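(* Let $\Gamma$ be an unoriented graph in which every vertex has exactly $g$ outgoing edges, let $D\subset\Gamma$ be a subgraph whose Green's function is finite, and let $F_1,F_2$ be two disjoint finite sets of vertices of $D$. Consider the soup of unoriented unrooted loops in $D$ with intensity $c=1$ (a Poisson point process with intensity $\nu$). Let $\eta_{1\leftrightarrow2}$ be the collection of (unoriented) parts of loops of the soup that join a point of $F_1$ to a point of $F_2$ and otherwise stay in the complement of $F_1\cup F_2$. Let $\mathcal Z$ be the vector of endpoints of these crossings in $F_2$, and $\mathcal Z'$ the vector of their endpoints in $F_1$. Then, conditionally on $\eta_{1\leftrightarrow2}$, the missing parts of the unoriented loops that these crossings are part of (these are the loops of the soup that intersect both $F_1$ and $F_2$) are described by two independent unordered unoriented bridges with respective conditional distributions $B^{D\setminus F_1}_{\mathcal Z}$ and $B^{D\setminus F_2}_{\mathcal Z'}$.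
   Context: **Graph, loops.** $\Gamma$ is a discrete unoriented graph; parallel edges and edges from a vertex to itself are allowed. Each unoriented edge can be traversed in two opposite directions, and an edge from $x$ to $x$ counts twice among the $g$ outgoing edges of $x$ (once for each direction of traversal). A rooted oriented loop with $n=|l|\ge1$ steps is $l=(l_0,e_1,l_1,\dots,e_n,l_n)$ with $l_0=l_n$ and $e_i$ an edge traversed from $l_{i-1}$ to $l_i$ (edges used and direction of traversal are part of the information). Put $p(l)=g^{-n}$, $\rho(l)=p(l)/n$. The time-reversal of $l$ is $\hat l=(l_n,e_n,l_{n-1},\dots,e_1,l_0)$ with all edges traversed in the opposite direction. An unrooted unoriented loop is an equivalence class of rooted oriented loops modulo rerooting (cyclic shift) and time-reversal. The measure $\nu$ on unrooted unoriented loops in $D$ is the image of $\rho/2$, restricted to loops in $D$, under the map sending a rooted oriented loop to its class. The soup of unoriented loops with intensity $c$ is a Poisson point process with intensity $c\,\nu$. **Bridges.** For a subgraph $D'$ and vertices $x,y$ of $D'$, a bridge $b$ from $x$ to $y$ in $D'$ is a finite nearest-neighbour path in $D'$ from $x$ to $y$ (keeping track of the edges used); $n(b)$ is its number of steps, and $n(b)=0$ is allowed if $x=y$. The Green's function is $G_{D'}(x,y)=\sum_b g^{-n(b)}$, summed over all bridges from $x$ to $y$ in $D'$; ''the Green's function of $D$ is finite'' means $G_D(x,y)<\infty$ for all $x,y$ in $D$. The bridge probability measure from $x$ to $y$ in $D'$ gives mass $g^{-n(b)}/G_{D'}(x,y)$ to each $b$; its image under time-reversal is the bridge probability measure from $y$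 to $x$. For $Z=(z_1,\dots,z_{2N})$, an unoriented (unordered) $Z$-bridge in $D'$ is a pairing $t$ of $\{1,\dots,2N\}$ into $N$ pairs together with, for each pair $\{i,j\}$ of $t$, an unoriented bridge in $D'$ joining the extremity labelled $i$ (at $z_i$) to the extremity labelled $j$ (at $z_j$), i.e. a bridge from $z_i$ to $z_j$ identified with its time-reversal viewed as a bridge from $z_j$ to $z_i$. The measure $B^{D'}_Z$ is the probability measure obtained by first sampling a pairing $\tau$ with $P(\tau=t)$ proportional to $\prod_{\{i,j\}\in t}G_{D'}(z_i,z_j)$, and then, given $\tau$, sampling independent unoriented bridges in $D'$ for the $N$ pairs according to the bridge probability measures. Equivalently, each $Z$-bridge has probability proportional to $g^{-K}$, with $K$ the total length of its $N$ bridges. (It is defined when this product is positive for some $t$.) $D\setminus F_i$ is $D$ with the vertices of $F_i$ removed. **Crossings and missing parts.** $\eta_{1\leftrightarrow2}$ lists, with multiplicity and ordered by a fixed deterministic rule, all portions $(a_0,e_1,a_1,\dots,e_n,a_n)$, $n\ge1$, viewed up to time-reversal, of loops of the soup such that one of $a_0,a_n$ is in $F_1$, the other is in $F_2$, and $a_1,\dots,a_{n-1}\in D\setminus(F_1\cup F_2)$. Their number is a.s. finite and even; the $j$-th coordinates of $\mathcal Z$ and $\mathcal Z'$ are the endpoints in $F_2$ and in $F_1$ of the $j$-th crossing. Removing all crossings from the loops of the soup that intersect both $F_1$ and $F_2$ leaves unoriented paths (possibly of length zero) of two types: paths in $D\setminus F_1$ joining the $F_2$-endpoints of two crossings, which together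 form a $\mathcal Z$-bridge in $D\setminus F_1$; and paths in $D\setminus F_2$ joining the $F_1$-endpoints of two crossings, which form a $\mathcal Z'$-bridge in $D\setminus F_2$. When some crossings coincide, this pair of bridges is only determined up to relabelling identical crossings; it is then chosen uniformly at random among all pairs consisting of a $\mathcal Z$-bridge in $D\setminus F_1$ and a $\mathcal Z'$-bridge in $D\setminus F_2$ which, concatenated with $\eta_{1\leftrightarrow2}$, give the collection of loops of the soup intersecting both $F_1$ and $F_2$. *)

(* Defs.v *)
From HB Require Import structures.
From mathcomp Require Import all_boot all_order all_algebra finmap.
From mathcomp Require Import generic_quotient.
From mathcomp Require Import all_classical all_reals all_analysis.

Set Implicit Arguments.
Unset Strict Implicit.
Unset Printing Implicit Defensive.

Import Order.TTheory GRing.Theory Num.Theory.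

Local Open Scope classical_set_scope.
Local Open Scope card_scope.
Local Open Scope ring_scope.
Local Open Scope quotient_scope.

(* An unoriented multigraph with loops, given by its edges together with a
   direction of traversal ("darts").  [flip a] is the same edge traversed
   backwards, so the unoriented edges are the pairs [{a, flip a}].  Since
   [flip] has no fixed point, an edge from [x] to [x] gives two darts issued
   from [x]. *)
Record graph := Graph {
  vertex : choiceType;
  dart : choiceType;
  src : dart -> vertex;
  flip : dart -> dart;
  flipK : involutive flip;
  flip_neq : forall a, flip a != a }.

Definition tgt (Gam : graph) (a : dart Gam) : vertex Gam := src (flip a).

Definition regular (Gam : graph) (g : nat) :=
  forall x : vertex Gam, [set a : dart Gam | src a = x] #= `I_g.

Record subgraph (Gam : graph) := Subgraph {
  sverts : set (vertex Gam);
  sdarts : set (dart Gam);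
  sdarts_flip : forall a, sdarts a -> sdarts (flip a);
  sdarts_src : forall a, sdarts a -> sverts (src a) }.

Section RemoveVertices.
Context (Gam : graph) (D : subgraph Gam) (F : {fset vertex Gam}).

Let verts : set (vertex Gam) := [set x | sverts D x /\ x \notin F].
Let darts : set (dart Gam) :=
  [set a | [/\ sdarts D a, src a \notin F & tgt a \notin F]].

Fact remove_flip a : darts a -> darts (flip a).
Proof.
case=> Da sa ta; split => //; first exact: sdarts_flip.
by rewrite /tgt flipK.
Qed.

Fact remove_src a : darts a -> verts (src a).
Proof. by case=> Da sa ta; split => //; exact: sdarts_src. Qed.

Definition remove_vertices : subgraph Gam := Subgraph remove_flip remove_src.

End RemoveVertices.

(* A path is encoded by the sequence of its darts, which determines the
   vertices that it visits.  [bflip] is time-reversal. *)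
Definition bflip (Gam : graph) (b : seq (dart Gam)) : seq (dart Gam) :=
  rev (map (@flip Gam) b).

Lemma size_bflip (Gam : graph) (b : seq (dart Gam)) : size (bflip b) = size b.
Proof. by rewrite size_rev size_map. Qed.

Lemma bflipK (Gam : graph) : involutive (@bflip Gam).
Proof.
move=> b; rewrite /bflip map_rev revK -map_comp map_id_in // => a _ /=.
exact: flipK.
Qed.

Section Loops.
Context (Gam : graph).
Implicit Types l : seq (dart Gam).

Definition is_loop l : bool :=
  (l != [::]) && cycle (fun a b => tgt a == src b) l.

Record rloop := RLoop { rloop_darts :> seq (dart Gam);
                        _ : is_loop rloop_darts }.

HB.instance Definition _ := [isSub for rloop_darts].
HB.instance Definition _ := [Choice of rloop by <:].

Definition same_loop l l' : bool :=
  (l' \in [seq rot i l | i <- iota 0 (size l).+1]) ||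
  (l' \in [seq rot i (bflip l) | i <- iota 0 (size l).+1]).

Lemma same_loopP l l' :
  reflect (exists i, l' = rot i l \/ l' = rot i (bflip l)) (same_loop l l').
Proof.
have mrot (s : seq (dart Gam)) : forall i, rot i s \in [seq rot j s | j <- iota 0 (size s).+1].
  move=> i; apply/mapP; exists (minn i (size s)); last exact: rot_minn.
  by rewrite mem_iota /= add0n ltnS geq_minr.
apply: (iffP orP) => [[/mapP[i _ ->]|/mapP[i _ ->]]|[i [->|->]]].
- by exists i; left.
- by exists i; right.
- by left; exact: mrot.
- by right; have := mrot (bflip l) i; rewrite size_bflip.
Qed.

Lemma bflip_rot i l : exists j, bflip (rot i l) = rot j (bflip l).
Proof. by eexists; rewrite /bflip map_rot rev_rot /rotr. Qed.

Lemma same_loop_refl : reflexive same_loop.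
Proof. by move=> l; apply/same_loopP; exists 0%N; left; rewrite rot0. Qed.

Lemma same_loop_sym : symmetric same_loop.
Proof.
suff sym l l' : same_loop l l' -> same_loop l' l.
  by move=> l l'; apply/idP/idP; exact: sym.
have rot_inv i (s : seq (dart Gam)) : exists j, s = rot j (rot i s).
  by exists (size (rot i s) - i)%N; rewrite -[LHS](rotK i) /rotr.
case/same_loopP=> i [->|->]; apply/same_loopP.
  by have [j ej] := rot_inv i l; exists j; left.
have [j ej] := bflip_rot i (bflip l).
have [k ek] := rot_inv j l; exists k; right.
by rewrite ej bflipK -ek.
Qed.

Lemma same_loop_trans : transitive same_loop.
Proof.
move=> m l r /same_loopP[i mi] /same_loopP[j rj]; apply/same_loopP.
have rr (s : seq (dart Gam)) : exists k, rot j (rot i s) = rot k s.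
  by rewrite rot_rot_add; eexists.
have rf (s : seq (dart Gam)) : exists k, rot j (bflip (rot i s)) = rot k (bflip s).
  by have [k ->] := bflip_rot i s; rewrite rot_rot_add; eexists.
case: mi rj => -> [] ->.
- by have [k ->] := rr l; exists k; left.
- by have [k ->] := rf l; exists k; right.
- by have [k ->] := rr (bflip l); exists k; right.
- by have [k ->] := rf (bflip l); exists k; left; rewrite bflipK.
Qed.

Definition rloop_eqv (l l' : rloop) : bool := same_loop l l'.

Fact rloop_eqv_refl : reflexive rloop_eqv.
Proof. by move=> l; exact: same_loop_refl. Qed.
Fact rloop_eqv_sym : symmetric rloop_eqv.
Proof. by move=> l l'; exact: same_loop_sym. Qed.
Fact rloop_eqv_trans : transitive rloop_eqv.
Proof. by move=> l m r; exact: same_loop_trans. Qed.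

Canonical rloop_equiv :=
  EquivRel rloop_eqv rloop_eqv_refl rloop_eqv_sym rloop_eqv_trans.

(* Unrooted unoriented loops. *)
Definition uloop := {eq_quot rloop_eqv}.

HB.instance Definition _ := Choice.on uloop.
HB.instance Definition _ := EqQuotient.on uloop.

Definition unroot (l : rloop) : uloop := \pi_uloop l.

(* The next three notions do not depend on the representative [repr L]. *)
Definition visits (F : {fset vertex Gam}) (L : uloop) : bool :=
  has (fun a => src a \in F) (repr L).

(* [l] is the sequence of darts of a rooted oriented loop of the class [L]. *)
Definition represents l (L : uloop) : bool := same_loop (repr L) l.

(* Number of portions of [L] that are equal to [c] or to its time-reversal;
   only used when [c] joins two disjoint sets and is therefore different from
   its time-reversal and strictly shorter than any loop that contains it. *)
Definition occ (L : uloop) (c : seq (dart Gam)) : nat :=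
  let l : seq (dart Gam) := repr L in
  (count (fun i => prefix c (rot i l)) (iota 0 (size l)) +
   count (fun i => prefix (bflip c) (rot i l)) (iota 0 (size l)))%N.

End Loops.

Section Measures.
Context (R : realType) (Gam : graph) (g : nat).
Implicit Types (D : subgraph Gam) (x y : vertex Gam).

Fixpoint bridge D x (b : seq (dart Gam)) y : bool :=
  if b is a :: b' then
    [&& src a == x, a \in sdarts D & bridge D (tgt a) b' y]
  else (x == y) && (x \in sverts D).

Definition weight (b : seq (dart Gam)) : R := (g%:R ^+ size b)^-1.

Definition green D x y : \bar R :=
  (\esum_(b in [set b | bridge D x b y]) (weight b)%:E)%E.

Definition finite_green D :=
  forall x y, sverts D x -> sverts D y -> (green D x y < +oo)%E.

Definition in_subgraph D (l : rloop Gam) := forall a, a \in (l : seq _) -> sdarts D a.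

Definition rho (l : rloop Gam) : R := weight l / (size l)%:R.

Definition nu D (A : set (uloop Gam)) : \bar R :=
  (\esum_(l in [set l | in_subgraph D l /\ A (unroot l)]) (rho l / 2)%:E)%E.

End Measures.

Section PoissonPointProcess.
Context (R : realType) (d : measure_display) (Omega : measurableType d).
Context (P : probability Omega R) (T : choiceType).
Implicit Types (N : Omega -> T -> nat) (mu : set T -> \bar R).

(* A random collection of points of [T] with multiplicities is given by the
   multiplicity [N w t] of each point [t]; [npoints n A] is the number of
   points in [A]. *)
Definition npoints (n : T -> nat) (A : set T) : \bar R :=
  (\esum_(t in A) (n t)%:R%:E)%E.

(* The second argument of the library's [poisson_prob] is a dummy. *)
Definition poisson_point_process N mu :=
  (forall t k, measurable [set w | N w t = k]) /\
  forall (m : nat) (A : 'I_m -> set T) (k : 'I_m -> nat),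
    (forall i, (mu (A i) < +oo)%E) -> trivIset setT A ->
    (forall i, measurable [set w | npoints (N w) (A i) = (k i)%:R%:E]) /\
    P (\bigcap_(i in setT) [set w | npoints (N w) (A i) = (k i)%:R%:E]) =
    (\prod_(i < m) poisson_prob (fine (mu (A i))) 0 [set k i])%E.

Definition events_of N : set (set Omega) :=
  <<s [set E | exists t k, E = [set w | N w t = k]] >>.

Definition uniform_mass (X : choiceType) (S : set X) (x : X) : R :=
  if x \in S then (#|` fset_set S|%:R)^-1 else 0.

(* [M] is a random variable with values in the discrete space [X] whose
   conditional law given the whole process [N] is uniform on [S (N w)]. *)
Definition uniform_given N (X : choiceType) (M : Omega -> X)
    (S : (T -> nat) -> set X) :=
  (forall A : set X, measurable (M @^-1` A)) /\
  forall (E : set Omega) (x : X), events_of N E ->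
    P (E `&` [set w | M w = x]) =
    (\int[P]_(w in E) (uniform_mass (S (N w)) x)%:E)%E.

End PoissonPointProcess.

Section Crossings.
Context (Gam : graph) (D : subgraph Gam) (F1 F2 : {fset vertex Gam}).

(* A path of positive length, as its first dart and its other darts.  As [F1]
   and [F2] are disjoint, each unoriented crossing has exactly one orientation
   from [F1] to [F2], by which it is represented. *)
Definition nepath := (dart Gam * seq (dart Gam))%type.

Definition darts_of (c : nepath) : seq (dart Gam) := c.1 :: c.2.

Definition start (c : nepath) : vertex Gam := src c.1.
Definition finish (c : nepath) : vertex Gam := tgt (last c.1 c.2).

Definition is_crossing (c : nepath) : bool :=
  [&& path (fun a b => tgt a == src b) c.1 c.2,
      all (fun a => a \in sdarts D) (darts_of c),
      start c \in F1, finish c \in F2 &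
      all (fun a => (src a \notin F1) && (src a \notin F2)) c.2].

Definition crossing_mult (R : realType) (n : uloop Gam -> nat) (c : nepath) :
    \bar R :=
  if is_crossing c then
    (\esum_(L in setT) (n L * occ L (darts_of c))%N%:R%:E)%E
  else 0%E.

(* A deterministic rule to order finite collections with multiplicities. *)
Definition ordering_rule (rule : seq nepath -> seq nepath) :=
  (forall s, perm_eq (rule s) s) /\
  (forall s s', perm_eq s s' -> rule s = rule s').

(* [s] is the ordered list of the crossings of the collection of loops [n]. *)
Definition eta_is (R : realType) (rule : seq nepath -> seq nepath)
    (n : uloop Gam -> nat) (s : seq nepath) :=
  rule s = s /\
  forall c, crossing_mult R n c = (count_mem c s)%:R%:E.

Definition endpoints1 (s : seq nepath) (i : 'I_(size s)) : vertex Gam :=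
  start (tnth (in_tuple s) i).
Definition endpoints2 (s : seq nepath) (i : 'I_(size s)) : vertex Gam :=
  finish (tnth (in_tuple s) i).

End Crossings.

Section PairedBridges.
Context (R : realType) (Gam : graph) (g : nat).
Implicit Types (D : subgraph Gam).

(* For each label [i], the label [beta.1 i] with which it is paired and the
   bridge [beta.2 i] seen from [i].  The same bridge seen from [beta.1 i] has
   to be its time-reversal (see [is_zbridge]), so that bridges are unoriented. *)
Definition zbridge (n : nat) : Type :=
  ({ffun 'I_n -> 'I_n} * {ffun 'I_n -> seq (dart Gam)})%type.

HB.instance Definition _ n := Choice.on (zbridge n).

Definition is_pairing n (t : {ffun 'I_n -> 'I_n}) : bool :=
  [forall i, (t i != i) && (t (t i) == i)].

Definition is_zbridge D n (z : 'I_n -> vertex Gam) (beta : zbridge n) : bool :=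
  is_pairing beta.1 &&
  [forall i, bridge D (z i) (beta.2 i) (z (beta.1 i)) &&
             (beta.2 (beta.1 i) == bflip (beta.2 i))].

(* Products over the pairs [{i, t i}] are indexed by the smaller label. *)
Definition pairing_weight D n (z : 'I_n -> vertex Gam) (t : {ffun 'I_n -> 'I_n}) : R :=
  \prod_(i : 'I_n | (i < t i)%N) fine (green R g D (z i) (z (t i))).

Definition pairing_prob D n (z : 'I_n -> vertex Gam) (t : {ffun 'I_n -> 'I_n}) : R :=
  pairing_weight D z t /
  \sum_(t' : {ffun 'I_n -> 'I_n} | is_pairing t') pairing_weight D z t'.

Definition bridge_prob D x y (b : seq (dart Gam)) : R :=
  weight R g b / fine (green R g D x y).

Definition zbridge_mass D n (z : 'I_n -> vertex Gam) (beta : zbridge n) : R :=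
  pairing_prob D z beta.1 *
  \prod_(i : 'I_n | (i < beta.1 i)%N) bridge_prob D (z i) (z (beta.1 i)) (beta.2 i).

(* The measure B^D_z on unordered unoriented bridges. *)
Definition zbridge_measure D n (z : 'I_n -> vertex Gam) (S : set (zbridge n)) :
    \bar R :=
  (\esum_(beta in [set beta | is_zbridge D z beta /\ S beta])
     (zbridge_mass D z beta)%:E)%E.

End PairedBridges.

Section MissingParts.
Context (R : realType) (Gam : graph) (D : subgraph Gam).
Context (F1 F2 : {fset vertex Gam}).

Definition zbridge_pair (n : nat) : Type := (zbridge Gam n * zbridge Gam n)%type.

HB.instance Definition _ n := Choice.on (zbridge_pair n).

Section Concatenation.
Context (s : seq (nepath Gam)) (b : zbridge_pair (size s)).

Let crossing (i : 'I_(size s)) : seq (dart Gam) := darts_of (tnth (in_tuple s) i).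

(* Start on [F1], follow crossing [j], the bridge in the complement of [F1]
   from its end to that of its partner [k], crossing [k] backwards, and then
   the bridge in the complement of [F2] from the start of crossing [k]. *)
Definition lap (j : 'I_(size s)) : seq (dart Gam) :=
  let k := b.1.1 j in
  crossing j ++ b.1.2 j ++ bflip (crossing k) ++ b.2.2 k.

Definition trail (i : 'I_(size s)) : seq (dart Gam) :=
  flatten [seq lap j | j <- orbit (b.2.1 \o b.1.1) i].

Definition linked (i j : 'I_(size s)) : bool := (j == b.1.1 i) || (j == b.2.1 i).

(* One loop for each connected component of the graph [linked]; starting from
   another label of the component gives the same unrooted unoriented loop. *)
Definition concatenation (L : uloop Gam) : nat :=
  count (fun i => represents (trail i) L) (enum (roots linked)).

End Concatenation.

(* The collection of the loops of [n] that intersect both [F1] and [F2]. *)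
Definition crossing_loops (n : uloop Gam -> nat) (L : uloop Gam) : nat :=
  if visits F1 L && visits F2 L then n L else 0%N.

Definition admissible (rule : seq (nepath Gam) -> seq (nepath Gam))
    (n : uloop Gam -> nat) : set {m : nat & zbridge_pair m} :=
  [set x | exists s (b : zbridge_pair (size s)),
    [/\ eta_is D F1 F2 R rule n s,
        x = Tagged zbridge_pair b,
        is_zbridge (remove_vertices D F1) (@endpoints2 _ s) b.1,
        is_zbridge (remove_vertices D F2) (@endpoints1 _ s) b.2 &
        concatenation b = crossing_loops n]].

End MissingParts.

(* Main.v *)
(* Write [m] for the multiplicities of the loops that visit both [F1] and [F2].
   A loop class [L] has [nu L = g ^- |L| / sym L], where [sym L] is the number
   of rerootings and time-reversals that fix a representative of [L], so that
   the Poisson law gives [m] a probability proportional to the product of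
   [(g ^- |L| / sym L) ^+ m L / (m L)`!].  The group of the permutations of the
   labels that preserve the ordered list [s] of the crossings acts transitively
   on the pairs of bridges whose concatenation is [m], with stabilisers of
   cardinal [\prod_L (sym L ^+ m L * (m L)`!)].  Choosing one of these pairs
   uniformly therefore cancels all symmetry factors: a given pair has
   probability [C(s) * g ^- (total length of the bridges)], and this weight is
   a product of a function of the first bridge and one of the second. *)

Require Import Defs.
From mathcomp Require Import fingroup perm generic_quotient.
From mathcomp Require Import all_boot all_order all_algebra finmap zify ring.
From mathcomp Require Import all_classical all_reals all_analysis.

Set Implicit Arguments.
Unset Strict Implicit.
Unset Printing Implicit Defensive.

(** * Rerooting and time-reversal *)

(** The delicate point is transitivity together with the exact stabiliser: a loop is a cyclic word
    without origin, and periodic loops or repeated crossings make labels indistinguishable. Unique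
    parsing makes the count exact. The rootings and orientations of a loop that begin with a full
    crossing from [F1] to [F2] are exactly the trails of the labels of its component, and such a
    word, read twice around, determines its laps, hence crossings, bridges and links. Equality of
    two trails thus produces a morphism between components, and a morphism from a connected linkage
    is determined by the image of one label. Stabilisers are counted as embeddings of a model built
    component by component, through identities between natural numbers in which only positive
    factors are cancelled.

    No normalising constant is evaluated: the weight identity is used a second time with both sets
    of bridges full, which yields the probability of the list of crossings with the same [C(s)]. The
    graph may be uncountable; countability of the relevant families comes from walks issued from the
    finite sets [F1] and [F2]. *)

Section Rotations.
Context (T : eqType).
Implicit Types (l x y z : seq T) (p q : pred T) (ws : seq (seq T)).

Definition rots l := [seq rot k l | k <- iota 0 (size l)].

Lemma size_rots l : size (rots l) = size l.
Proof. by rewrite size_map size_iota. Qed.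

Lemma rots_rot1 l : rots (rot 1 l) = rot 1 (rots l).
Proof.
case: (posnP (size l)) => [/size0nil -> //|l0].
have -> : rots l = [:: l] ++ [seq rot k l | k <- iota 1 (size l).-1].
  by rewrite /rots -[in LHS](prednK l0) /= rot0.
rewrite (rot_size_cat [:: l]) /rots size_rot.
have -> : iota 0 (size l) = iota 0 (size l).-1 ++ [:: (size l).-1].
  by rewrite -{1}(prednK l0) -addn1 iotaD.
rewrite map_cat; congr (_ ++ _); last first.
  by rewrite /= -rotD ?addn1 prednK // rot_size.
rewrite -[iota 1 _]/(iota (1 + 0) _) iotaDl -map_comp; apply/eq_in_map => k.
rewrite mem_iota /= add0n => kl; rewrite -rotD; first by rewrite addnC.
by rewrite addn1 -(prednK l0) ltnS ltnW.
Qed.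

Lemma perm_rots_rot j l : perm_eq (rots (rot j l)) (rots l).
Proof.
have rots0 s : perm_eq (rots (rot 0 s)) (rots s) by rewrite rot0.
elim: j => // j IH; case: (ltnP j (size l)) => jl; last first.
  by rewrite rot_oversize // leqW.
by rewrite rotS // rots_rot1 perm_rot.
Qed.

Lemma rots_rotr j l : map (rotr j) (rots l) = rots (rotr j l).
Proof.
rewrite /rots size_rotr -map_comp; apply: eq_map => k /=.
by rewrite rot_rotr.
Qed.

Lemma perm_map_rotr_rots j l : perm_eq (map (rotr j) (rots l)) (rots l).
Proof. by rewrite rots_rotr /rotr perm_rots_rot. Qed.

(** A rotation of the flattened word cuts either between two blocks or strictly inside one. [P]
    rejects the inner cuts, and a boundary cut is the flattening of a rotation of the list of
    blocks. Empty blocks are excluded because they would make several boundaries coincide. *)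
Lemma count_rots_flatten (P : pred (seq T)) ws :
  all (fun w => w != [::]) ws ->
  (forall a o, a < size ws -> 0 < o < size (nth [::] ws a) ->
     ~~ P (rot o (flatten (rot a ws)))) ->
  count P (rots (flatten ws)) =
  count P [seq flatten (rot a ws) | a <- iota 0 (size ws)].
Proof.
move=> ws0 wsP.
(* Induction on the blocks [ws2] still to be scanned; [ws1] only records the offset. *)
suff gen ws2 ws1 : ws = ws1 ++ ws2 ->
    count P [seq rot k (flatten ws) | k <- iota (size (flatten ws1)) (size (flatten ws2))] =
    count P [seq flatten (rot a ws) | a <- iota (size ws1) (size ws2)].
  exact: (gen ws [::]).
elim: ws2 ws1 => [//|w ws2 IH] ws1 ews.
have szw : size w = (size w).-1.+1.
  rewrite prednK // lt0n size_eq0.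
  by move/allP: ws0; apply; rewrite ews mem_cat inE eqxx orbT.
rewrite [flatten (w :: _)]/= size_cat iotaD map_cat count_cat -size_cat.
have -> : size (flatten ws1 ++ w) = size (flatten (rcons ws1 w)).
  by rewrite flatten_rcons.
rewrite IH ?cat_rcons // size_rcons [in RHS]/=; congr (_ + _).
have rt o : rot (size (flatten ws1) + o) (flatten ws) = rot o (flatten (rot (size ws1) ws))
    \/ size w < o.
  case: (ltnP (size w) o) => ow; [by right|left].
  rewrite addnC rotD; last first.
    by rewrite ews flatten_cat /= !size_cat; lia.
  by rewrite ews rot_size_cat !flatten_cat rot_size_cat.
rewrite szw -[size (flatten ws1)]addn0 iotaDl -map_comp /= -[RHS]addn0.
congr (nat_of_bool (P _) + _); first by case: (rt 0) => [->|//]; rewrite rot0.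
rewrite count_map; apply/eqP; rewrite -leqn0 leqNgt -has_count; apply/hasPn => o.
rewrite mem_iota /= => oi; case: (rt o) => [->|]; last by lia.
apply: wsP; first by rewrite ews size_cat /=; lia.
by rewrite ews nth_cat ltnn subnn /=; lia.
Qed.

(** The cut sits at the first letter that violates [p]. *)
Lemma catsplit_inj p x y x' y' : all p x -> all p x' ->
  ~~ nilp y -> ~~ nilp y' -> ~~ head false (map p y) -> ~~ head false (map p y') ->
  x ++ y = x' ++ y' -> x = x' /\ y = y'.
Proof.
elim: x x' y y' => [|a x IH] [|a' x'] y y' //=.
- by case: y => //= b y _ /andP[pa' _] _ _ /negP pb _ [eb _]; rewrite eb in pb.
- by case: y' => //= b y' /andP[pa _] _ _ _ _ /negP pb [eb _]; rewrite -eb in pb.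
move=> /andP[_ px] /andP[_ px'] ny ny' hy hy' [<- e].
by have [<- <-] := IH x' y y' px px' ny ny' hy hy' e.
Qed.

End Rotations.

Section Dihedral.
Context (Gam : graph).
Implicit Types (l y : seq (dart Gam)).

Lemma bflip_inj : injective (@bflip Gam).
Proof. exact: inv_inj (@bflipK Gam). Qed.

Lemma bflip_cat (a b : seq (dart Gam)) : bflip (a ++ b) = bflip b ++ bflip a.
Proof. by rewrite /bflip map_cat rev_cat. Qed.

Lemma bflip_rot_rotr k l : bflip (rot k l) = rotr k (bflip l).
Proof. by rewrite /bflip map_rot rev_rot. Qed.

Lemma perm_bflip_rots l : perm_eq (map (@bflip Gam) (rots l)) (rots (bflip l)).
Proof.
(* Reversal turns the rotation by [k] into the rotation by [size l - k], so that the range [0..n-1]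
   becomes [1..n]; this shift by one is harmless for rotations. *)
have -> : map (@bflip Gam) (rots l) =
    [seq rot k (bflip l) | k <- rev (iota 1 (size l))].
  rewrite /rots -map_comp.
  have -> : rev (iota 1 (size l)) = [seq size l - k | k <- iota 0 (size l)].
    apply: (@eq_from_nth _ 0) => [|i]; first by rewrite size_rev size_map !size_iota.
    rewrite size_rev size_iota => il.
    by rewrite nth_rev size_iota // (nth_map 0) ?size_iota // !nth_iota; lia.
  rewrite -map_comp; apply: eq_map => k /=.
  by rewrite bflip_rot_rotr /rotr size_bflip.
rewrite map_rev perm_rev.
have -> : [seq rot k (bflip l) | k <- iota 1 (size l)] = rots (rot 1 (bflip l)).
  rewrite /rots size_rot size_bflip -[1%N]/(1 + 0)%N iotaDl -map_comp.
  apply/eq_in_map => k; rewrite mem_iota /= add0n => kl.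
  by rewrite -rotD; [rewrite addnC | rewrite size_bflip addn1].
exact: perm_rots_rot.
Qed.

(* The orbit of [l] under rerooting and time-reversal, each loop being listed
   as often as there are symmetries of [l]. *)
Definition dih l := rots l ++ rots (bflip l).

Lemma size_dih l : size (dih l) = (size l).*2.
Proof. by rewrite size_cat !size_rots size_bflip addnn. Qed.

Lemma perm_dih_bflip l : perm_eq (dih (bflip l)) (dih l).
Proof. by rewrite /dih bflipK perm_catC. Qed.

Lemma perm_dih_rot k l : perm_eq (dih (rot k l)) (dih l).
Proof.
apply: perm_cat; first exact: perm_rots_rot.
by rewrite bflip_rot_rotr perm_rots_rot.
Qed.

Lemma perm_dih l l' : same_loop l l' -> perm_eq (dih l') (dih l).
Proof.
case/same_loopP => i [->|->]; first exact: perm_dih_rot.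
exact: perm_trans (perm_dih_rot _ _) (perm_dih_bflip l).
Qed.

Lemma perm_map_bflip_dih l : perm_eq (map (@bflip Gam) (dih l)) (dih l).
Proof.
rewrite map_cat (perm_trans _ (perm_dih_bflip l)) // /dih.
by apply: perm_cat; exact: perm_bflip_rots.
Qed.

Lemma perm_map_rotr_dih k l : perm_eq (map (rotr k) (dih l)) (dih l).
Proof. by rewrite map_cat perm_cat // perm_map_rotr_rots. Qed.

Lemma mem_rots l y : l != [::] ->
  (y \in rots l) = (y \in [seq rot i l | i <- iota 0 (size l).+1]).
Proof.
move=> l0; apply/idP/idP.
  by rewrite -[(size l).+1]addn1 iotaD map_cat mem_cat => ->.
case/mapP => i; rewrite mem_iota /= add0n ltnS leq_eqVlt => /predU1P[->|il] ->.
  apply/mapP; exists 0; rewrite ?rot_size ?rot0 // mem_iota /= add0n lt0n.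
  by rewrite size_eq0.
by apply/mapP; exists i; rewrite // mem_iota.
Qed.

Lemma mem_dih l y : l != [::] -> (y \in dih l) = same_loop l y.
Proof.
move=> l0; have fl0 : bflip l != [::] by rewrite -size_eq0 size_bflip size_eq0.
by rewrite mem_cat !mem_rots // size_bflip.
Qed.

(** Rotations and reversal are injective and permute [dih l], so multiplicities are constant along
    the orbit. *)
Lemma count_mem_dih l y y' : same_loop y y' ->
  count_mem y' (dih l) = count_mem y (dih l).
Proof.
have inj_count (f : seq (dart Gam) -> seq (dart Gam)) : injective f ->
    perm_eq (map f (dih l)) (dih l) ->
    forall z, count_mem (f z) (dih l) = count_mem z (dih l).
  move=> f_inj /permP fl z; rewrite -fl count_map; apply: eq_count => x /=.
  exact: (inj_eq f_inj).
have rot_count i z : count_mem (rot i z) (dih l) = count_mem z (dih l).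
  have := inj_count (rotr i) (@rotr_inj i _) (perm_map_rotr_dih i l) (rot i z).
  by rewrite rotK.
case/same_loopP => i [->|->]; rewrite rot_count //.
by rewrite inj_count //; [exact: bflip_inj | exact: perm_map_bflip_dih].
Qed.

Definition symmetries l := count_mem l (dih l).

Lemma count_mem_dih_symmetries l y : same_loop l y ->
  count_mem y (dih l) = symmetries l.
Proof. exact: count_mem_dih. Qed.

(** Orbit-stabiliser count: the [2 n] entries of [dih l] are the distinct rootings, each repeated
    [symmetries l] times. *)
Lemma size_undup_dih l : l != [::] ->
  size (undup (dih l)) * symmetries l = (size l).*2.
Proof.
move=> l0; rewrite -size_dih -(perm_size (perm_count_undup (dih l))) size_flatten.
rewrite /shape -map_comp sumnE big_map (eq_big_seq (fun=> symmetries l)) => [|y].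
  by rewrite big_const_seq count_predT iter_addn_0 mulnC.
by rewrite /= size_nseq mem_undup mem_dih // => /count_mem_dih_symmetries.
Qed.

End Dihedral.

(** * Decomposition of words into laps *)

Section Words.
Context (T : eqType).
Implicit Types (p q : pred T) (x y u b d : seq T).

Definition starts p x := head false (map p x).

Lemma starts_cat p x y : starts p x -> starts p (x ++ y).
Proof. by case: x. Qed.

(** Letters stand for darts, and [p], [q] for having the source in one or the other finite set. Only
    sources are recorded: the arrival of a crossing shows as the first letter of what follows it. *)
Definition excursion p q x :=
  if x is a :: x' then p a && all (fun a => ~~ p a && ~~ q a) x' else false.

Definition bridging p q x := all (fun a => ~~ p a) x && (nilp x || starts q x).

Lemma excursion_starts p q x : excursion p q x -> starts p x.
Proof. by case: x => //= a x /andP[]. Qed.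

Lemma starts_bridging p q b y : bridging p q b -> starts q y -> starts q (b ++ y).
Proof. by case: b => // a b /andP[_]. Qed.

(** Three landmarks fix the cuts: [u] stops at the first [q]-letter, [b ++ d] stops at the next
    [p]-letter, and [d] begins at the last [q]-letter in between. *)
Lemma half_inj p q u b d y u' b' d' y' :
  excursion p q u -> bridging p q b -> excursion q p d -> starts p y ->
  excursion p q u' -> bridging p q b' -> excursion q p d' -> starts p y' ->
  (forall a, p a -> ~~ q a) ->
  u ++ b ++ d ++ y = u' ++ b' ++ d' ++ y' ->
  [/\ u = u', b = b', d = d' & y = y'].
Proof.
move=> hu hb hd hy hu' hb' hd' hy' pq e.
have pred_split r x z x' z' : starts r z -> starts r z' ->
    all (fun a => ~~ r a) x -> all (fun a => ~~ r a) x' ->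
    x ++ z = x' ++ z' -> x = x' /\ z = z'.
  move=> hz hz' ax ax'; apply: (catsplit_inj ax ax').
  - by case: z hz.
  - by case: z' hz'.
  - by case: z hz => //= c t; rewrite /starts /= => ->.
  - by case: z' hz' => //= c t; rewrite /starts /= => ->.
have stq v w : bridging p q v -> excursion q p w -> starts q (v ++ w).
  by move=> hv hw; apply: starts_bridging hv (excursion_starts hw).
case: u hu e => // a x /andP[pa nx] e; case: u' hu' e => // a' x' /andP[pa' nx'] [ea e].
have [ex e1] : x = x' /\ b ++ d ++ y = b' ++ d' ++ y'.
  apply: (pred_split q) e.
  - by rewrite catA starts_cat ?stq.
  - by rewrite catA starts_cat ?stq.
  - by apply: sub_all nx => c /andP[].
  - by apply: sub_all nx' => c /andP[].
have notp v w : bridging p q v -> excursion q p w -> all (fun a => ~~ p a) (v ++ w).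
  rewrite all_cat => /andP[-> _]; case: w => //= c w /andP[qc nw].
  apply/andP; split; first by apply: contraL qc; exact: pq.
  by apply: sub_all nw => z /andP[].
have [e2 ey] : b ++ d = b' ++ d' /\ y = y'.
  by apply: (pred_split p) => //; rewrite ?notp // -!catA.
case: d hd e2 {e e1 notp stq} => // c z /andP[qc nz] e2.
case: d' hd' e2 => // c' z' /andP[qc' nz'] e2.
(* Reading backwards turns the last [q]-letter into the first one. *)
have : rev z ++ (c :: rev b) = rev z' ++ (c' :: rev b').
  by rewrite -!cat_rcons -!rev_cons -!rev_cat e2.
have nq w : all (fun a => ~~ q a && ~~ p a) w -> all (fun a => ~~ q a) (rev w).
  by rewrite all_rev => nw; apply: sub_all nw => t /andP[].
case/(pred_split q); rewrite ?nq //= => /(can_inj revK) -> [-> /(can_inj revK) ->].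
by rewrite ea ex ey.
Qed.

Section Laps.
Context (p q : pred T).
Hypothesis pq : forall a, p a -> ~~ q a.

Let qp a : q a -> ~~ p a. Proof. by apply: contraL; exact: pq. Qed.

Definition lapword u b d b' :=
  [&& excursion p q u, bridging p q b, excursion q p d & bridging q p b'].

(* [x] starts with a full crossing. *)
Definition crossing_first x :=
  if x is a :: x' then p a && starts q [seq c <- x' | p c || q c] else false.

Lemma excursion_filter p' q' x : excursion p' q' x ->
  [seq c <- behead x | p' c || q' c] = [::].
Proof.
case: x => //= a x /andP[_]; elim: x => //= c x IH /andP[/andP[pc qc] /IH ->].
by rewrite (negPf pc) (negPf qc).
Qed.

Lemma crossing_first_cat u y : excursion p q u -> starts q y -> crossing_first (u ++ y).
Proof.
move=> hu hy; have := excursion_filter hu.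
case: u hu => // a u /andP[pa _] /= fu; rewrite pa filter_cat fu /=.
by case: y hy => //= c y qc; rewrite [q c]qc orbT.
Qed.

Lemma lapword_crossing u b d b' y : lapword u b d b' ->
  crossing_first ((u ++ b ++ d ++ b') ++ y).
Proof.
case/and4P=> hu hb hd hb'; rewrite -!catA; apply: crossing_first_cat => //.
by apply: starts_bridging hb _; apply: starts_cat; exact: excursion_starts hd.
Qed.

(** Two uses of [half_inj], with [p] and [q] exchanged in the second. The next crossing [y] and its
    arrival in [z] must be visible, since [b'] ends just before the last [p]-letter that precedes
    the next [q]-letter. *)
Lemma lapword_inj u b d b' u' c d' c' y z y' z' :
  lapword u b d b' -> lapword u' c d' c' ->
  excursion p q y -> starts q z -> excursion p q y' -> starts q z' ->
  (u ++ b ++ d ++ b') ++ y ++ z = (u' ++ c ++ d' ++ c') ++ y' ++ z' ->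
  [/\ u = u', b = c, d = d', b' = c' & y ++ z = y' ++ z'].
Proof.
case/and4P=> hu hb hd hb' /and4P[hu' hc hd' hc'] hy hz hy' hz'; rewrite -!catA => e.
have st v w t : bridging q p v -> excursion p q w -> starts p (v ++ w ++ t).
  by move=> hv hw; apply: starts_bridging hv _; apply: starts_cat; exact: excursion_starts hw.
have [-> -> ed e'] := half_inj hu hb hd (st _ _ _ hb' hy) hu' hc hd' (st _ _ _ hc' hy') pq e.
have [-> -> -> ->] := half_inj hd hb' hy hz hd' hc' hy' hz' qp (congr2 cat ed e').
by [].
Qed.

(** A cut after the first letter of [u ++ b ++ d] leaves a word that does not start with [p]. A cut
    inside [b'] leaves no [q] before [y] or the wrapped-around beginning of the lap, both of which
    start with [p]. *)
Lemma crossing_first_inside u b d b' y o :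
  lapword u b d b' -> nilp y || starts p y ->
  0 < o < size (u ++ b ++ d ++ b') ->
  ~~ crossing_first (rot o ((u ++ b ++ d ++ b') ++ y)).
Proof.
set w := u ++ b ++ d ++ b'.
move=> hw hy /andP[n0 ow].
have [hu hb hd hb'] := and4P hw.
have -> : rot o (w ++ y) = drop o w ++ y ++ take o w.
  by rewrite /rot drop_cat take_cat ow catA.
have tp : starts p (take o w).
  by rewrite /w; case: (u) (excursion_starts hu) n0 => //= a s pa; case: (o).
have notp v : all (fun a => ~~ p a) v -> forall n c s, drop n v = c :: s -> ~~ p c.
  by move=> /allP nv n c s e; apply: nv; apply: (@mem_drop n); rewrite e inE eqxx.
have ew : w = (u ++ b ++ d) ++ b' by rewrite -!catA.
have nub : all (fun a => ~~ p a) (behead (u ++ b ++ d)).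
  case: (u) hu => // a s /andP[_ ns] /=; rewrite !all_cat; apply/and3P; split.
  - by apply: sub_all ns => c /andP[].
  - by case/andP: hb.
  - case: (d) hd => //= c t /andP[qc nt]; rewrite qp //=.
    by apply: sub_all nt => z /andP[].
rewrite ew drop_cat; case: ltnP => uo.
  have [a [s e]] : exists a s, drop o (u ++ b ++ d) = a :: s.
    case e : (drop o _) => [|a s]; last by exists a, s.
    by move: (size_drop o (u ++ b ++ d)); rewrite e /=; lia.
  rewrite e /=; suff -> : p a = false by [].
  apply/negbTE; apply: (notp _ nub o.-1 a s).
  by rewrite -drop1 drop_drop addn1 prednK.
have nq : all (fun a => ~~ q a) (drop (o - size (u ++ b ++ d)) b').
  case/andP: hb' => /allP nb' _; apply/allP => c /mem_drop; exact: nb'.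
have filt s r : all (fun a => ~~ q a) s -> starts p r ->
    ~~ starts q [seq c <- s ++ r | p c || q c].
  elim: s => [_|c s IH /andP[nqc nqs] pr] /=.
    by case: r => //= c r pc; rewrite [p c]pc /=; exact: pq.
  by rewrite (negPf nqc) orbF; case: ifP => _; [exact: nqc | exact: IH].
case e : (drop _ _) nq => [|a s] nq.
  move: (size_drop (o - size (u ++ b ++ d)) b'); rewrite e /=.
  by move: ow; rewrite ew size_cat; lia.
rewrite /= negb_and orbC filt //; first by case/andP: nq.
by rewrite -ew; case: (y) hy.
Qed.

End Laps.
End Words.

(** * Linkages and their trails *)

Section Bridges.
Context (Gam : graph).
Implicit Types (D : subgraph Gam) (b : seq (dart Gam)) (x y z : vertex Gam).

Lemma tgt_flip (a : dart Gam) : tgt (flip a) = src a.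
Proof. by rewrite /tgt flipK. Qed.

Lemma sdarts_tgt D (a : dart Gam) : a \in sdarts D -> tgt a \in sverts D.
Proof.
by move=> /set_mem aD; apply/mem_set; apply: sdarts_src; exact: sdarts_flip.
Qed.

Lemma bridge_verts D x b y : bridge D x b y -> (x \in sverts D) && (y \in sverts D).
Proof.
elim: b x => [|a b IH] x /=; first by case/andP => /eqP -> ->.
case/and3P => /eqP <- aD /IH /andP[_ ->]; rewrite andbT.
by apply/mem_set; apply: sdarts_src; exact: set_mem.
Qed.

Lemma bridge_tgt D x b y : bridge D x b y -> x :: map (@tgt Gam) b = rcons (map (@src Gam) b) y.
Proof.
elim: b x => [|a b IH] x /=; first by case/andP => /eqP ->.
by case/and3P => /eqP <- _ /IH ->.
Qed.

Lemma bridge_cat D x a y b z :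
  bridge D x a y -> bridge D y b z -> bridge D x (a ++ b) z.
Proof.
elim: a x => [|c a IH] x /=; first by case/andP => /eqP ->.
by case/and3P => -> -> /IH.
Qed.

Lemma bridge_bflip D x b y : bridge D x b y -> bridge D y (bflip b) x.
Proof.
elim: b x => [|a b IH] x /=; first by case/andP => /eqP -> ->; rewrite eqxx.
case/and3P => /eqP <- aD /IH yb.
have -> : bflip (a :: b) = bflip b ++ [:: flip a] by rewrite /bflip /= rev_cons cats1.
apply: (bridge_cat yb).
rewrite /= tgt_flip /tgt eqxx /= eqxx /=; apply/andP; split; apply/mem_set.
  by apply: sdarts_flip; exact: set_mem.
by apply: sdarts_src; exact: set_mem.
Qed.

Lemma bridge_remove D F x b y : bridge (remove_vertices D F) x b y -> bridge D x b y.
Proof.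
elim: b x => [|a b IH] x /=.
  by case/andP => -> /set_mem[/mem_set ->].
by case/and3P => -> /set_mem[/mem_set -> _ _] /IH.
Qed.

Lemma bridge_avoid D (F : {fset vertex Gam}) x b y :
  bridge (remove_vertices D F) x b y -> all (fun a => src a \notin F) b.
Proof.
by elim: b x => //= a b IH x /and3P[_ /set_mem[_ ->] _ /IH].
Qed.

Lemma bridge_starts D x b y (F : {fset vertex Gam}) : x \in F ->
  bridge D x b y -> nilp b || starts (fun a => src a \in F) b.
Proof. by move=> xF; case: b => //= a b /and3P[/eqP ax _ _]; rewrite /starts /= ax. Qed.

Lemma bridge_darts D x b y : bridge D x b y -> forall a, a \in b -> sdarts D a.
Proof.
elim: b x => //= c b IH x /and3P[_ /set_mem cD /IH bD] a.
by rewrite inE => /predU1P[->|/bD].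
Qed.

Lemma bridgeE D a b y : bridge D (src a) (a :: b) y =
  [&& path (fun a c => tgt a == src c) a b,
      all (fun c => c \in sdarts D) (a :: b) & tgt (last a b) == y].
Proof.
rewrite /= eqxx /=; elim: b a => [|c b IH] a /=.
  rewrite andbT; case aD: (a \in _) => //=.
  by rewrite (sdarts_tgt aD) andbT.
rewrite [src c == _]eq_sym IH; case: (_ == _) => /=; last by rewrite andbF.
by case: (path _ _ _); case: (a \in _); rewrite ?andbF.
Qed.

Lemma bridge_is_loop D x b : b != [::] -> bridge D x b x -> is_loop b.
Proof.
case: b => // a b _ xb; have := xb; rewrite /= => /and3P[/eqP ax _ _].
move: xb; rewrite -ax bridgeE => /and3P[pab _ e].
by rewrite /is_loop /= rcons_path pab e.
Qed.

Lemma is_loop_bridge D a b : is_loop (a :: b) ->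
  (forall c, c \in a :: b -> sdarts D c) -> bridge D (src a) (a :: b) (src a).
Proof.
move=> abl abD; rewrite bridgeE; apply/and3P.
case/andP: abl => _; rewrite /cycle rcons_path => /andP[pab e].
by split=> //; apply/allP => c /abD /mem_set.
Qed.

End Bridges.

Section CrossingWords.
Context (Gam : graph) (D : subgraph Gam) (F1 F2 : {fset vertex Gam}).
Hypothesis F12 : [disjoint F1 & F2]%fset.

Definition in1 (a : dart Gam) := src a \in F1.
Definition in2 (a : dart Gam) := src a \in F2.

Lemma in1N2 a : in1 a -> ~~ in2 a.
Proof. by move=> a1; apply/negP => a2; have /fdisjointP/(_ _ a1)/negP := F12. Qed.

Lemma crossing_bridge c : is_crossing D F1 F2 c ->
  bridge D (start c) (darts_of c) (finish c).
Proof. by case/and5P => pc cD _ _ _; rewrite bridgeE pc cD eqxx. Qed.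

Lemma crossing_excursion c : is_crossing D F1 F2 c -> excursion in1 in2 (darts_of c).
Proof. by case/and5P => _ _ c1 _ cN; rewrite /= [in1 _]c1. Qed.

Lemma crossing_excursion_flip c : is_crossing D F1 F2 c ->
  excursion in2 in1 (bflip (darts_of c)).
Proof.
move=> cc; have cb := crossing_bridge cc.
have e : map (@src Gam) (bflip (darts_of c)) = finish c :: rev (map (@src Gam) c.2).
  rewrite -rev_rcons; have := bridge_tgt cb; rewrite /= => -[<-].
  by rewrite /bflip map_rev -map_comp.
case: (bflip _) e => //= a b [ea eb]; case/and5P: cc => _ _ _ c2 cN.
rewrite /in2 ea c2 /=; apply/allP => d db.
have : src d \in rev (map (@src Gam) c.2) by rewrite -eb map_f.
by rewrite mem_rev => /mapP[d' /(allP cN)]; rewrite /in1 => /andP[h1 h2] ->; rewrite h1 h2.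
Qed.

Lemma crossing_start c : is_crossing D F1 F2 c -> start c \in F1.
Proof. by case/and5P. Qed.

Lemma crossing_finish c : is_crossing D F1 F2 c -> finish c \in F2.
Proof. by case/and5P. Qed.

Lemma bridge_bridging1 x b y : x \in F2 ->
  bridge (remove_vertices D F1) x b y -> bridging in1 in2 b.
Proof.
move=> x2 xb; apply/andP; split; first exact: bridge_avoid xb.
exact: bridge_starts xb.
Qed.

Lemma bridge_bridging2 x b y : x \in F1 ->
  bridge (remove_vertices D F2) x b y -> bridging in2 in1 b.
Proof.
move=> x2 xb; apply/andP; split; first exact: bridge_avoid xb.
exact: bridge_starts xb.
Qed.

Lemma darts_of_inj : injective (@darts_of Gam).
Proof. by case=> a b [c d] [-> ->]. Qed.

(* [zbridge_pair] over arbitrary labels, so that linkages can be assembled from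
   their connected components. *)
Record linkage (J : finType) := Linkage {
  lab : J -> nepath Gam;
  lk1 : J -> J;
  lk2 : J -> J;
  br1 : J -> seq (dart Gam);
  br2 : J -> seq (dart Gam) }.

Record linkage_wf (J : finType) (x : linkage J) : Prop := LinkageWf {
  lk1K : involutive (lk1 x);
  lk1_neq : forall i, lk1 x i != i;
  lk2K : involutive (lk2 x);
  lk2_neq : forall i, lk2 x i != i;
  lab_crossing : forall i, is_crossing D F1 F2 (lab x i);
  br1_bridge : forall i,
    bridge (remove_vertices D F1) (finish (lab x i)) (br1 x i) (finish (lab x (lk1 x i)));
  br1_flip : forall i, br1 x (lk1 x i) = bflip (br1 x i);
  br2_bridge : forall i,
    bridge (remove_vertices D F2) (start (lab x i)) (br2 x i) (start (lab x (lk2 x i)));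
  br2_flip : forall i, br2 x (lk2 x i) = bflip (br2 x i) }.

Section Trails.
Context (J : finType) (x : linkage J).

(** The next crossing that the same sense of traversal follows from [F1] to [F2], one lap later. *)
Definition hop := lk2 x \o lk1 x.

Definition link_lap (j : J) := darts_of (lab x j) ++ br1 x j ++
  bflip (darts_of (lab x (lk1 x j))) ++ br2 x (lk1 x j).

Definition link_trail (i : J) := flatten [seq link_lap j | j <- orbit hop i].

(** An orbit of [hop] collects the crossings that one sense of traversal follows from [F1] to [F2];
    [lk1] adds those that the opposite sense follows in this direction. *)
Definition component (i : J) := orbit hop i ++ map (lk1 x) (orbit hop i).

Hypothesis wf : linkage_wf x.

Let i1 := lk1K wf.
Let i2 := lk2K wf.

Lemma hop_inj : injective hop.
Proof. by apply: inj_comp; [exact: inv_inj i2 | exact: inv_inj i1]. Qed.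

Lemma iter_hop_order i : iter (order hop i) hop i = i.
Proof. exact: (iter_order hop_inj). Qed.

Lemma orbit_iter a i : a < order hop i ->
  orbit hop (iter a hop i) = rot a (orbit hop i).
Proof.
move=> ai; have -> := orbitE (cycle_orbit hop_inj i) (orbit_uniq _ _)
    (_ : iter a hop i \in orbit hop i).
  by rewrite -[in RHS](findex_iter ai).
by rewrite -fconnect_orbit fconnect_iter.
Qed.

Lemma order_iter a i : order hop (iter a hop i) = order hop i.
Proof.
have := eq_order_cycle (cycle_orbit hop_inj i) (in_orbit hop i) (y := iter a hop i).
by rewrite -fconnect_orbit fconnect_iter => ->.
Qed.

Lemma lk1_hop i : lk1 x (hop (lk1 x (hop i))) = i.
Proof. by rewrite /hop /= i1 i2 i1. Qed.

(** The dihedral relation: [lk1] conjugates [hop] to its inverse. *)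
Lemma hop_lk1_iter a i : iter a hop (lk1 x (iter a hop i)) = lk1 x i.
Proof.
elim: a i => // a IH i; rewrite iterSr iterS.
by have -> : hop (lk1 x (hop (iter a hop i))) = lk1 x (iter a hop i)
  by rewrite -[LHS]i1 lk1_hop.
Qed.

Lemma order_lk1 i : order hop (lk1 x i) = order hop i.
Proof.
suff le j : order hop (lk1 x j) <= order hop j.
  by apply/eqP; rewrite eqn_leq le -{1}[i]i1 le.
have h := hop_lk1_iter (order hop j) j; rewrite iter_hop_order in h.
rewrite leqNgt; apply/negP => /findex_iter; rewrite h findex0 => e.
by have := order_gt0 hop j; rewrite -e.
Qed.

(* A label fixed by [lk1] or [lk2] would have to sit halfway between [i] and
   [lk1 i] on a common orbit. *)
Lemma orbit_lk1_disjoint i : lk1 x i \notin orbit hop i.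
Proof.
suff h a j : iter a hop j != lk1 x j.
  by apply/negP; rewrite -fconnect_orbit => /iter_findex /eqP; rewrite (negPf (h _ _)).
(* Both ends move inwards: [iter a.+2 hop j = lk1 j] gives [iter a hop (hop j) = lk1 (hop j)]. The
   exponents 0 and 1 contradict [lk1_neq] and [lk2_neq]. *)
elim/ltn_ind: a j => -[|[|a]] IH j.
- by rewrite /= eq_sym lk1_neq.
- by rewrite /= /hop /= lk2_neq.
apply: contra (IH a _ (hop j)) => //= /eqP e; apply/eqP.
by apply: hop_inj; rewrite -iterS iterSr -iterSr -iterSr iterS iterS e -[LHS]i1 -[RHS]i1 lk1_hop i1.
Qed.

Definition laps i n := flatten (map link_lap (traject hop i n)).

Lemma link_trailE i : link_trail i = laps i (order hop i).
Proof. by []. Qed.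

Lemma lapsS i n : laps i n.+1 = link_lap i ++ laps (hop i) n.
Proof. by []. Qed.

Lemma lapsSr i n : laps i n.+1 = laps i n ++ link_lap (iter n hop i).
Proof. by rewrite /laps trajectSr map_rcons flatten_rcons. Qed.

Lemma link_trailS i :
  link_trail i = link_lap i ++ laps (hop i) (order hop i).-1.
Proof. by rewrite link_trailE -orderSpred lapsS. Qed.

Lemma link_trail_hop i : link_trail (hop i) = rot (size (link_lap i)) (link_trail i).
Proof.
rewrite (link_trailS i) rot_size_cat link_trailE (order_iter 1) -{1}(orderSpred hop i).
by rewrite lapsSr -iterSr orderSpred iter_hop_order.
Qed.

(** A reversed lap is again a lap, except that its bridge avoiding [F2] comes in front instead of at
    the end; appending [br2 x i] completes the lap of [lk1 x i]. *)
Lemma bflip_lap i : bflip (link_lap i) ++ br2 x i =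
  br2 x (hop i) ++ link_lap (lk1 x i).
Proof.
by rewrite /link_lap !bflip_cat bflipK i1 -(br1_flip wf) -(br2_flip wf) -!catA.
Qed.

Lemma bflip_laps i n : bflip (laps i n) ++ br2 x i =
  br2 x (iter n hop i) ++ laps (lk2 x (iter n hop i)) n.
Proof.
elim: n i => [|n IH] i; first by rewrite /= cats0.
rewrite lapsS bflip_cat -catA bflip_lap catA IH -iterSr lapsSr -catA.
congr (_ ++ (_ ++ link_lap _)).
by rewrite iterS /hop /= i2 -/hop hop_lk1_iter.
Qed.

Lemma order_lk2 i : order hop (lk2 x i) = order hop i.
Proof. by rewrite -{1}(i1 i) -[lk2 x _]/(iter 1 hop (lk1 x i)) order_iter order_lk1. Qed.

Lemma size_br2_trail i : size (br2 x i) <= size (link_trail i).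
Proof.
(* [j] precedes [i] on its orbit, so [br2 x i] is the reversal of the bridge that closes the trail
   of [i]. *)
set j := iter (order hop i).-1 hop i.
have ji : hop j = i by rewrite /j -iterS orderSpred iter_hop_order.
have -> : size (br2 x i) = size (br2 x (lk1 x j)).
  by rewrite -[in LHS]ji /hop /= (br2_flip wf) size_bflip.
by rewrite link_trailE -orderSpred lapsSr -/j /link_lap !size_cat; clear F12; lia.
Qed.

(** The reversed trail begins with the bridge [br2 x i]; moving it to the end gives a word that
    starts with a crossing, the trail of the opposite traversal. *)
Lemma link_trail_lk2 i : link_trail (lk2 x i) = rot (size (br2 x i)) (bflip (link_trail i)).
Proof.
have := bflip_laps i (order hop i); rewrite iter_hop_order -link_trailE.
rewrite -[in laps _ _]order_lk2 -link_trailE => e.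
have sz := size_br2_trail i; rewrite -(size_bflip (link_trail i)) in sz.
move/eqP: e; rewrite -{1}(cat_take_drop (size (br2 x i)) (bflip (link_trail i))) -catA.
by rewrite eqseq_cat ?size_takel // => /andP[/eqP e /eqP <-]; rewrite /rot e.
Qed.

Lemma same_loop_hop i : same_loop (link_trail i) (link_trail (hop i)).
Proof. by apply/same_loopP; exists (size (link_lap i)); left; rewrite link_trail_hop. Qed.

Lemma same_loop_lk2 i : same_loop (link_trail i) (link_trail (lk2 x i)).
Proof. by apply/same_loopP; exists (size (br2 x i)); right; rewrite link_trail_lk2. Qed.

Lemma same_loop_lk1 i : same_loop (link_trail i) (link_trail (lk1 x i)).
Proof.
have := same_loop_lk2 (hop i); rewrite /hop /= i2.
exact: same_loop_trans (same_loop_hop i).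
Qed.

Lemma fconnect_hop_sym i j : fconnect hop i j = fconnect hop j i.
Proof. exact: (fconnect_sym hop_inj). Qed.

Lemma lk1_orbit i j : (lk1 x j \in orbit hop (lk1 x i)) = (j \in orbit hop i).
Proof.
suff h a b : b \in orbit hop a -> lk1 x b \in orbit hop (lk1 x a).
  by apply/idP/idP => /h //; rewrite !i1.
rewrite -!fconnect_orbit => /iter_findex <-.
by rewrite fconnect_hop_sym -(hop_lk1_iter (findex hop a b) a) fconnect_iter.
Qed.

Lemma mem_map_lk1 (s : seq J) j : (j \in map (lk1 x) s) = (lk1 x j \in s).
Proof. by rewrite -{1}(i1 j) mem_map //; exact: inv_inj. Qed.

Lemma mem_component i j : (j \in component i) = (j \in orbit hop i) || (lk1 x j \in orbit hop i).
Proof. by rewrite mem_cat mem_map_lk1. Qed.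

Lemma component_uniq i : uniq (component i).
Proof.
rewrite cat_uniq orbit_uniq (map_inj_uniq (inv_inj i1)) orbit_uniq andbT /=.
apply/hasPn => j; rewrite mem_map_lk1 => ji; apply/negP => ji'.
have := orbit_lk1_disjoint j; rewrite -fconnect_orbit => /negP; apply.
apply: (@connect_trans _ _ i); last by rewrite fconnect_orbit.
by rewrite fconnect_hop_sym fconnect_orbit.
Qed.

Lemma size_component i : size (component i) = (order hop i).*2.
Proof. by rewrite size_cat size_map size_orbit addnn. Qed.

Lemma mem_component_refl i : i \in component i.
Proof. by rewrite mem_component in_orbit. Qed.

Lemma orbit_sym i j : (i \in orbit hop j) = (j \in orbit hop i).
Proof. by rewrite -!fconnect_orbit fconnect_hop_sym. Qed.

Lemma orbit_trans i j k : j \in orbit hop i -> k \in orbit hop j -> k \in orbit hop i.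
Proof. by rewrite -!fconnect_orbit; exact: connect_trans. Qed.

Lemma mem_component_sym i j : (i \in component j) = (j \in component i).
Proof. by rewrite !mem_component (orbit_sym i j) -(lk1_orbit j) i1 (orbit_sym i). Qed.

Lemma mem_component_trans i j k : j \in component i -> k \in component j -> k \in component i.
Proof.
rewrite !mem_component => /orP[ji|ji] /orP[kj|kj].
- by rewrite (orbit_trans ji kj).
- by rewrite (orbit_trans ji kj) orbT.
- by rewrite -lk1_orbit in kj; rewrite (orbit_trans ji kj) orbT.
- by rewrite -lk1_orbit i1 in kj; rewrite (orbit_trans ji kj).
Qed.

Lemma eq_component i j : j \in component i -> component j =i component i.
Proof.
move=> ji k; apply/idP/idP; first exact: mem_component_trans.
by apply: mem_component_trans; rewrite mem_component_sym.
Qed.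

Lemma mem_component_lk1 i j : (lk1 x j \in component i) = (j \in component i).
Proof. by rewrite !mem_component i1 orbC. Qed.

Lemma mem_component_hop i j : (hop j \in component i) = (j \in component i).
Proof.
have h : hop j \in component j by rewrite mem_component (mem_orbit (in_orbit hop j)).
by rewrite mem_component_sym (eq_component h) mem_component_sym.
Qed.

Lemma mem_component_lk2 i j : (lk2 x j \in component i) = (j \in component i).
Proof. by rewrite -{1}(i1 j) mem_component_hop mem_component_lk1. Qed.

Lemma same_loop_component i j : j \in component i -> same_loop (link_trail i) (link_trail j).
Proof.
suff orb k : k \in orbit hop i -> same_loop (link_trail i) (link_trail k).
  rewrite mem_component => /orP[/orb //|/orb h]; apply: same_loop_trans h _.
  by have := same_loop_lk1 (lk1 x j); rewrite i1.
rewrite -fconnect_orbit => /iter_findex <-; elim: (findex _ _ _) => [|n IH] /=.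
  exact: same_loop_refl.
exact: same_loop_trans IH (same_loop_hop _).
Qed.

Lemma link_lapword i : lapword in1 in2 (darts_of (lab x i)) (br1 x i)
  (bflip (darts_of (lab x (lk1 x i)))) (br2 x (lk1 x i)).
Proof.
apply/and4P; split.
- exact: crossing_excursion (lab_crossing wf i).
- apply: bridge_bridging1 (br1_bridge wf i).
  exact: crossing_finish (lab_crossing wf i).
- exact: crossing_excursion_flip (lab_crossing wf _).
- apply: bridge_bridging2 (br2_bridge wf _).
  exact: crossing_start (lab_crossing wf _).
Qed.

Lemma link_lap_bridge i : bridge D (start (lab x i)) (link_lap i) (start (lab x (hop i))).
Proof.
apply: bridge_cat (crossing_bridge (lab_crossing wf i)) _.
apply: bridge_cat (bridge_remove (br1_bridge wf i)) _.
apply: bridge_cat (bridge_bflip (crossing_bridge (lab_crossing wf _))) _.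
exact: bridge_remove (br2_bridge wf _).
Qed.

Lemma laps_bridge i n : bridge D (start (lab x i)) (laps i n) (start (lab x (iter n hop i))).
Proof.
elim: n i => [|n IH] i.
  by rewrite /= eqxx; case/andP: (bridge_verts (link_lap_bridge i)).
by rewrite lapsS iterSr; apply: bridge_cat (link_lap_bridge i) _.
Qed.

Lemma link_trail_bridge i :
  bridge D (start (lab x i)) (link_trail i) (start (lab x i)).
Proof. by have := laps_bridge i (order hop i); rewrite iter_hop_order. Qed.

Lemma link_trail_neq0 i : link_trail i != [::].
Proof. by rewrite link_trailS. Qed.

Lemma link_trail_is_loop i : is_loop (link_trail i).
Proof. exact: bridge_is_loop (link_trail_neq0 i) (link_trail_bridge i). Qed.

Lemma crossing_first_laps i n : crossing_first in1 in2 (laps i n.+1).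
Proof. by rewrite lapsS; apply: lapword_crossing; exact: link_lapword. Qed.

Lemma crossing_first_trail i : crossing_first in1 in2 (link_trail i).
Proof. by rewrite link_trailE -orderSpred crossing_first_laps. Qed.

Lemma starts_laps i n : nilp (laps i n) || starts in1 (laps i n).
Proof.
case: n => // n; rewrite lapsS.
by rewrite !starts_cat ?orbT //; apply: excursion_starts (crossing_excursion (lab_crossing wf i)).
Qed.

Lemma perm_orbit_lk2 i : perm_eq (orbit hop (lk2 x i)) (map (lk1 x) (orbit hop i)).
Proof.
apply: uniq_perm; first exact: orbit_uniq.
  by rewrite (map_inj_uniq (inv_inj i1)) orbit_uniq.
move=> j; rewrite mem_map_lk1 -[X in _ = (_ \in orbit _ X)]i1 lk1_orbit.
have e : fconnect hop (lk1 x i) (lk2 x i).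
  by rewrite -{2}(i1 i) -[lk2 x _]/(hop (lk1 x i)) fconnect_orbit (mem_orbit (in_orbit _ _)).
by rewrite -!fconnect_orbit (same_connect (fconnect_sym hop_inj) e).
Qed.

(** Rotations that cut inside a lap do not begin with a full crossing; those that cut between laps
    are the trails of the labels of the orbit. *)
Lemma count_rots_trail (P : pred (seq (dart Gam))) i :
  (forall l, P l -> crossing_first in1 in2 l) ->
  count P (rots (link_trail i)) = count (P \o link_trail) (orbit hop i).
Proof.
move=> P1; rewrite count_rots_flatten.
- rewrite -[RHS]count_map; congr (count P _); rewrite size_map size_orbit /orbit.
  apply: (@eq_from_nth _ [::]) => [|a]; rewrite !size_map size_iota ?size_traject //.
  move=> ai; rewrite (nth_map 0) ?size_iota // nth_iota // (nth_map i) ?size_traject //.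
  by rewrite nth_traject // add0n -map_rot -orbit_iter.
- by apply/allP => w /mapP[j _ ->].
- move=> a o; rewrite size_map size_orbit => ai.
  rewrite (nth_map i) ?size_orbit // nth_traject // => oi.
  apply: contra (P1 _) _; rewrite -map_rot -orbit_iter // -/(link_trail _) link_trailS.
  exact: (crossing_first_inside in1N2 (link_lapword (iter a hop i)) (starts_laps _ _) oi).
Qed.

(* The labels of the component of [i] correspond to the ways of rooting and
   orienting its loop that start with a crossing from [F1] to [F2]. *)
Lemma count_dih_trail (P : pred (seq (dart Gam))) i :
  (forall l, P l -> crossing_first in1 in2 l) ->
  count P (dih (link_trail i)) = count (P \o link_trail) (component i).
Proof.
move=> P1; rewrite !count_cat count_rots_trail //; congr (_ + _).
rewrite -(permP (perm_rots_rot (size (br2 x i)) _)) -link_trail_lk2 count_rots_trail //.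
exact: permP (perm_orbit_lk2 i) _.
Qed.

End Trails.
End CrossingWords.

(** * Morphisms of linkages *)

Section Embeddings.
Context (Gam : graph) (D : subgraph Gam) (F1 F2 : {fset vertex Gam}).
Hypothesis F12 : [disjoint F1 & F2]%fset.
Local Notation wf := (linkage_wf D F1 F2).

Lemma order_le (T : finType) (f : T -> T) i n : 0 < n -> iter n f i = i -> order f i <= n.
Proof.
move=> n0 e; rewrite leqNgt; apply/negP => /findex_iter; rewrite e findex0 => e'.
by rewrite -e' in n0.
Qed.

Lemma iter_mod_order (T : finType) (f : T -> T) i n : injective f ->
  iter n f i = iter (n %% order f i) f i.
Proof.
move=> f_inj; rewrite {1}(divn_eq n (order f i)) addnC iterD; congr iter.
by elim: (n %/ _) => // k IH; rewrite mulSn iterD IH iter_order.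
Qed.

Lemma findex_iter_mod (T : finType) (f : T -> T) i n : injective f ->
  findex f i (iter n f i) = n %% order f i.
Proof.
by move=> f_inj; rewrite iter_mod_order // findex_iter // ltn_mod order_gt0.
Qed.

Section TrailInjectivity.
Context (J J' : finType) (x : linkage Gam J) (y : linkage Gam J').
Hypotheses (wx : wf x) (wy : wf y).

Definition same_lap i j := [/\ lab x i = lab y j, br1 x i = br1 y j,
  lab x (lk1 x i) = lab y (lk1 y j) & br2 x (lk1 x i) = br2 y (lk1 y j)].

Lemma same_lapE i j : same_lap i j -> link_lap x i = link_lap y j.
Proof. by case=> e1 e2 e3 e4; rewrite /link_lap e1 e2 e3 e4. Qed.

(** A lap can be read off only when another one follows it, hence at least two laps on either
    side. *)
Lemma laps_step i j n m : laps x i n.+2 = laps y j m.+2 ->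
  same_lap i j /\ laps x (hop x i) n.+1 = laps y (hop y j) m.+1.
Proof.
have split_lap (K : finType) (z : linkage Gam K) (wz : wf z) k p :
    exists2 r, laps z k p.+1 = darts_of (lab z k) ++ r & starts (in2 F2) r.
  exists (br1 z k ++ bflip (darts_of (lab z (lk1 z k))) ++ br2 z (lk1 z k) ++ laps z (hop z k) p).
    by rewrite lapsS /link_lap -!catA.
  have /and4P[_ h1 h2 _] := link_lapword wz k.
  by apply: starts_bridging h1 _; apply: starts_cat; exact: excursion_starts h2.
have [r e1 s1] := split_lap J x wx (hop x i) n; have [r' e2 s2] := split_lap J' y wy (hop y j) m.
rewrite lapsS [in RHS]lapsS {}e1 {}e2 /link_lap => e.
have [] := lapword_inj (in1N2 F12) (link_lapword wx i) (link_lapword wy j)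
  (crossing_excursion (lab_crossing wx (hop x i))) s1
  (crossing_excursion (lab_crossing wy (hop y j))) s2 e.
move=> /darts_of_inj h1 h2 /bflip_inj/darts_of_inj h3 h4 h5.
by split.
Qed.

Lemma laps_inj k i j n m : laps x i (k + n.+1) = laps y j (k + m.+1) ->
  forall a, a < k -> same_lap (iter a (hop x) i) (iter a (hop y) j).
Proof.
elim: k i j => // k IH i j; rewrite !addSn !addnS => /laps_step[e e'] [|a] //.
by rewrite ltnS !iterSr; apply: IH; rewrite !addnS.
Qed.

Lemma laps_same k i j :
  (forall a, a < k -> same_lap (iter a (hop x) i) (iter a (hop y) j)) ->
  laps x i k = laps y j k.
Proof.
elim: k => // k IH h; rewrite !lapsSr IH => [|a ak]; last by apply: h; exact: ltnW.
by rewrite (same_lapE (h k _)).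
Qed.

Lemma laps_cat (K : finType) (z : linkage Gam K) k n m :
  laps z k (n + m) = laps z k n ++ laps z (iter n (hop z) k) m.
Proof. by rewrite /laps trajectD map_cat flatten_cat. Qed.

Lemma link_trail_double (K : finType) (z : linkage Gam K) (wz : wf z) k :
  laps z k (order (hop z) k + order (hop z) k) = link_trail z k ++ link_trail z k.
Proof. by rewrite laps_cat (iter_hop_order wz). Qed.

Lemma link_trail_order_le i j : link_trail x i = link_trail y j ->
  order (hop x) i <= order (hop y) j ->
  order (hop x) i = order (hop y) j /\
  forall a, same_lap (iter a (hop x) i) (iter a (hop y) j).
Proof.
move=> e le; have h0 := order_gt0 (hop x) i; have h0' := order_gt0 (hop y) j.
have same a : a < order (hop x) i -> same_lap (iter a (hop x) i) (iter a (hop y) j).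
  (* Both trails are read twice around, so that every lap of the first turn has a successor. *)
  apply: (@laps_inj _ _ _ (order (hop x) i).-1
    (order (hop y) j - order (hop x) i + (order (hop y) j).-1)).
  rewrite prednK // link_trail_double // e -link_trail_double //.
  by congr (laps y j _); lia.
have eo : order (hop x) i = order (hop y) j.
  apply/eqP; rewrite eqn_leq le /=.
  (* If the second orbit were longer, its surplus laps would have total length zero, whereas a lap
     contains at least one dart. *)
  have := congr1 size e; rewrite !link_trailE (laps_same same).
  rewrite -[in X in _ = X](subnKC le) laps_cat size_cat.
  case d: (_ - _) => [|n]; first by move/eqP: d; rewrite subn_eq0.
  rewrite lapsS /link_lap !size_cat /=; lia.
split=> // a; rewrite (iter_mod_order _ _ (hop_inj wx)) (iter_mod_order _ _ (hop_inj wy)) -eo.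
by apply: same; rewrite ltn_mod.
Qed.

End TrailInjectivity.

Section SameTrail.
Context (J J' : finType) (x : linkage Gam J) (y : linkage Gam J').
Hypotheses (wx : wf x) (wy : wf y).

Lemma link_trail_inj i j : link_trail x i = link_trail y j ->
  order (hop x) i = order (hop y) j /\
  forall a, same_lap x y (iter a (hop x) i) (iter a (hop y) j).
Proof.
move=> e; case: (leqP (order (hop x) i) (order (hop y) j)) => [|/ltnW] le.
  exact: link_trail_order_le.
have [-> h] := link_trail_order_le wy wx (esym e) le.
by split=> // a; have [? ? ? ?] := h a.
Qed.

Context (i : J) (j : J').
Hypothesis e : link_trail x i = link_trail y j.

Lemma same_order : order (hop x) i = order (hop y) j.
Proof. by case: (link_trail_inj e). Qed.

Lemma same_lab : lab x i = lab y j.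
Proof. by case: (link_trail_inj e) => _ /(_ 0)[]. Qed.

Lemma same_br1 : br1 x i = br1 y j.
Proof. by case: (link_trail_inj e) => _ /(_ 0)[]. Qed.

Lemma same_br2 : br2 x i = br2 y j.
Proof.
(* [br2 x i] is not part of the first lap: it is the reversal of the bridge that ends the last
   one. *)
have [eo /(_ (order (hop x) i).-1)[_ _ _]] := link_trail_inj e.
have br2E (K : finType) (z : linkage Gam K) (wz : wf z) k :
    br2 z k = bflip (br2 z (lk1 z (iter (order (hop z) k).-1 (hop z) k))).
  by rewrite -(br2_flip wz) -[lk2 z _]/(hop z _) -iterS orderSpred (iter_hop_order wz).
by move=> h; rewrite (br2E _ _ wx i) h eo -(br2E _ _ wy).
Qed.

Lemma same_trail_hop : link_trail x (hop x i) = link_trail y (hop y j).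
Proof.
rewrite (link_trail_hop wx) (link_trail_hop wy) e.
have [_ /(_ 0)/same_lapE sl] := link_trail_inj e.
by rewrite sl.
Qed.

Lemma same_trail_lk2 : link_trail x (lk2 x i) = link_trail y (lk2 y j).
Proof. by rewrite (link_trail_lk2 wx) (link_trail_lk2 wy) e same_br2. Qed.

End SameTrail.

Section SameTrailLk1.
Context (J J' : finType) (x : linkage Gam J) (y : linkage Gam J').
Hypotheses (wx : wf x) (wy : wf y).

Lemma same_trail_lk1 i j : link_trail x i = link_trail y j ->
  link_trail x (lk1 x i) = link_trail y (lk1 y j).
Proof.
move=> e; have := same_trail_lk2 wx wy (same_trail_hop wx wy e).
by rewrite /hop /= !(lk2K wx, lk2K wy).
Qed.

Lemma same_trail_iter i j a : link_trail x i = link_trail y j ->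
  link_trail x (iter a (hop x) i) = link_trail y (iter a (hop y) j).
Proof. by move=> e; elim: a => //= a IH; exact: same_trail_hop. Qed.

Definition link_hom (f : J -> J') := [forall i,
  [&& lab y (f i) == lab x i, br1 y (f i) == br1 x i, br2 y (f i) == br2 x i,
      lk1 y (f i) == f (lk1 x i) & lk2 y (f i) == f (lk2 x i)]].

Lemma link_homP f : reflect
  [/\ forall i, lab y (f i) = lab x i, forall i, br1 y (f i) = br1 x i,
      forall i, br2 y (f i) = br2 x i, forall i, lk1 y (f i) = f (lk1 x i) &
      forall i, lk2 y (f i) = f (lk2 x i)] (link_hom f).
Proof.
apply: (iffP forallP) => [h|[h1 h2 h3 h4 h5] i].
  by split=> i; have /and5P[/eqP ? /eqP ? /eqP ? /eqP ? /eqP ?] := h i.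
by rewrite h1 h2 h3 h4 h5 !eqxx.
Qed.

Lemma link_hom_iter f i a : link_hom f -> iter a (hop y) (f i) = f (iter a (hop x) i).
Proof.
case/link_homP=> _ _ _ h1 h2; elim: a => //= a ->.
by rewrite /hop /= h1 h2.
Qed.

(** Injectivity makes [f] preserve the order of [hop]; otherwise a long orbit could wrap several
    times around a shorter one. *)
Lemma link_hom_trail f i : link_hom f -> injective f ->
  link_trail y (f i) = link_trail x i.
Proof.
move=> hf f_inj; have [h1 h2 h3 h4 h5] := link_homP _ hf.
have eo : order (hop y) (f i) = order (hop x) i.
  apply/eqP; rewrite eqn_leq; apply/andP; split; apply: order_le; rewrite ?order_gt0 //.
    by rewrite link_hom_iter // (iter_hop_order wx).
  by apply: f_inj; rewrite -link_hom_iter // (iter_hop_order wy).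
rewrite !link_trailE eo; apply: laps_same => a _.
by rewrite link_hom_iter //; split; rewrite ?h4.
Qed.

Context (i0 : J).
Hypothesis conn : forall i, i \in component x i0.

Lemma component_iterP i : exists a, i = iter a (hop x) i0 \/ i = lk1 x (iter a (hop x) i0).
Proof.
have := conn i; rewrite (mem_component wx) -!fconnect_orbit => /orP[] /iter_findex h.
  by exists (findex (hop x) i0 i); left.
by exists (findex (hop x) i0 (lk1 x i)); right; rewrite h (lk1K wx).
Qed.

Lemma connected_hom_inj f f' : link_hom f -> link_hom f' -> f i0 = f' i0 -> f =1 f'.
Proof.
move=> hf hf' e i; have [_ _ _ h4 _] := link_homP _ hf; have [_ _ _ h4' _] := link_homP _ hf'.
have [a [->|->]] := component_iterP i; first by rewrite -!link_hom_iter // e.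
by rewrite -h4 -h4' -!link_hom_iter // e.
Qed.

(** Equal trails have the same laps all along both orbits. Transporting the iterates of [hop], and
    then their images under [lk1], is therefore compatible with all the data, and it is well defined
    since the orders agree and the two halves of a component are disjoint. *)
Lemma connected_hom_exists j0 : link_trail x i0 = link_trail y j0 ->
  exists f : J -> J', [/\ link_hom f, injective f & f i0 = j0].
Proof.
move=> e; have eo := same_order wx wy e.
pose g i := iter (findex (hop x) i0 i) (hop y) j0.
pose f i := if i \in orbit (hop x) i0 then g i else lk1 y (g (lk1 x i)).
have gE a : g (iter a (hop x) i0) = iter a (hop y) j0.
  rewrite /g findex_iter_mod; last exact: hop_inj wx.
  by rewrite eo -iter_mod_order //; exact: hop_inj wy.
have orb (K : finType) (z : linkage Gam K) (wz : wf z) a k :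
    lk1 z (iter a (hop z) k) \notin orbit (hop z) k.
  apply/negP; rewrite -fconnect_orbit => h.
  have := orbit_lk1_disjoint wz (iter a (hop z) k); rewrite -fconnect_orbit => /negP; apply.
  by apply: connect_trans h; rewrite (fconnect_hop_sym wz) fconnect_iter.
have f1 a : f (iter a (hop x) i0) = iter a (hop y) j0.
  by rewrite /f -fconnect_orbit fconnect_iter.
have f2 a : f (lk1 x (iter a (hop x) i0)) = lk1 y (iter a (hop y) j0).
  by rewrite /f (negPf (orb _ _ wx _ _)) (lk1K wx) gE.
have ft i : link_trail x i = link_trail y (f i).
  have [a [->|->]] := component_iterP i; rewrite ?f1 ?f2; first exact: same_trail_iter.
  by apply: same_trail_lk1; exact: same_trail_iter.
have hopE (K : finType) (z : linkage Gam K) (wz : wf z) k : lk2 z (hop z k) = lk1 z k.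
  by rewrite /hop /= (lk2K wz).
exists f; split; last by rewrite (f1 0).
- apply/link_homP; split=> i.
  + by rewrite (same_lab wx wy (ft i)).
  + by rewrite (same_br1 wx wy (ft i)).
  + by rewrite (same_br2 wx wy (ft i)).
  + have [a [->|->]] := component_iterP i; first by rewrite f1 f2.
    by rewrite (lk1K wx) f1 f2 (lk1K wy).
  + have [a [->|->]] := component_iterP i; last first.
      by rewrite f2 -[lk2 y _]/(iter a.+1 (hop y) j0) -[lk2 x _]/(iter a.+1 (hop x) i0) f1.
    (* A full turn is added so that the iterate has the form [hop k], where [lk2] takes the value
       [lk1 k]. *)
    have -> : iter a (hop x) i0 = iter (a + (order (hop x) i0).-1).+1 (hop x) i0.
      by rewrite -addnS orderSpred iterD (iter_hop_order wx).
    by rewrite f1 !iterS !hopE // f2.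
- have inj1 a b : iter a (hop y) j0 = iter b (hop y) j0 -> iter a (hop x) i0 = iter b (hop x) i0.
    move=> /(congr1 (findex (hop y) j0)); rewrite !findex_iter_mod; try exact: hop_inj wy.
    rewrite -eo => h; rewrite iter_mod_order ?h -?iter_mod_order //; exact: hop_inj wx.
  have disj a b : iter a (hop y) j0 <> lk1 y (iter b (hop y) j0).
    by move=> h; have := orb _ _ wy b j0; rewrite -h -fconnect_orbit fconnect_iter.
  move=> i k; have [a [->|->]] := component_iterP i; have [b [->|->]] := component_iterP k;
    rewrite ?f1 ?f2.
  + exact: inj1.
  + by move/disj.
  + by move/esym/disj.
  + by move/(inv_inj (lk1K wy))/inj1 ->.
Qed.

End SameTrailLk1.
End Embeddings.

(** * Crossings of a loop *)

Section LoopClasses.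
Context (Gam : graph).
Implicit Types (l : seq (dart Gam)) (L : uloop Gam).

(** Along a closed path the targets are the sources shifted by one. *)
Lemma perm_src_bflip l : is_loop l ->
  perm_eq (map (@src Gam) (bflip l)) (map (@src Gam) l).
Proof.
case/andP; case: l => // a l _ /=; rewrite rcons_path => /andP[al e].
rewrite /bflip map_rev -map_comp perm_rev.
have -> : map (@src Gam \o @flip Gam) (a :: l) = rcons (map (@src Gam) l) (tgt (last a l)).
  elim: l a al {e} => [//|b l IH] a /= /andP[/eqP <- bl].
  by congr (_ :: _); exact: IH.
by rewrite (eqP e) perm_rcons.
Qed.

Lemma same_loop_src l l' : is_loop l -> same_loop l l' ->
  perm_eq (map (@src Gam) l') (map (@src Gam) l).
Proof.
move=> ll /same_loopP[i [->|->]]; rewrite map_rot perm_rot //.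
exact: perm_src_bflip.
Qed.

Lemma same_loop_has (F : {fset vertex Gam}) l l' : is_loop l -> same_loop l l' ->
  has (fun a => src a \in F) l' = has (fun a => src a \in F) l.
Proof.
move=> ll h; rewrite -!(has_map (@src Gam) (fun v => v \in F)).
exact/perm_has/same_loop_src.
Qed.

Lemma same_loop_darts (D : subgraph Gam) l l' : same_loop l l' ->
  (forall a, a \in l -> sdarts D a) -> forall a, a \in l' -> sdarts D a.
Proof.
move=> /same_loopP[i [->|->]] h a; rewrite mem_rot; first exact: h.
rewrite mem_rev => /mapP[b bl ->]; apply: sdarts_flip; exact: h.
Qed.

Lemma same_loop_size l l' : same_loop l l' -> size l' = size l.
Proof. by case/same_loopP=> i [->|->]; rewrite size_rot ?size_bflip. Qed.

Lemma same_loop_is_loop (D : subgraph Gam) l l' : (forall a, a \in l -> sdarts D a) ->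
  is_loop l -> same_loop l l' -> is_loop l'.
Proof.
have rot_loop i m : is_loop m -> is_loop (rot i m).
  by rewrite /is_loop rot_cycle -!size_eq0 size_rot.
case: l => // a l lD ll /same_loopP[i [->|->]]; apply: rot_loop => //.
apply: (bridge_is_loop _ (bridge_bflip (is_loop_bridge ll lD))).
by rewrite -size_eq0 size_bflip.
Qed.

Lemma rloop_is_loop (l : rloop Gam) : is_loop l.
Proof. by case: l. Qed.

Lemma repr_is_loop L : is_loop (repr L).
Proof. exact: rloop_is_loop. Qed.

Lemma repr_neq0 L : repr L != [::] :> seq _.
Proof. by case/andP: (repr_is_loop L). Qed.

Lemma unroot_eq (l l' : rloop Gam) : (unroot l == unroot l') = same_loop l l'.
Proof. by rewrite /unroot eqmodE. Qed.

Lemma unroot_repr L : unroot (repr L) = L.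
Proof. by rewrite /unroot reprK. Qed.

Lemma represents_unroot (l : rloop Gam) L : represents l L = (unroot l == L).
Proof. by rewrite /represents same_loop_sym -{2}(unroot_repr L) unroot_eq. Qed.

Lemma represents_same l l' L : represents l L -> represents l' L = same_loop l l'.
Proof.
rewrite /represents => lL; apply/idP/idP => h; last exact: same_loop_trans h.
by apply: same_loop_trans h; rewrite same_loop_sym.
Qed.

Lemma represents_inj l L L' : represents l L -> represents l L' -> L = L'.
Proof.
rewrite /represents => h h'; apply/eqP; rewrite -(unroot_repr L) -(unroot_repr L') unroot_eq.
by rewrite same_loop_sym in h'; exact: same_loop_trans h'.
Qed.

Lemma represents_visits F l L : represents l L ->
  visits F L = has (fun a => src a \in F) l.
Proof. by move=> h; rewrite (same_loop_has F (repr_is_loop L) h). Qed.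

(** Two orientations of [c] on one orientation of the loop are traded for one orientation of [c] on
    both orientations of the loop. *)
Lemma occE L c : occ L c = count (prefix c) (dih (repr L)).
Proof.
rewrite /occ /dih count_cat; congr (_ + _); first by rewrite count_map.
set l := repr L; have -> : count (fun i => prefix (bflip c) (rot i l)) (iota 0 (size l)) =
   count (prefix (bflip c)) (rots l) by rewrite count_map.
(* After reversal, a prefix [bflip c] is a suffix [c]; [rotr] brings it to the front. *)
transitivity (count (prefix c) (map (rotr (size c)) (rots (bflip l)))); last first.
  exact: permP (perm_map_rotr_rots _ _) _.
rewrite [RHS]count_map -(permP (perm_bflip_rots l)) [RHS]count_map.
apply: eq_in_count => y yl /=.
have yb : y = bflip (bflip y) by rewrite bflipK.
apply/idP/idP.
  case/prefixP => z e; rewrite e bflip_cat bflipK rotr_size_cat.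
  exact: prefix_prefix.
case: (leqP (size c) (size (bflip y))) => cy; last first.
  by move/size_prefix; rewrite size_rotr leqNgt cy.
case/prefixP => z /(congr1 (rot (size c))); rewrite rotrK rot_size_cat => e.
by rewrite -[y]bflipK e bflip_cat prefix_prefix.
Qed.

End LoopClasses.

Section Components.
Context (Gam : graph) (D : subgraph Gam) (F1 F2 : {fset vertex Gam}).
Hypothesis F12 : [disjoint F1 & F2]%fset.
Local Notation wf := (linkage_wf D F1 F2).
Local Notation crossing_first := (crossing_first (in1 F1) (in2 F2)).

(** The number of crossings of [L]: each of them singles out the rooting at its [F1]-end, oriented
    along it. Counting in [dih] keeps the multiplicities of periodic loops. *)
Definition ncrossings (L : uloop Gam) := count crossing_first (dih (repr L)).

(** The type [uloop] contains the loops of the whole graph, so staying in [D] has to be required. *)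
Definition crossing_loop (L : uloop Gam) :=
  [/\ forall a, a \in (repr L : seq _) -> sdarts D a, visits F1 L & visits F2 L].

Context (J : finType) (x : linkage Gam J).
Hypothesis wx : wf x.

Lemma trail_represents i : exists L, represents (link_trail x i) L.
Proof.
exists (unroot (RLoop (link_trail_is_loop wx i))).
by rewrite (represents_unroot (RLoop (link_trail_is_loop wx i))) eqxx.
Qed.

Lemma trail_darts i a : a \in link_trail x i -> sdarts D a.
Proof. exact: bridge_darts (link_trail_bridge wx i) a. Qed.

Lemma trail_visits1 i : has (in1 F1) (link_trail x i).
Proof.
have := crossing_first_trail wx i; case: (link_trail x i) => //= a l /andP[-> _].
by [].
Qed.

Lemma trail_visits2 i : has (in2 F2) (link_trail x i).
Proof.
have := crossing_first_trail wx i; case: (link_trail x i) => //= a l /andP[_].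
set s := [seq c <- l | _]; case e : s => [|b s'] // b2.
apply/orP; right; apply/hasP; exists b => //.
have : b \in s by rewrite e inE eqxx.
by rewrite mem_filter => /andP[].
Qed.

Lemma trail_crossing_loop i L : represents (link_trail x i) L -> crossing_loop L.
Proof.
move=> h; split; last 2 first.
- by rewrite (represents_visits _ h) trail_visits1.
- by rewrite (represents_visits _ h) trail_visits2.
apply: same_loop_darts (@trail_darts i).
by rewrite same_loop_sym.
Qed.

Lemma count_dih_represents (P : pred (seq (dart Gam))) i L :
  (forall l, P l -> crossing_first l) -> represents (link_trail x i) L ->
  count P (dih (repr L)) = count (P \o link_trail x) (component x i).
Proof.
move=> P1 h; rewrite -(count_dih_trail F12 wx) //.
by rewrite -(permP (perm_dih h)).
Qed.

Lemma ncrossingsE i L : represents (link_trail x i) L ->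
  ncrossings L = size (component x i).
Proof.
move=> h; rewrite /ncrossings (count_dih_represents _ h) // -(count_predT (component x i)).
by apply: eq_count => j /=; rewrite (crossing_first_trail wx).
Qed.

Lemma ncrossings_gt0 i L : represents (link_trail x i) L -> 0 < ncrossings L.
Proof. by move/ncrossingsE => ->; rewrite size_component double_gt0 order_gt0. Qed.

Lemma occ_component i L c : represents (link_trail x i) L -> is_crossing D F1 F2 c ->
  occ L (darts_of c) = count (fun j => lab x j == c) (component x i).
Proof.
move=> h cc; rewrite occE.
(* The crossing does not exhaust the loop, since no dart of [c] starts in [F2] while the loop visits
   [F2]; the next dart then starts at the end of [c], in [F2]. *)
have cont y : y \in dih (repr L) -> prefix (darts_of c) y ->
    exists2 z, y = darts_of c ++ z & starts (in2 F2) z.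
  rewrite mem_dih ?repr_neq0 // => sy /prefixP[z ey]; exists z => //.
  have [LD _ v2] := trail_crossing_loop h.
  have yD := same_loop_darts sy LD.
  have y2 : has (in2 F2) y by rewrite (same_loop_has F2 (repr_is_loop L) sy).
  have yl := same_loop_is_loop LD (repr_is_loop L) sy.
  case: z ey => [|b z] ey.
    have := crossing_excursion cc; move: y2; rewrite ey cats0 /= => /orP[c2 /andP[c1 _]|].
      by have := in1N2 F12 c1; rewrite c2.
    by case/hasP=> b bc b2 /andP[_ /allP/(_ _ bc)]; rewrite b2 andbF.
  have := yl; rewrite /is_loop ey /= rcons_path cat_path /=.
  case/andP=> /andP[_ /andP[/eqP e _]] _.
  by rewrite /starts /= /in2 -e (crossing_finish cc).
have cont_lab j : exists2 r, link_trail x j = darts_of (lab x j) ++ r & starts (in2 F2) r.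
  exists (br1 x j ++ bflip (darts_of (lab x (lk1 x j))) ++ br2 x (lk1 x j) ++
     laps x (hop x j) (order (hop x) j).-1); first by rewrite link_trailS /link_lap -!catA.
  have /and4P[_ h1 h2 _] := link_lapword wx j.
  by apply: starts_bridging h1 _; apply: starts_cat; exact: excursion_starts h2.
rewrite (@eq_in_count _ _ (fun y => prefix (darts_of c) y && crossing_first y)); last first.
  move=> y yL /=; case p: (prefix _ _) => //=; have [z -> z2] := cont y yL p.
  by rewrite (crossing_first_cat _ z2) ?(crossing_excursion cc).
rewrite (count_dih_represents _ h); last by move=> l /andP[].
apply: eq_in_count => j ji; rewrite /= (crossing_first_trail wx) andbT.
have [r ej r2] := cont_lab j.
apply/idP/eqP => [p|<-]; last by rewrite ej prefix_prefix.
have jL : link_trail x j \in dih (repr L).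
  by rewrite mem_dih ?repr_neq0 //; apply: same_loop_trans (same_loop_component wx ji).
have [z ez z2] := cont _ jL p; apply: darts_of_inj.
have := crossing_excursion cc; have := crossing_excursion (lab_crossing wx j).
move: ej; rewrite ez => ec; case: (c) (lab x j) ec => [a u] [a' u'] /= [-> ec].
case/andP=> _ nu' /andP[_ nu]; congr (_ :: _).
have nn v : all (fun b => ~~ in1 F1 b && ~~ in2 F2 b) v -> all (fun b => ~~ in2 F2 b) v.
  by apply: sub_all => b /andP[].
have h2 v : starts (in2 F2) v -> ~~ nilp v /\ ~~ head false (map (fun b => ~~ in2 F2 b) v).
  by case: v => //= b v; rewrite /starts /= => ->.
have [z0 zh] := h2 _ z2; have [r0 rh] := h2 _ r2.
by have [] := catsplit_inj (nn _ nu) (nn _ nu') z0 r0 zh rh ec.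
Qed.

(* Counts the pairs of labels of the same component in two ways. *)
Lemma card_trail_eq (B : {set J}) (l : seq (dart Gam)) L :
  (forall i j, i \in B -> j \in component x i -> j \in B) ->
  represents l L -> crossing_first l ->
  #|[set j in B | link_trail x j == l]| * ncrossings L =
  #|[set j in B | represents (link_trail x j) L]| * symmetries (repr L).
Proof.
move=> Bc lL l1.
have sz j : link_trail x j == l -> ncrossings L = size (component x j).
  by move=> /eqP e; apply: ncrossingsE; rewrite e.
transitivity (\sum_(j in B | link_trail x j == l) \sum_(i in B) (i \in component x j)).
  rewrite -sum1_card big_distrl /= (eq_bigl (fun j => (j \in B) && (link_trail x j == l))).
    apply: eq_bigr => j /andP[jB ej]; rewrite mul1n (sz j ej).
    rewrite -(card_uniqP (component_uniq wx j)) -sum1_card big_mkcond [RHS]big_mkcond.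
    apply: eq_bigr => i _ /=; case: ifP => ij; first by rewrite (Bc j).
    by case: ifP.
  by move=> j; rewrite inE.
rewrite exchange_big /= -sum1_card big_distrl /=.
rewrite [RHS](eq_bigl (fun j => (j \in B) && represents (link_trail x j) L)); last first.
  by move=> j; rewrite inE.
rewrite big_mkcondr /=; apply: eq_bigr => i iB.
have -> : \sum_(j in B | link_trail x j == l) (i \in component x j) =
    count (fun j => link_trail x j == l) (component x i).
  rewrite -sum1_count [RHS]big_mkcond (big_uniq _ (component_uniq wx i)) /=.
  rewrite big_mkcond [RHS]big_mkcond.
  apply: eq_bigr => j _; rewrite (mem_component_sym wx).
  case: eqP => ej; rewrite ?(andbT, andbF) ?if_same //.
  by case: ifP => jB; case: ifP => ji //; move: jB; rewrite (Bc i).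
case: ifP => iL; last first.
  apply/eqP; rewrite -leqn0 leqNgt -has_count; apply/hasPn => j ji; apply/negP => /eqP ej.
  move: iL; rewrite -ej in lL; rewrite (represents_same _ lL) same_loop_sym.
  by rewrite (same_loop_component wx).
rewrite mul1n -(@count_mem_dih_symmetries _ _ l) //.
by rewrite (count_dih_represents _ iL) // => y /eqP ->.
Qed.

End Components.

(** * Loops as trails *)

Section Decomposition.
Context (Gam : graph) (D : subgraph Gam).
Implicit Types (F : {fset vertex Gam}).

Lemma bridge_split v b c w : bridge D v (b ++ c) w ->
  exists2 u, bridge D v b u & bridge D u c w.
Proof.
elim: b v => [|a b IH] v /=.
  by move=> vw; exists v; rewrite ?eqxx //; case/andP: (bridge_verts vw).
by case/and3P => /eqP <- aD /IH[u h1 h2]; exists u; rewrite ?eqxx ?aD.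
Qed.

Lemma bridge_remove_intro F v b w : bridge D v b w ->
  all (fun a => src a \notin F) b -> w \notin F -> bridge (remove_vertices D F) v b w.
Proof.
move=> + + wF; elim: b v => [|a b IH] v /=.
  by case/andP => /eqP -> /set_mem wD _; rewrite eqxx; apply/mem_set.
case/and3P => -> aD ab /andP[aF bF]; rewrite IH // andbT; apply/mem_set; split => //.
  exact: set_mem.
by case: b ab bF {IH} => [/andP[/eqP -> _]|c b /and3P[/eqP <- _ _] /andP[]].
Qed.

Lemma split_last (T : eqType) (p : pred T) l : has p l ->
  exists b a c, [/\ l = b ++ a :: c, p a & all (fun x => ~~ p x) c].
Proof.
elim: l => // a l IH /=; case: (boolP (has p l)) => [/IH[b [a' [c [-> pa' pc]]]] _|nl].
  by exists (a :: b), a', c.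
rewrite orbF => pa; exists [::], a, l; split=> //.
by rewrite all_predC.
Qed.

Lemma take_find_all (T : eqType) (p : pred T) l : all (fun x => ~~ p x) (take (find p l) l).
Proof. by elim: l => //= a l IH; case: ifP => //= ->. Qed.

(** The first visit to [B] ends the crossing, and the last visit to [A] before it starts it. If no
    dart of [l] starts in [B], then [find] returns the length of [l] and the first visit is at the
    end point [w]. *)
Lemma split_excursion (A B : {fset vertex Gam}) v l w : [disjoint A & B]%fset ->
  bridge D v l w -> v \in A -> has (fun a => src a \in B) l || (w \in B) ->
  exists b c r, [/\ l = b ++ darts_of c ++ r, is_crossing D A B c,
    bridge (remove_vertices D B) v b (start c) & bridge D (finish c) r w].
Proof.
move=> AB lvw vA lB; set n := find (fun a => src a \in B) l.
have AnB u : u \in A -> u \notin B by move/fdisjointP: AB; apply.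
have := lvw; rewrite -[in X in X -> _](cat_take_drop n l) => /bridge_split[t h1 h2].
have tB : t \in B.
  case: (boolP (has (fun a => src a \in B) l)) lB => [hl _|nl /= wB].
    have nl : n < size l by rewrite -has_find.
    case e : (drop n l) h2 => [|a r]; first by move: (size_drop n l); rewrite e /=; lia.
    case/and3P => /eqP <- _ _; have := nth_find a hl.
    by rewrite -/n -[n]addn0 -nth_drop e.
  move: h2; rewrite /n hasNfind // drop_size /= => /andP[/eqP -> _] //.
have l1B := take_find_all (fun a => src a \in B) l.
have l1A : has (fun a => src a \in A) (take n l).
  case: (take n l) h1 => [/andP[/eqP vt _]|a b /and3P[/eqP av _ _]] /=.
    by have := AnB _ vA; rewrite vt tB.
  by rewrite av vA.
have [b [a [c [e aA cA]]]] := split_last l1A.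
rewrite -/n e all_cat /= in l1B; case/and3P: l1B => bB aB cB.
move: h1; rewrite e => /bridge_split[u h1 h3].
have ua : u = src a by case/and3P: h3 => /eqP.
rewrite ua bridgeE in h1 h3; case/and3P: h3 => ac acD /eqP et.
exists b, (a, c), (drop n l); split.
- by rewrite -{1}(cat_take_drop n l) e -catA.
- apply/and5P; split => //; first by rewrite /finish /= et.
  by apply/allP => d dc; rewrite (allP cA) // (allP cB).
- by apply: bridge_remove_intro h1 bB _; exact: AnB.
- by rewrite /finish /= et.
Qed.

Lemma crossing_rev (A B : {fset vertex Gam}) c : [disjoint A & B]%fset -> is_crossing D A B c ->
  exists c', [/\ is_crossing D B A c', darts_of c' = bflip (darts_of c),
    start c' = finish c & finish c' = start c].
Proof.
move=> AB cc; have cb := bridge_bflip (crossing_bridge cc).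
have := crossing_excursion_flip cc; case: (bflip _) cb => // a l cb /andP[aB lN].
have sa : src a = finish c by case/and3P: cb => /eqP.
rewrite -sa bridgeE in cb; case/and3P: cb => al alD /eqP fa.
exists (a, l); split => //; apply/and5P; split => //.
by rewrite /finish /= fa; exact: crossing_start cc.
Qed.

(* A crossing, the bridge that follows it, the next crossing (traversed
   backwards), and the bridge that follows it. *)
Definition lapdata := (nepath Gam * seq (dart Gam) * nepath Gam * seq (dart Gam))%type.

Definition lapdata_word (t : lapdata) :=
  let: (c, b, c', b') := t in darts_of c ++ b ++ bflip (darts_of c') ++ b'.

Definition lapdata_start (t : lapdata) := let: (c, b, c', b') := t in start c.

Context (F1 F2 : {fset vertex Gam}).
Hypothesis F12 : [disjoint F1 & F2]%fset.

Definition lapdata_ok (t : lapdata) (u : vertex Gam) : Prop :=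
  let: (c, b, c', b') := t in
  [/\ is_crossing D F1 F2 c, is_crossing D F1 F2 c',
      bridge (remove_vertices D F1) (finish c) b (finish c') &
      bridge (remove_vertices D F2) (start c') b' u].

Fixpoint lapdata_chain (ws : seq lapdata) (w : vertex Gam) : Prop :=
  if ws is t :: ws' then
    lapdata_ok t (head w (map lapdata_start ws')) /\ lapdata_chain ws' w
  else True.

Lemma lapdata_chain_nth t0 ws w a : lapdata_chain ws w -> a < size ws ->
  lapdata_ok (nth t0 ws a) (nth w (map lapdata_start ws) a.+1).
Proof.
elim: ws a => // t ws IH [|a] /= [h1 h2]; first by rewrite nth0.
by rewrite ltnS => /IH; apply.
Qed.

(** Induction on the length of the remaining path: the next crossing from [F2] to [F1] is cut off
    and stored reversed, and the path continues with the next crossing to [F2], if there is one. *)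
Lemma lapdata_exists c r w : is_crossing D F1 F2 c -> bridge D (finish c) r w ->
  w \in F1 -> exists t ws, [/\ lapdata_chain (t :: ws) w,
    darts_of c ++ r = flatten (map lapdata_word (t :: ws)) & lapdata_start t = start c].
Proof.
elim: {r}(size r).+1 {-2}r (ltnSn (size r)) c => // n IH r; rewrite ltnS => rn c cc rw w1.
have F21 : [disjoint F2 & F1]%fset by rewrite fdisjoint_sym.
have [|b1 [d [r2 [er cd b1b dr2]]]] := split_excursion F21 rw (crossing_finish cc).
  by rewrite w1 orbT.
have [c' [cc' ec' sc' fc']] := crossing_rev F21 cd.
have ed : darts_of d = bflip (darts_of c') by rewrite ec' bflipK.
(* If [F2] is not visited any more, the rest of the path is the bridge avoiding [F2] of the last
   lap. *)
case: (boolP (has (fun a => src a \in F2) r2)) => r22; last first.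
  exists (c, b1, c', r2), [::]; split => //=; last by rewrite er ed cats0.
  split=> //; split=> //; first by rewrite fc'.
  rewrite sc'; apply: bridge_remove_intro => //; first by rewrite all_predC.
  by move/fdisjointP: F12; apply.
have [|b2 [c2 [r3 [er2 cc2 b2b r3b]]]] := split_excursion F12 dr2 (crossing_finish cd).
  by rewrite r22.
have [|t [ws [h1 h2 h3]]] := IH r3 _ c2 cc2 r3b w1.
  by move: rn; rewrite er er2 !size_cat /=; clear; lia.
exists (c, b1, c', b2), (t :: ws); split => //=.
  by split=> //; rewrite h3; split=> //; rewrite ?fc' ?sc'.
by rewrite er er2 h2 ed /= -!catA.
Qed.

(** The loop is rooted at a visit to [F1]; the piece [b] that precedes its first crossing is then
    rotated to the end. *)
Lemma crossing_loop_root L : crossing_loop D F1 F2 L ->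
  exists c r, [/\ is_crossing D F1 F2 c, bridge D (finish c) r (start c) &
    represents (darts_of c ++ r) L].
Proof.
case=> LD L1 L2.
have [i [a [l [e a1]]]] : exists i a l, rot i (repr L) = a :: l /\ src a \in F1.
  have [a aL a1] := hasP L1; case: (rot_to aL) => i l e.
  by exists i, a, l.
have sl : same_loop (repr L) (a :: l) by apply/same_loopP; exists i; left.
have lb := is_loop_bridge (same_loop_is_loop LD (repr_is_loop L) sl) (same_loop_darts sl LD).
have [|b [c [r [e2 cc h1 h2]]]] := split_excursion F12 lb a1.
  by rewrite (same_loop_has _ (repr_is_loop L) sl) [has _ _]L2.
exists c, (r ++ b); split => //.
  exact: bridge_cat h2 (bridge_remove h1).
apply: same_loop_trans sl _; rewrite e2; apply/same_loopP; exists (size b); left.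
by rewrite rot_size_cat catA.
Qed.

Section CycleModel.
Context (h : nat) (T : 'I_h.+1 -> lapdata).
Hypothesis T_ok : forall a, lapdata_ok (T a) (lapdata_start (T (ordS a))).

(* [(a, false)] and [(a, true)] label the two crossings of the lap [T a]. *)
Definition cycle_link : linkage Gam ('I_h.+1 * bool)%type :=
  Linkage
    (fun i => let: (c, b, c', b') := T i.1 in if i.2 then c' else c)
    (fun i => (i.1, ~~ i.2))
    (fun i => if i.2 then (ordS i.1, false) else (ord_pred i.1, true))
    (fun i => let: (c, b, c', b') := T i.1 in if i.2 then bflip b else b)
    (fun i => if i.2 then (T i.1).2 else bflip (T (ord_pred i.1)).2).

Lemma cycle_link_wf : linkage_wf D F1 F2 cycle_link.
Proof.
split.
- by move=> [a u] /=; rewrite negbK.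
- by move=> [a u]; rewrite /= xpair_eqE negb_and orbC; case: u.
- by move=> [a []] /=; rewrite ?ordSK ?ord_predK.
- by move=> [a u]; case: u; rewrite /= xpair_eqE negb_and orbC.
- by move=> [a u] /=; have := T_ok a; case: (T a) => [[[c b] c'] b'] /= [? ? _ _]; case: u.
- move=> [a u] /=; have := T_ok a; case: (T a) => [[[c b] c'] b'] /= [_ _ h1 _].
  by case: u => //=; exact: bridge_bflip.
- by move=> [a u] /=; case: (T a) => [[[c b] c'] b']; case: u => //=; rewrite bflipK.
- move=> [a [|]] /=.
    have := T_ok a; case: (T (ordS a)) => [[[? ?] ?] ?].
    by case: (T a) => [[[c b] c'] b'] /= [_ _ _].
  have := T_ok (ord_pred a); rewrite ord_predK; case: (T a) => [[[? ?] ?] ?].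
  by case: (T _) => [[[c b] c'] b'] /= [_ _ _ /bridge_bflip].
- by move=> [a [|]] /=; rewrite ?ordSK ?bflipK.
Qed.

Lemma cycle_link_hop a : hop cycle_link (a, false) = (ordS a, false).
Proof. by []. Qed.

Lemma cycle_link_iter k : iter k (hop cycle_link) (ord0, false) = (inord (k %% h.+1), false).
Proof.
elim: k => [|k IH]; first by congr pair; apply/val_inj; rewrite /= inordK ?mod0n.
rewrite iterS IH cycle_link_hop; congr pair; apply/val_inj; rewrite /= !inordK ?ltn_mod //.
by rewrite -addn1 modnDml addn1.
Qed.

Lemma cycle_link_order : order (hop cycle_link) (ord0, false) = h.+1.
Proof.
apply/eqP; rewrite eqn_leq; apply/andP; split.
  by apply: order_le => //; rewrite cycle_link_iter modnn; congr pair; apply/val_inj; rewrite /= inordK.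
rewrite leqNgt; apply/negP => lt.
have := iter_hop_order cycle_link_wf (ord0, false); rewrite cycle_link_iter modn_small //.
case=> /(congr1 val); rewrite /= inordK // => e.
by have := order_gt0 (hop cycle_link) (ord0, false); rewrite e.
Qed.

Lemma cycle_link_conn i : i \in component cycle_link (ord0, false).
Proof.
have h1 a : (a, false) \in orbit (hop cycle_link) (ord0, false).
  rewrite -fconnect_orbit; have -> : (a, false) = iter a (hop cycle_link) (ord0, false).
    by rewrite cycle_link_iter modn_small // inord_val.
  exact: fconnect_iter.
by rewrite (mem_component cycle_link_wf); case: i => a [|]; rewrite h1 ?orbT.
Qed.

Lemma cycle_link_trail :
  link_trail cycle_link (ord0, false) = flatten [seq lapdata_word (T a) | a <- enum 'I_h.+1].
Proof.
rewrite link_trailE cycle_link_order /laps; congr flatten.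
apply: (@eq_from_nth _ [::]) => [|k]; first by rewrite size_map size_traject size_map size_enum_ord.
rewrite size_map size_traject => kh.
rewrite (nth_map (ord0, false)) ?size_traject // nth_traject // (nth_map ord0) ?size_enum_ord //.
rewrite cycle_link_iter modn_small // (_ : nth ord0 _ k = inord k); last first.
  by apply/val_inj; rewrite /= inordK // nth_enum_ord.
by rewrite /link_lap /=; case: (T _) => [[[? ?] ?] ?].
Qed.

End CycleModel.

Lemma single_model L : crossing_loop D F1 F2 L ->
  exists (J : finType) (x : linkage Gam J) i0,
    [/\ linkage_wf D F1 F2 x, forall i, i \in component x i0 & represents (link_trail x i0) L].
Proof.
move=> /crossing_loop_root[c [r [cc rb cr]]].
have [t [ws [h1 h2 h3]]] := lapdata_exists cc rb (crossing_start cc).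
pose T (a : 'I_(size ws).+1) := nth t (t :: ws) a.
have T_ok a : lapdata_ok (T a) (lapdata_start (T (ordS a))).
  have := lapdata_chain_nth t h1 (ltn_ord a); rewrite -/(T a) => h.
  (* For the last lap, the default value [start c] of [nth] is the start of the first lap, which
     closes the cycle. *)
  suff -> : lapdata_start (T (ordS a)) =
      nth (start c) (map lapdata_start (t :: ws)) a.+1 by [].
  rewrite /T /=; case: (ltnP a (size ws)) => aw.
    by rewrite modn_small //= (nth_map t).
  have -> : nat_of_ord a = size ws by apply/eqP; rewrite eqn_leq aw -ltnS ltn_ord.
  by rewrite modnn [RHS]nth_default ?size_map // -h3.
exists _, (cycle_link T), (ord0, false); split; first exact: cycle_link_wf.
  exact: cycle_link_conn.
rewrite cycle_link_trail //; suff -> : [seq lapdata_word (T a) | a <- enum 'I_(size ws).+1] =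
    map lapdata_word (t :: ws) by rewrite -h2.
rewrite (map_comp lapdata_word T); congr map.
apply: (@eq_from_nth _ t) => [|k]; first by rewrite size_map size_enum_ord.
rewrite size_map size_enum_ord => kw.
by rewrite (nth_map ord0) ?size_enum_ord // /T nth_enum_ord.
Qed.

End Decomposition.

(** * Models of finite collections of loops, and the number of their embeddings *)

Section Models.
Context (Gam : graph) (D : subgraph Gam) (F1 F2 : {fset vertex Gam}).
Hypothesis F12 : [disjoint F1 & F2]%fset.
Local Notation wf := (linkage_wf D F1 F2).
Local Notation ncrossings := (ncrossings F1 F2).
Local Notation crossing_loop := (crossing_loop D F1 F2).

Definition class_count (J : finType) (x : linkage Gam J) (B : {set J}) L :=
  #|[set j in B | represents (link_trail x j) L]|.

Definition saturated (J : finType) (x : linkage Gam J) (B : {set J}) :=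
  forall i j, i \in B -> j \in component x i -> j \in B.

Definition embeddings (J J' : finType) (x : linkage Gam J) (y : linkage Gam J')
    (B : {set J'}) : {set {ffun J -> J'}} :=
  [set f : {ffun J -> J'} | [&& link_hom x y f, injectiveb f & [forall i, f i \in B]]].

Lemma embeddingsP (J J' : finType) (x : linkage Gam J) (y : linkage Gam J') (B : {set J'})
  (f : {ffun J -> J'}) :
  reflect [/\ link_hom x y f, injective f & forall i, f i \in B] (f \in embeddings x y B).
Proof.
rewrite inE; apply: (iffP and3P) => [[h1 /injectiveP h2 /forallP h3]|[h1 h2 h3]] //.
by split=> //; [exact/injectiveP | exact/forallP].
Qed.

Fixpoint symmetry_weight (ls : seq (uloop Gam)) : nat :=
  if ls is L :: ls' then symmetries (repr L) * count_mem L ls * symmetry_weight ls' else 1.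

(* The trails of [x] are the loops [ls].  The last field says that the number of
   ways to find [x] inside a linkage with the same loops depends only on [ls]. *)
Record is_model (ls : seq (uloop Gam)) (J : finType) (x : linkage Gam J) : Prop := IsModel {
  model_wf : wf x;
  model_count : forall L, class_count x [set: J] L = ncrossings L * count_mem L ls;
  model_lab : forall c, is_crossing D F1 F2 c ->
    #|[set j | lab x j == c]| = \sum_(L <- ls) occ L (darts_of c);
  model_size : \sum_j size (link_lap x j) = (\sum_(L <- ls) size (repr L : seq _)).*2;
  model_embeddings : forall (J' : finType) (y : linkage Gam J') (B : {set J'}),
    wf y -> saturated y B ->
    (forall L, class_count y B L = ncrossings L * count_mem L ls) ->
    #|embeddings x y B| = symmetry_weight ls }.

Section Connected.
Context (J : finType) (x : linkage Gam J) (i0 : J).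
Hypotheses (wx : wf x) (conn : forall i, i \in component x i0).

(** The image lies in one component, and equality of the trails gives both components the same
    number of labels. *)
Lemma embedding_image (J' : finType) (y : linkage Gam J') (f : J -> J') :
  wf y -> link_hom x y f -> injective f ->
  [set f i | i in J] = [set j in component y (f i0)].
Proof.
move=> wy hf f_inj; apply/eqP; rewrite eqEcard; apply/andP; split.
  apply/fintype.subsetP => _ /imsetP[i _ ->]; rewrite inE.
  have [_ _ _ h4 _] := link_homP _ _ _ hf.
  have [a [->|->]] := component_iterP wx conn i.
    by rewrite -(link_hom_iter _ _ hf) (mem_component wy) -!fconnect_orbit fconnect_iter.
  rewrite -h4 (mem_component_lk1 wy) -(link_hom_iter _ _ hf) (mem_component wy).
  by rewrite -!fconnect_orbit fconnect_iter.
rewrite card_imset // cardsE (card_uniqP (component_uniq wy _)).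
rewrite size_component (same_order F12 wy wx (link_hom_trail wx wy _ hf f_inj)) -size_component.
by rewrite -(card_uniqP (component_uniq wx i0)); apply/subset_leq_card/fintype.subsetP.
Qed.

(** A morphism from a connected linkage is determined by the image of [i0], which can be any label
    of [B] with the same trail. *)
Lemma card_embeddings_connected (J' : finType) (y : linkage Gam J') (B : {set J'}) :
  wf y -> saturated y B ->
  #|embeddings x y B| = #|[set j in B | link_trail y j == link_trail x i0]|.
Proof.
move=> wy Bc; rewrite -(@card_in_imset _ _ (fun f : {ffun J -> J'} => f i0)); last first.
  move=> f f' /embeddingsP[hf _ _] /embeddingsP[hf' _ _] e; apply/ffunP.
  exact: (connected_hom_inj wx conn hf hf').
congr #|pred_of_set _|; apply/setP => j; rewrite inE; apply/imsetP/andP.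
  case=> f /embeddingsP[hf f_inj fB] ->; split=> //.
  by rewrite (link_hom_trail wx wy _ hf f_inj).
case=> jB /eqP ej; have [f [hf f_inj fj]] := connected_hom_exists F12 wx wy conn (esym ej).
have eF : finfun f =1 f by move=> i; rewrite ffunE.
have hF : link_hom x y (finfun f).
  by have [h1 h2 h3 h4 h5] := link_homP _ _ _ hf; apply/link_homP; split=> i; rewrite !eF.
exists (finfun f); last by rewrite eF.
apply/embeddingsP; split=> //; first by move=> i k; rewrite !eF => /f_inj.
move=> i; rewrite eF; apply: (Bc j) => //; have : f i \in [set f i | i in J] by rewrite imset_f.
by rewrite (embedding_image wy hf f_inj) inE fj.
Qed.

End Connected.

Lemma class_countID (J : finType) (x : linkage Gam J) (A B : {set J}) L : A \subset B ->
  class_count x B L = class_count x A L + class_count x (B :\: A) L.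
Proof.
move=> AB; rewrite /class_count -(cardsID A); congr (_ + _); congr #|pred_of_set _|.
  apply/setP => j; rewrite !inE; case jA: (j \in A); rewrite ?andbF ?andbT //=.
  by rewrite (fintype.subsetP AB).
by apply/setP => j; rewrite !inE andbA.
Qed.

Lemma class_count_component (J : finType) (x : linkage Gam J) i L0 L : wf x ->
  represents (link_trail x i) L0 ->
  class_count x [set j in component x i] L = ncrossings L * (L0 == L).
Proof.
move=> wx h; have comp_rep j L' : j \in component x i ->
    represents (link_trail x j) L' = (L0 == L').
  move=> ji; apply/idP/eqP => [h'|<-]; last first.
    by rewrite (represents_same _ h) (same_loop_component wx).
  apply: represents_inj h'; rewrite (represents_same _ h).
  exact: (same_loop_component wx ji).
case: eqP => [<-|ne]; rewrite ?muln1 ?muln0.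
  rewrite (ncrossingsE F12 wx h) -(card_uniqP (component_uniq wx i)) -cardsE.
  congr #|pred_of_set _|; apply/setP => j; rewrite !inE.
  by case ji: (j \in component x i); rewrite // comp_rep // eqxx.
apply: eq_card0 => j; rewrite !inE; case ji: (j \in component x i) => //=.
by rewrite comp_rep //; apply/eqP.
Qed.

Lemma class_count_setT (J : finType) (x : linkage Gam J) i L0 L : wf x ->
  (forall j, j \in component x i) -> represents (link_trail x i) L0 ->
  class_count x [set: J] L = ncrossings L * (L0 == L).
Proof.
move=> wx conn h; rewrite -(class_count_component _ wx h); congr class_count.
by apply/setP => j; rewrite !inE conn.
Qed.

(** The laps of a component run through the loop once in each direction. *)
Lemma component_size (J : finType) (x : linkage Gam J) i : wf x ->
  \sum_(j <- component x i) size (link_lap x j) = (size (link_trail x i)).*2.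
Proof.
move=> wx; have orb k : \sum_(j <- orbit (hop x) k) size (link_lap x j) = size (link_trail x k).
  by rewrite /link_trail size_flatten /shape -map_comp sumnE big_map.
rewrite big_cat -(perm_big _ (perm_orbit_lk2 wx i)) /= !orb.
by rewrite (link_trail_lk2 wx) size_rot size_bflip addnn.
Qed.

Section Sum.
Context (J1 J2 : finType) (x1 : linkage Gam J1) (x2 : linkage Gam J2).

Definition sum_link : linkage Gam (J1 + J2)%type := Linkage
  (fun i => match i with inl a => lab x1 a | inr a => lab x2 a end)
  (fun i => match i with inl a => inl (lk1 x1 a) | inr a => inr (lk1 x2 a) end)
  (fun i => match i with inl a => inl (lk2 x1 a) | inr a => inr (lk2 x2 a) end)
  (fun i => match i with inl a => br1 x1 a | inr a => br1 x2 a end)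
  (fun i => match i with inl a => br2 x1 a | inr a => br2 x2 a end).

Hypotheses (w1 : wf x1) (w2 : wf x2).

Lemma sum_link_wf : wf sum_link.
Proof.
case: w1 w2 => a1 a2 a3 a4 a5 a6 a7 a8 a9 [b1 b2 b3 b4 b5 b6 b7 b8 b9].
split.
- by move=> [i|i] /=; rewrite ?a1 ?b1.
- by move=> [i|i]; [exact: a2 | exact: b2].
- by move=> [i|i] /=; rewrite ?a3 ?b3.
- by move=> [i|i]; [exact: a4 | exact: b4].
- by move=> [i|i]; [exact: a5 | exact: b5].
- by move=> [i|i]; [exact: a6 | exact: b6].
- by move=> [i|i]; [exact: a7 | exact: b7].
- by move=> [i|i]; [exact: a8 | exact: b8].
- by move=> [i|i]; [exact: a9 | exact: b9].
Qed.

Lemma sum_trail_inl i : link_trail sum_link (inl i) = link_trail x1 i.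
Proof.
by apply: (link_hom_trail w1 sum_link_wf) => [|a b [->]] //; apply/link_homP; split.
Qed.

Lemma sum_trail_inr i : link_trail sum_link (inr i) = link_trail x2 i.
Proof.
by apply: (link_hom_trail w2 sum_link_wf) => [|a b [->]] //; apply/link_homP; split.
Qed.

Lemma card_sum_set (P : pred (J1 + J2)) :
  #|[set j | P j]| = #|[set j | P (inl j)]| + #|[set j | P (inr j)]|.
Proof. by rewrite -!sum1dep_card big_sumType. Qed.

(** An embedding of a disjoint union is an embedding of the first part, followed by one of the
    second part into what the first leaves free. *)
Lemma card_embeddings_sum (J' : finType) (y : linkage Gam J') (B : {set J'}) :
  #|embeddings sum_link y B| =
  \sum_(f in embeddings x1 y B) #|embeddings x2 y (B :\: [set f i | i in J1])|.
Proof.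
pose pl (f : {ffun J1 + J2 -> J'}) : {ffun J1 -> J'} := [ffun i => f (inl i)].
pose pr (f : {ffun J1 + J2 -> J'}) : {ffun J2 -> J'} := [ffun i => f (inr i)].
have plP f : f \in embeddings sum_link y B -> pl f \in embeddings x1 y B.
  case/embeddingsP => /link_homP[h1 h2 h3 h4 h5] f_inj fB; apply/embeddingsP; split.
  - by apply/link_homP; split=> i; rewrite !ffunE ?h1 ?h2 ?h3 ?h4 ?h5.
  - by move=> i j; rewrite !ffunE => /f_inj[].
  - by move=> i; rewrite ffunE.
rewrite -sum1_card (partition_big pl (mem (embeddings x1 y B))) //=; apply: eq_bigr => f1 f1P.
rewrite sum1dep_card -(@card_in_imset _ _ pr); last first.
  move=> f f'; rewrite !inE => /andP[_ /eqP e1] /andP[_ /eqP e2] e; apply/ffunP => -[i|i].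
    by have := congr1 (fun g : {ffun J1 -> J'} => g i) (etrans e1 (esym e2)); rewrite !ffunE.
  by have := congr1 (fun g : {ffun J2 -> J'} => g i) e; rewrite !ffunE.
congr #|pred_of_set _|; apply/setP => f2; apply/imsetP/idP.
  case=> f; rewrite inE => /andP[/embeddingsP[/link_homP[h1 h2 h3 h4 h5] f_inj fB] /eqP e] ->.
  apply/embeddingsP; split.
  - by apply/link_homP; split=> i; rewrite !ffunE ?h1 ?h2 ?h3 ?h4 ?h5.
  - by move=> i j; rewrite !ffunE => /f_inj[].
  - move=> i; rewrite inE ffunE fB andbT -e; apply/imsetP => -[j _]; rewrite ffunE => /f_inj.
    by [].
case/embeddingsP => h2 i2 B2; have /embeddingsP[h1 i1 B1] := f1P.
pose f : {ffun J1 + J2 -> J'} := [ffun i => match i with inl a => f1 a | inr a => f2 a end].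
have fl i : f (inl i) = f1 i by rewrite ffunE.
have fr i : f (inr i) = f2 i by rewrite ffunE.
exists f; last by apply/ffunP => i; rewrite !ffunE.
rewrite inE; apply/andP; split; last by apply/eqP/ffunP => i; rewrite !ffunE.
have [a1 a2 a3 a4 a5] := link_homP _ _ _ h1; have [b1 b2 b3 b4 b5] := link_homP _ _ _ h2.
apply/embeddingsP; split.
- by apply/link_homP; split=> -[i|i]; rewrite ?fl ?fr /= ?(fl, fr).
- have disj i j : f1 i <> f2 j.
    by move=> e; have := B2 j; rewrite inE -e imset_f.
  move=> [i|i] [j|j]; rewrite ?fl ?fr.
  + by move/i1 ->.
  + by move/disj.
  + by move/esym/disj.
  + by move/i2 ->.
- by move=> [i|i]; rewrite ?fl ?fr // ; have := B2 i; rewrite inE => /andP[].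
Qed.

End Sum.

Lemma model_exists ls : (forall L, L \in ls -> crossing_loop L) ->
  exists (J : finType) (x : linkage Gam J), is_model ls x.
Proof.
elim: ls => [_|L ls IH lsP].
  pose x := @Linkage Gam 'I_0 (fun i => False_rect _ (notF (ltn_ord i))) id id
    (fun=> [::]) (fun=> [::]).
  exists _, x; split.
  - by split; case.
  - by move=> L; rewrite muln0; apply: eq_card0 => -[].
  - by move=> c _; rewrite big_nil; apply: eq_card0 => -[].
  - by rewrite big_ord0 big_nil.
  - move=> J' y B wy Bc _; rewrite /= -(card_ord 1).
    rewrite (_ : embeddings x y B = [set: {ffun 'I_0 -> J'}]) ?cardsT ?card_ffun
      ?card_ord ?expn0 //.
    apply/setP => f; rewrite [RHS]inE; apply/embeddingsP; split; last by case.
      by apply/forallP; case.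
    by case.
have [J2 [x2 m2]] := IH (fun L' L'ls => lsP L' (mem_behead (s := L :: ls) L'ls)).
have [J1 [x1 [i0 [w1 conn rL]]]] := single_model F12 (lsP L (mem_head _ _)).
have w2 := model_wf m2; have w := sum_link_wf w1 w2.
exists _, (sum_link x1 x2); split => //.
- move=> L'; rewrite /= mulnDr -(class_count_setT _ w1 conn rL) -(model_count m2).
  rewrite /class_count card_sum_set; congr (_ + _); congr #|pred_of_set _|.
    by apply/setP => j; rewrite !inE sum_trail_inl.
  by apply/setP => j; rewrite !inE sum_trail_inr.
- move=> c cc; rewrite card_sum_set big_cons -(model_lab m2 cc) (occ_component F12 w1 rL cc).
  congr (_ + _); rewrite -size_filter -(card_uniqP (filter_uniq _ (component_uniq w1 i0))).
  by apply: eq_card => j; rewrite mem_filter conn andbT inE.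
- rewrite big_sumType big_cons doubleD -(model_size m2) /=; congr (_ + _).
  rewrite -(same_loop_size rL) -(component_size _ w1) (big_uniq _ (component_uniq w1 i0)) /=.
  by apply: eq_bigl => j; rewrite conn.
- move=> J' y B wy Bc Bcount.
  have l1 : crossing_first (in1 F1) (in2 F2) (link_trail x1 i0) by exact: crossing_first_trail w1 i0.
  have L0 : 0 < ncrossings L by exact: (ncrossings_gt0 F12 w1 rL).
  (* [card_trail_eq] counts the labels of [B] with the trail of [i0]; the positive factor
     [ncrossings L] cancels. *)
  have cE : #|embeddings x1 y B| = symmetries (repr L) * count_mem L (L :: ls).
    rewrite (card_embeddings_connected w1 conn wy Bc).
    apply/eqP; rewrite -(eqn_pmul2r L0); apply/eqP.
    rewrite (card_trail_eq F12 wy Bc rL l1) -/(class_count y B L) Bcount.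
    by rewrite mulnC [X in _ * X]mulnC mulnA.
  rewrite card_embeddings_sum [RHS]/= -/(count_mem _ _) -cE -sum_nat_const.
  apply: eq_bigr => f /embeddingsP[hf f_inj fB].
  have eI := embedding_image w1 conn wy hf f_inj.
  have rf : represents (link_trail y (f i0)) L by rewrite (link_hom_trail w1 wy _ hf f_inj).
  have sub : [set j in component y (f i0)] \subset B.
    by apply/fintype.subsetP => j; rewrite inE; exact: Bc.
  (* The image of [f] is a whole component, that is, one copy of [L]; what remains is saturated and
     has the counts of [ls]. *)
  apply: (model_embeddings m2) => //.
    move=> i j; rewrite eI !inE => /andP[i1 iB] ji; rewrite (Bc i) // andbT.
    by apply: contra i1 => j1; apply: (mem_component_trans wy j1); rewrite (mem_component_sym wy).
  move=> L'; rewrite eI; apply/eqP.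
  rewrite -(eqn_add2l (class_count y [set j in component y (f i0)] L')).
  by rewrite -class_countID // Bcount (class_count_component _ wy rf) -mulnDr.
Qed.

End Models.

(** * Number of admissible pairs of bridges *)

Section Counting.
Context (Gam : graph) (D : subgraph Gam) (F1 F2 : {fset vertex Gam}).
Hypothesis F12 : [disjoint F1 & F2]%fset.
Local Notation wf := (linkage_wf D F1 F2).
Local Notation ncrossings := (ncrossings F1 F2).
Local Notation crossing_loop := (crossing_loop D F1 F2).

Section Isomorphisms.
Context (I J : finType) (x : linkage Gam I) (y : linkage Gam J) (f : I -> J).
Hypotheses (wx : wf x) (wy : wf y) (hf : link_hom x y f).

Lemma class_count_image (f_inj : injective f) L :
  class_count y [set f i | i in I] L = class_count x [set: I] L.
Proof.
rewrite /class_count -[RHS](card_imset _ f_inj); congr #|pred_of_set _|.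
apply/setP => j; rewrite inE; apply/andP/imsetP.
  case=> /imsetP[i _ ->]; rewrite (link_hom_trail wx wy _ hf f_inj) => h.
  by exists i; rewrite // !inE.
by case=> i; rewrite !inE /= => h ->; rewrite imset_f // (link_hom_trail wx wy _ hf f_inj).
Qed.

Lemma iso_class_count (f_bij : bijective f) L :
  class_count x [set: I] L = class_count y [set: J] L.
Proof.
rewrite -(class_count_image (bij_inj f_bij)); congr class_count; apply/setP => j; rewrite [RHS]inE.
by case: f_bij => g fK gK; apply/imsetP; exists (g j); rewrite ?gK.
Qed.

Lemma iso_size (f_bij : bijective f) :
  \sum_i size (link_lap x i) = \sum_j size (link_lap y j).
Proof.
rewrite [RHS](reindex f) /=; last exact: onW_bij.
have [h1 h2 h3 h4 h5] := link_homP _ _ _ hf.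
by apply: eq_bigr => i _; rewrite /link_lap h4 !h1 h2 h3.
Qed.

(** A label missed by [f] would increase the count of the class of its trail. *)
Lemma hom_surj (f_inj : injective f) :
  (forall L, class_count x [set: I] L = class_count y [set: J] L) -> bijective f.
Proof.
move=> h; have sub : [set f i | i in I] \subset [set: J] by apply/fintype.subsetP => j; rewrite !inE.
apply: inj_card_bij => //; rewrite -(card_imset _ f_inj) -cardsT.
apply/subset_leq_card/fintype.subsetP => j _; apply/negPn/negP => jf.
have [L jL] := trail_represents wy j.
have := class_countID y L sub; rewrite class_count_image // h => /eqP.
rewrite -[X in X == _]addn0 eqn_add2l eq_sym cards_eq0 => /eqP/setP/(_ j).
by rewrite !inE jf jL.
Qed.

End Isomorphisms.

Section Relabel.
Context (I J : finType) (g : I -> J) (h : J -> I) (y : linkage Gam J).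
Hypotheses (gK : cancel g h) (hK : cancel h g) (wy : wf y).

Definition relabel := Linkage (lab y \o g) (h \o lk1 y \o g) (h \o lk2 y \o g)
  (br1 y \o g) (br2 y \o g).

Lemma relabel_hom : link_hom relabel y g.
Proof. by apply/link_homP; split=> i //=; rewrite hK. Qed.

Lemma relabel_wf : wf relabel.
Proof.
case: wy => a1 a2 a3 a4 a5 a6 a7 a8 a9; split=> i /=; rewrite ?hK //.
- by rewrite a1 gK.
- by apply/eqP => /(congr1 g); rewrite hK; apply/eqP.
- by rewrite a3 gK.
- by apply/eqP => /(congr1 g); rewrite hK; apply/eqP.
Qed.

End Relabel.

Lemma hom_id_wf (I : finType) (x y : linkage Gam I) : link_hom x y id -> wf y -> wf x.
Proof.
case/link_homP=> h1 h2 h3 h4 h5 [a1 a2 a3 a4 a5 a6 a7 a8 a9].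
by split=> i; rewrite -?h4 -?h5 -?h1 -?h2 -?h3 -?h4 -?h5.
Qed.

(** * Relabellings of identical crossings: orbits and stabilisers of pairs of bridges *)

Section Labels.
Context (s : seq (nepath Gam)).
Hypothesis s_cross : forall c, c \in s -> is_crossing D F1 F2 c.
Local Notation n := (size s).
Local Notation zpair := (zbridge_pair Gam n).

Definition link_of (b : zpair) : linkage Gam 'I_n :=
  Linkage (tnth (in_tuple s)) b.1.1 b.2.1 b.1.2 b.2.2.

Definition of_link (x : linkage Gam 'I_n) : zpair :=
  ((finfun (lk1 x), finfun (br1 x)), (finfun (lk2 x), finfun (br2 x))).

Definition valid (b : zpair) :=
  is_zbridge (remove_vertices D F1) (@endpoints2 _ s) b.1 &&
  is_zbridge (remove_vertices D F2) (@endpoints1 _ s) b.2.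

Lemma valid_wf b : valid b <-> wf (link_of b).
Proof.
split.
  case/andP=> /andP[/forallP p1 /forallP z1] /andP[/forallP p2 /forallP z2].
  split=> i /=.
  - by case/andP: (p1 i) => _ /eqP.
  - by case/andP: (p1 i).
  - by case/andP: (p2 i) => _ /eqP.
  - by case/andP: (p2 i).
  - by apply: s_cross; exact: mem_tnth.
  - by case/andP: (z1 i).
  - by case/andP: (z1 i) => _ /eqP.
  - by case/andP: (z2 i).
  - by case/andP: (z2 i) => _ /eqP.
case=> a1 a2 a3 a4 a5 a6 a7 a8 a9; apply/andP; split; apply/andP; split; apply/forallP => i.
- by rewrite a2 /=; apply/eqP; exact: a1.
- by apply/andP; split; [exact: a6 | apply/eqP; exact: a7].
- by rewrite a4 /=; apply/eqP; exact: a3.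
- by apply/andP; split; [exact: a8 | apply/eqP; exact: a9].
Qed.

Lemma trail_link b i : trail b i = link_trail (link_of b) i.
Proof. by []. Qed.

Lemma of_link_hom x : (forall i, lab x i = tnth (in_tuple s) i) ->
  link_hom (link_of (of_link x)) x id.
Proof. by move=> h; apply/link_homP; split=> i /=; rewrite ?ffunE. Qed.

Lemma connect_linked b i j : wf (link_of b) ->
  connect (linked b) i j = (j \in component (link_of b) i).
Proof.
move=> w; set x := link_of b.
have l1 k : connect (linked b) k (lk1 x k) by apply: connect1; rewrite /linked eqxx.
have l2 k : connect (linked b) k (lk2 x k) by apply: connect1; rewrite /linked eqxx orbT.
have lhop k a : connect (linked b) k (iter a (hop x) k).
  by elim: a => //= a IH; apply: (connect_trans IH); apply: (connect_trans (l1 _)); exact: l2.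
apply/idP/idP; last first.
  rewrite (mem_component w) -!fconnect_orbit => /orP[] /iter_findex h.
    by rewrite -h.
  rewrite -[j](lk1K w) -/x -h; apply: connect_trans (lhop _ _) _.
  exact: l1.
have cl : fingraph.closed (linked b) (mem (component x i)).
  move=> k l /orP[/eqP ->|/eqP ->] /=.
    by rewrite -[b.1.1 k]/(lk1 x k) (mem_component_lk1 w).
  by rewrite -[b.2.1 k]/(lk2 x k) (mem_component_lk2 w).
by move=> /(closed_connect cl) /=; rewrite (mem_component_refl w).
Qed.

Lemma connect_linked_sym b : wf (link_of b) -> connect_sym (linked b).
Proof.
move=> w i j; rewrite !connect_linked //; exact: (mem_component_sym w).
Qed.

(** Each component of [linked] with loop [L] carries [ncrossings L] labels, whereas [concatenation]
    counts it once, through its root. *)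
Lemma concatenation_class_count b L : wf (link_of b) ->
  class_count (link_of b) [set: 'I_n] L = ncrossings L * concatenation b L.
Proof.
move=> w; set x := link_of b; have cs := connect_linked_sym w.
rewrite /class_count -sum1dep_card.
rewrite (partition_big (fingraph.root (linked b)) (mem (fingraph.roots (linked b)))) /=; last first.
  by move=> i _; exact: roots_root.
rewrite /concatenation -sum1_count big_distrr /= big_enum_cond big_mkcondr /=.
apply: eq_bigr => r rr.
transitivity (class_count x [set j in component x r] L).
  rewrite /class_count -sum1dep_card; apply: eq_bigl => i; rewrite !inE /=.
  rewrite andbC; congr (_ && _); rewrite -(connect_linked _ _ w).
  by rewrite -{1}(eqP rr) (root_connect cs) cs.
have [L0 hL0] := trail_represents w r.
rewrite (class_count_component F12 _ w hL0) muln1 trail_link -/x.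
case: eqP => [<-|ne]; first by rewrite hL0 muln1.
rewrite muln0; case: ifP => // hL; case: ne.
exact: represents_inj hL0 hL.
Qed.

Lemma concatenation_list b : wf (link_of b) -> exists2 ls,
  (forall L, L \in ls -> crossing_loop L) & forall L, concatenation b L = count_mem L ls.
Proof.
move=> w; pose cl i := unroot (RLoop (link_trail_is_loop w i)).
have clE i L : represents (trail b i) L = (cl i == L).
  exact: (represents_unroot (RLoop (link_trail_is_loop w i))).
exists (map cl (enum (fingraph.roots (linked b)))) => [_ /mapP[i _ ->]|L].
  by apply: (trail_crossing_loop (i := i) w); rewrite -trail_link clE.
by rewrite count_map; apply: eq_count => i; rewrite /= clE.
Qed.

Definition label_perms := [set f : {perm 'I_n} |
  [forall i, tnth (in_tuple s) (f i) == tnth (in_tuple s) i]].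

Lemma link_hom_labels b b' (f : {perm 'I_n}) :
  link_hom (link_of b) (link_of b') f -> f \in label_perms.
Proof. by case/link_homP=> h _ _ _ _; rewrite inE; apply/forallP => i; apply/eqP/h. Qed.

(** The action of a relabelling on pairs of bridges. The crossings stay those of [s], which is why
    [push_hom] asks [f] to preserve them. *)
Definition push (f : {perm 'I_n}) (b : zpair) : zpair :=
  of_link (relabel (f^-1)%g f (link_of b)).

Lemma push_hom (f : {perm 'I_n}) b : f \in label_perms ->
  link_hom (link_of b) (link_of (push f b)) f.
Proof.
rewrite inE => /forallP fs; apply/link_homP; split=> i; rewrite /= ?ffunE /= ?permK //.
exact/eqP.
Qed.

Lemma push_unique (f : {perm 'I_n}) b b' : link_hom (link_of b) (link_of b') f -> b' = push f b.
Proof.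
case/link_homP=> _ /= h2 h3 h4 h5; case: b' h2 h3 h4 h5 => -[t1 e1] [t2 e2] /= h2 h3 h4 h5.
by congr ((_, _), (_, _)); apply/ffunP => i; rewrite ffunE /= -?h2 -?h3 -?h4 -?h5 permKV.
Qed.

Lemma iso_concatenation b b' (f : 'I_n -> 'I_n) : wf (link_of b) -> wf (link_of b') ->
  link_hom (link_of b) (link_of b') f -> bijective f ->
  concatenation b = concatenation b'.
Proof.
move=> w w' hf f_bij; apply/funext => L.
have e : ncrossings L * concatenation b L = ncrossings L * concatenation b' L.
  by rewrite -!concatenation_class_count // (iso_class_count w w' hf f_bij).
(* If [ncrossings L] is zero then no trail represents [L], and both concatenations vanish at [L]. *)
case: (posnP (ncrossings L)) e => [n0 _|n0 /eqP]; last by rewrite eqn_pmul2l // => /eqP.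
have c0 (b0 : zpair) : wf (link_of b0) -> concatenation b0 L = 0.
  move=> w0; apply/eqP; rewrite /concatenation -leqn0 leqNgt -has_count; apply/hasPn => i _.
  by apply/negP => /(ncrossings_gt0 F12 w0); rewrite n0.
by rewrite !c0.
Qed.

Lemma symmetry_weight_gt0 (ls : seq (uloop Gam)) : 0 < symmetry_weight ls.
Proof.
elim: ls => //= L ls IH; rewrite eqxx !muln_gt0 IH andbT /=.
by rewrite -has_count has_pred1 mem_dih ?repr_neq0 // same_loop_refl.
Qed.

Lemma saturated_setT (J : finType) (x : linkage Gam J) : saturated x [set: J].
Proof. by move=> i j _ _; rewrite !inE. Qed.

Lemma link_hom_comp (I J K : finType) (x : linkage Gam I) (y : linkage Gam J)
  (z : linkage Gam K) f g : link_hom x y f -> link_hom y z g -> link_hom x z (g \o f).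
Proof.
case/link_homP=> a1 a2 a3 a4 a5 /link_homP[b1 b2 b3 b4 b5].
by apply/link_homP; split=> i /=; rewrite ?b1 ?b2 ?b3 ?b4 ?b5 ?a1 ?a2 ?a3 ?a4 ?a5.
Qed.

Lemma link_hom_inv (I J : finType) (x : linkage Gam I) (y : linkage Gam J) f g :
  link_hom x y f -> cancel f g -> cancel g f -> link_hom y x g.
Proof.
case/link_homP=> a1 a2 a3 a4 a5 fK gK.
apply/link_homP; split=> i.
- by rewrite -{2}(gK i) a1.
- by rewrite -{2}(gK i) a2.
- by rewrite -{2}(gK i) a3.
- by rewrite -{2}(gK i) a4 fK.
- by rewrite -{2}(gK i) a5 fK.
Qed.

Section Model.
Context (ls : seq (uloop Gam)) (J : finType) (x : linkage Gam J).
Hypothesis mx : is_model D F1 F2 ls x.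

Lemma card_embeddings_model b : wf (link_of b) ->
  (forall L, concatenation b L = count_mem L ls) ->
  #|embeddings x (link_of b) [set: 'I_n]| = symmetry_weight ls.
Proof.
move=> w bls; apply: (model_embeddings mx) => //; first exact: saturated_setT.
by move=> L; rewrite concatenation_class_count // bls.
Qed.

Lemma model_iso b : wf (link_of b) -> (forall L, concatenation b L = count_mem L ls) ->
  exists2 f : J -> 'I_n, link_hom x (link_of b) f & bijective f.
Proof.
move=> w bls; have := symmetry_weight_gt0 ls; rewrite -(card_embeddings_model w bls).
case/card_gt0P => f /embeddingsP[hf f_inj _]; exists f => //.
apply: (hom_surj (model_wf mx) w hf f_inj) => L.
by rewrite concatenation_class_count // bls (model_count mx).
Qed.

(** Composition with a fixed isomorphism from the model to [b] identifies these permutations with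
    the embeddings of the model into [b']. *)
Lemma card_isos b b' : wf (link_of b) -> wf (link_of b') ->
  (forall L, concatenation b L = count_mem L ls) ->
  (forall L, concatenation b' L = count_mem L ls) ->
  #|[set f : {perm 'I_n} | link_hom (link_of b) (link_of b') f]| = symmetry_weight ls.
Proof.
move=> w w' bls bls'; rewrite -(card_embeddings_model w' bls').
have [f hf [h fK hK]] := model_iso w bls.
pose c (e : {perm 'I_n}) : {ffun J -> 'I_n} := [ffun j => e (f j)].
rewrite -(@card_in_imset _ _ c); last first.
  move=> e e' _ _ /ffunP cc; apply/perm.permP => i; have := cc (h i).
  by rewrite !ffunE hK.
congr #|pred_of_set _|; apply/setP => e; apply/imsetP/embeddingsP.
  case=> e'; rewrite inE => he' ->; split; last by move=> i; rewrite inE.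
    have cE : c e' =1 e' \o f by move=> i; rewrite ffunE.
    have [h1 h2 h3 h4 h5] := link_homP _ _ _ (link_hom_comp hf he').
    by apply/link_homP; split=> i; rewrite !cE.
  by move=> i j; rewrite !ffunE => /perm_inj/(can_inj fK).
case=> he e_inj _; have eh_inj : injective (e \o h) by apply: inj_comp => //; exact: can_inj hK.
exists (perm eh_inj); last by apply/ffunP => j; rewrite ffunE permE /= fK.
rewrite inE.
have [h1 h2 h3 h4 h5] := link_homP _ _ _ (link_hom_comp (link_hom_inv hf fK hK) he).
by apply/link_homP; split=> i; rewrite !permE.
Qed.

End Model.

(* The pairs with the same concatenation as [b] form its orbit under the
   relabellings of identical crossings, of stabiliser [symmetry_weight ls]. *)
Lemma valid_count b ls : valid b -> (forall L, concatenation b L = count_mem L ls) ->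
  (forall L, L \in ls -> crossing_loop L) ->
  exists A : seq zpair, [/\ uniq A,
    forall b', (b' \in A) = valid b' && `[< concatenation b' = concatenation b >] &
    size A * symmetry_weight ls = #|label_perms|].
Proof.
move=> vb bls lsP; have w := (valid_wf b).1 vb; have [J [x mx]] := model_exists F12 lsP.
have push_wf f : f \in label_perms -> wf (link_of (push f b)).
  move=> fP; have hf := push_hom b fP.
  have [_ _ _ h4 h5] := link_homP _ _ _ hf.
  apply: (hom_id_wf (of_link_hom _)) (relabel_wf _ _ w) => [i /=|i|i]; last 2 first.
  - by rewrite permKV.
  - by rewrite permK.
  have := fP; rewrite inE => /forallP/(_ (f^-1%g i))/eqP; by rewrite permKV.
have push_conc f : f \in label_perms -> concatenation (push f b) = concatenation b.
  move=> fP; apply/esym; apply: (iso_concatenation w (push_wf f fP) (push_hom b fP)).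
  by exists (f^-1)%g; [exact: permK | exact: permKV].
exists (undup [seq push f b | f <- enum label_perms]); split; first exact: undup_uniq.
  move=> b'; rewrite mem_undup; apply/mapP/andP.
    case=> f; rewrite mem_enum => fP ->; split; first exact/valid_wf/push_wf.
    exact/asboolP/push_conc.
  case=> /valid_wf w' /asboolP e.
  have bls' L : concatenation b' L = count_mem L ls by rewrite e.
  have := symmetry_weight_gt0 ls; rewrite -(card_isos mx w w' bls bls') => /card_gt0P[f].
  rewrite inE => hf; exists f; first by rewrite mem_enum; exact: link_hom_labels hf.
  exact: push_unique.
(* The relabellings are grouped by their image; the fibre over [b'] consists of the isomorphisms
   from [b] to [b']. *)
rewrite cardE -(size_map (push^~ b)) -[RHS](perm_size (perm_count_undup _)) size_flatten.
rewrite /shape -map_comp sumnE big_map.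
rewrite (eq_big_seq (fun=> symmetry_weight ls)) => [|b'].
  by rewrite big_const_seq count_predT iter_addn_0 mulnC.
rewrite mem_undup => /mapP[g]; rewrite mem_enum => gP eb' /=; rewrite size_nseq count_map.
have w' : wf (link_of b') by rewrite eb'; exact: push_wf.
have bls' L : concatenation b' L = count_mem L ls by rewrite eb' push_conc.
rewrite -(card_isos mx w w' bls bls') -sum1_count big_enum_cond sum1dep_card.
congr #|pred_of_set _|; apply/setP => f; rewrite [LHS]inE [RHS]inE.
apply/andP/idP => [[fP /eqP <-]|hf]; first exact: push_hom.
by split; [exact: link_hom_labels hf | apply/eqP; rewrite -(push_unique hf)].
Qed.

Lemma involution_sum (t : 'I_n -> 'I_n) (v : 'I_n -> nat) :
  involutive t -> (forall i, t i != i) -> (forall i, v (t i) = v i) ->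
  \sum_i v i = (\sum_(i : 'I_n | i < t i) v i).*2.
Proof.
move=> tK tn vt; rewrite (bigID (fun i : 'I_n => i < t i)) /= -addnn; congr (_ + _).
rewrite (reindex_inj (inv_inj tK)) /=; apply: eq_big => [i|i _]; last exact: vt.
rewrite tK -leqNgt leq_eqVlt (_ : (nat_of_ord i == t i) = false) //.
by apply/negbTE; rewrite (inj_eq val_inj) eq_sym; exact: tn.
Qed.

(** The laps of all labels run through every loop in both directions, each crossing lies in the laps
    of two labels, and each bridge is seen from both of its ends: everything is counted twice. *)
Lemma valid_size b ls : valid b -> (forall L, concatenation b L = count_mem L ls) ->
  (forall L, L \in ls -> crossing_loop L) ->
  \sum_(L <- ls) size (repr L : seq _) = \sum_(c <- s) size (darts_of c) +
    \sum_(i : 'I_n | i < b.1.1 i) size (b.1.2 i) + \sum_(i : 'I_n | i < b.2.1 i) size (b.2.2 i).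
Proof.
move=> vb bls lsP; have w := (valid_wf b).1 vb; have [J [x mx]] := model_exists F12 lsP.
have [f hf f_bij] := model_iso mx w bls.
apply: double_inj; rewrite -(model_size mx) (iso_size hf f_bij) !doubleD.
case: (w) => a1 a2 a3 a4 _ _ a5 _ a6; rewrite /= in a1 a2 a3 a4 a5 a6.
rewrite -(@involution_sum b.1.1 (fun i => size (b.1.2 i))) // => [|i]; last first.
  by rewrite a5 size_bflip.
rewrite -(@involution_sum b.2.1 (fun i => size (b.2.2 i))) // => [|i]; last first.
  by rewrite a6 size_bflip.
have lapE i : size (link_lap (link_of b) i) = size (darts_of (tnth (in_tuple s) i)) +
    size (b.1.2 i) + size (darts_of (tnth (in_tuple s) (b.1.1 i))) + size (b.2.2 (b.1.1 i)).
  by rewrite /link_lap !size_cat size_bflip !addnA.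
rewrite (big_tnth _ _ s) -addnn (eq_bigr _ (fun i _ => lapE i)) !big_split.
rewrite -(reindex_inj (inv_inj a1) (P := predT) (F := fun i => size (darts_of (tnth (in_tuple s) i)))) /=.
rewrite -(reindex_inj (inv_inj a1) (P := predT) (F := fun i => size (b.2.2 i))) /=.
by rewrite [X in X + _ = _]addnAC.
Qed.

Lemma valid_count_mem b ls c : valid b -> (forall L, concatenation b L = count_mem L ls) ->
  (forall L, L \in ls -> crossing_loop L) -> is_crossing D F1 F2 c ->
  count_mem c s = \sum_(L <- ls) occ L (darts_of c).
Proof.
move=> vb bls lsP cc; have w := (valid_wf b).1 vb; have [J [x mx]] := model_exists F12 lsP.
have [f hf f_bij] := model_iso mx w bls; have [h1 _ _ _ _] := link_homP _ _ _ hf.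
rewrite -(model_lab mx cc) -(card_imset _ (bij_inj f_bij)) -sum1_count big_tnth.
rewrite sum1dep_card; congr #|pred_of_set _|; apply/setP => i; rewrite inE.
apply/eqP/imsetP => [e|[j]]; last by rewrite inE -h1 => /eqP <- ->.
by case: f_bij => g fK gK; exists (g i); rewrite ?gK // inE -h1 gK; apply/eqP.
Qed.

Lemma valid_exists ls : (forall L, L \in ls -> crossing_loop L) ->
  (forall c, is_crossing D F1 F2 c -> count_mem c s = \sum_(L <- ls) occ L (darts_of c)) ->
  exists2 b, valid b & forall L, concatenation b L = count_mem L ls.
Proof.
move=> lsP cs; have [J [x mx]] := model_exists F12 lsP.
have sJ : perm_eq s [seq lab x j | j <- enum J].
  apply/allP => c _; rewrite /= (_ : count_mem c (map _ _) = #|[set j | lab x j == c]|); last first.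
    by rewrite count_map -sum1_count big_enum_cond /= sum1dep_card.
  case cc: (is_crossing D F1 F2 c); first by rewrite cs // -(model_lab mx cc).
  rewrite (_ : count_mem c s = 0); last first.
    by apply/count_memPn/negP => /s_cross; rewrite cc.
  apply/eqP/esym/eq_card0 => j; rewrite inE; apply/negP => /eqP e.
  by have := lab_crossing (model_wf mx) j; rewrite e cc.
(* The model has as many copies of each crossing as [s], so its labels can be renumbered along
   [s]. *)
have [g g_inj gs] : exists2 g : 'I_n -> J, injective g & forall i, lab x (g i) = tnth (in_tuple s) i.
  have szs : n = #|J| by rewrite (perm_size sJ) size_map cardE.
  case: (pickP (mem J)) => [j0 _|J0]; last first.
    have n0 : n = 0 by rewrite szs; exact: eq_card0.
    have no (i : 'I_n) : False by case: i => i; rewrite n0.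
    by exists (fun i => False_rect _ (no i)) => i; case: (no i).
  have [Is Isp es] := perm_iotaP (lab x j0) sJ.
  have sIs : size Is = n by rewrite [in RHS]es size_map.
  exists (fun i : 'I_n => nth j0 (enum J) (nth 0 Is i)).
    have IsJ (i : 'I_n) : nth 0 Is i < size (enum J).
      have : nth 0 Is i \in Is by rewrite mem_nth // sIs.
      by rewrite (perm_mem Isp) mem_iota size_map.
    move=> i k /eqP; rewrite nth_uniq ?enum_uniq // nth_uniq ?sIs //; last first.
      by rewrite (perm_uniq Isp) iota_uniq.
    by move/eqP/val_inj.
  move=> i; rewrite (tnth_nth (lab x j0)) /=.
  transitivity (nth (lab x j0) [seq nth (lab x j0) [seq lab x j | j <- enum J] k | k <- Is] i).
    2: by rewrite -es.
  rewrite (nth_map 0) ?sIs // (nth_map j0) //.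
  have : nth 0 Is i \in Is by rewrite mem_nth // sIs.
  by rewrite (perm_mem Isp) mem_iota size_map.
have [h gK hK] : bijective g.
  apply: inj_card_bij => //; rewrite card_ord (perm_size sJ) size_map -cardE //.
pose r := relabel g h x; have wr : wf r := relabel_wf gK hK (model_wf mx).
have hr : link_hom r x g := relabel_hom x hK.
pose b := of_link r.
have hb : link_hom (link_of b) r id by apply: of_link_hom => i; rewrite /= gs.
have wb : wf (link_of b) := hom_id_wf hb wr.
exists b; first exact/valid_wf.
have hbx := link_hom_comp hb hr.
have g_bij : bijective (g \o id) by exists h.
move=> L; have := iso_class_count wb (model_wf mx) hbx g_bij L.
rewrite concatenation_class_count // (model_count mx) => /eqP.
case: (posnP (ncrossings L)) => [n0 _|n0]; last by rewrite eqn_pmul2l // => /eqP.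
have Lls : L \notin ls.
  apply/negP => /lsP /(single_model F12)[K [y [i0 [wy _ h0]]]].
  by have := ncrossings_gt0 F12 wy h0; rewrite n0.
rewrite (count_memPn Lls); apply/eqP; rewrite -leqn0 leqNgt -has_count; apply/hasPn => i _.
by apply/negP => /(ncrossings_gt0 F12 wb); rewrite n0.
Qed.

End Labels.
End Counting.

(** * Countable sums and Poisson configurations *)

Import Order.TTheory GRing.Theory Num.Theory.

Section ExtendedSums.
Context (R : realType).
Local Open Scope classical_set_scope.
Local Open Scope ring_scope.
Local Open Scope ereal_scope.

Lemma esumZl (T : choiceType) (I : set T) (a : T -> \bar R) (c : R) :
  (0 <= c)%R -> (forall i, 0 <= a i) ->
  \esum_(i in I) (c%:E * a i) = c%:E * \esum_(i in I) a i.
Proof.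
move=> c0 a0; rewrite /esum -ereal_supZl //; last first.
  by apply/set0P; exists (\sum_(x \in set0) a x); exists set0 => //; exact: fsets_set0.
congr ereal_sup; apply/seteqP; split => x /=.
  by case=> X XI <-; exists (\sum_(x \in X) a x); [exists X | rewrite ge0_mule_fsumr].
by case=> _ [X XI <-] <-; exists X => //; rewrite ge0_mule_fsumr.
Qed.

Lemma esumZr (T : choiceType) (I : set T) (a : T -> \bar R) (c : R) :
  (0 <= c)%R -> (forall i, 0 <= a i) ->
  \esum_(i in I) (a i * c%:E) = (\esum_(i in I) a i) * c%:E.
Proof.
by move=> c0 a0; rewrite muleC -esumZl //; apply: eq_esum => i _; rewrite muleC.
Qed.

Lemma esum_setX (T U : choiceType) (I : set T) (J : set U) (a : T -> R) (b : U -> R) :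
  (forall i, 0 <= a i)%R -> (forall j, 0 <= b j)%R ->
  \esum_(j in J) (b j)%:E < +oo ->
  \esum_(k in I `*` J) (a k.1 * b k.2)%:E =
  (\esum_(i in I) (a i)%:E) * \esum_(j in J) (b j)%:E.
Proof.
move=> a0 b0 bfin.
have bnum : \esum_(j in J) (b j)%:E \is a fin_num.
  by rewrite ge0_fin_numE // esum_ge0 // => j _; rewrite lee_fin.
rewrite -(fineK bnum) -esumZr; last 2 first.
- by apply/fine_ge0/esum_ge0 => j _; rewrite lee_fin.
- by move=> i; rewrite lee_fin.
rewrite -(@esum_esum _ _ _ I (fun=> J) (fun i j => (a i * b j)%:E)); last first.
  by move=> i j _ _; rewrite lee_fin mulr_ge0.
apply: eq_esum => i _; rewrite fineK // -esumZl //.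
Qed.

Lemma esum_seq (T : choiceType) (rs : seq T) (a : T -> \bar R) : uniq rs ->
  (forall i, 0 <= a i) -> \esum_(i in [set` rs]) a i = \sum_(i <- rs) a i.
Proof. by move=> urs a0; rewrite esum_fset // (fsbig_seq _ _ urs). Qed.

Lemma esum_subset (T : choiceType) (I J : set T) (a : T -> \bar R) :
  I `<=` J -> \esum_(i in I) a i <= \esum_(i in J) a i.
Proof.
move=> IJ; apply: ge_ereal_sup => _ [X [finX XI] <-]; apply: ereal_sup_ubound.
by exists X => //; split=> // x /XI /IJ.
Qed.

End ExtendedSums.

Section CountableUnions.
Local Open Scope classical_set_scope.
Context (Omega : Type) (T : Type) (K : set T) (E : T -> set Omega).
Hypothesis cK : countable K.

(** An injection into [nat] turns a countable family into a sequence with empty sets in the gaps, to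
    which results on sequences apply. *)
Lemma countable_bigcup_seq : exists (f : T -> nat) (F : nat -> set Omega),
  [/\ {in K &, injective f}, forall x, K x -> F (f x) = E x,
      forall n, F n = set0 \/ exists2 x, K x & f x = n /\ F n = E x &
      \bigcup_(x in K) E x = \bigcup_n F n].
Proof.
have [f f_inj] := countable_injP _ cK.
pose F n := \bigcup_(x in [set x | K x /\ f x = n]) E x.
have Ff x : K x -> F (f x) = E x.
  move=> Kx; apply/seteqP; split=> w /=; last by exists x.
  by case=> y [Ky fy] ?; rewrite -(f_inj y x) ?inE.
exists f, F; split => //.
  move=> n; case: (pselect (exists2 x, K x & f x = n)) => [[x Kx fx]|no].
    by right; exists x => //; rewrite -fx Ff.
  by left; apply/seteqP; split=> // w [x [Kx fx] _]; apply: no; exists x.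
apply/seteqP; split=> w; first by case=> x Kx Ew; exists (f x) => //; rewrite Ff.
by case=> n _ [x [Kx _] Ew]; exists x.
Qed.

End CountableUnions.

Section CountableSigma.
Local Open Scope classical_set_scope.
Context (Omega : Type) (G : set (set Omega)) (T : Type) (K : set T) (E : T -> set Omega).
Hypotheses (cK : countable K) (mE : forall x, K x -> <<s G >> (E x)).

Lemma sigma_countable_bigcup : <<s G >> (\bigcup_(x in K) E x).
Proof.
have [f [F [_ _ hF ->]]] := countable_bigcup_seq E cK.
have [h0 _ hU] := @smallest_sigma_algebra _ setT G.
by apply: hU => n; case: (hF n) => [->//|[x Kx [_ ->]]]; exact: mE.
Qed.

End CountableSigma.

Local Open Scope classical_set_scope.

Lemma sigma_countable_bigcap (Omega : Type) (G : set (set Omega)) (T : Type) (K : set T)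
    (E : T -> set Omega) : countable K -> (forall x, K x -> <<s G >> (E x)) ->
  <<s G >> (\bigcap_(x in K) E x).
Proof.
move=> cK mE; have [_ hC _] := @smallest_sigma_algebra _ setT G.
rewrite -[X in _ X]setCK setC_bigcap -setTD; apply: (hC).
apply: sigma_countable_bigcup => // x Kx.
by rewrite -setTD; apply: (hC); exact: mE.
Qed.

Section CountableMeasure.
Local Open Scope ring_scope.
Local Open Scope ereal_scope.
Context (R : realType) (d : measure_display) (Omega : measurableType d).
Context (mu : {measure set Omega -> \bar R}) (T : choiceType).

Lemma countable_bigcup_measurable (K : set T) (E : T -> set Omega) : countable K ->
  (forall x, K x -> measurable (E x)) -> measurable (\bigcup_(x in K) E x).
Proof.
move=> cK mE; have [f [F [_ _ hF ->]]] := countable_bigcup_seq E cK.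
by apply: bigcup_measurable => n _; case: (hF n) => [->//|[x Kx [_ ->]]]; exact: mE.
Qed.

Lemma countable_bigcap_measurable (K : set T) (E : T -> set Omega) : countable K ->
  (forall x, K x -> measurable (E x)) -> measurable (\bigcap_(x in K) E x).
Proof.
move=> cK mE; rewrite -[X in measurable X]setCK setC_bigcap; apply: measurableC.
by apply: countable_bigcup_measurable => // x Kx; apply: measurableC; exact: mE.
Qed.

Lemma negligible_countable_bigcup (K : set T) (E : T -> set Omega) : countable K ->
  (forall x, K x -> mu.-negligible (E x)) -> mu.-negligible (\bigcup_(x in K) E x).
Proof.
move=> cK mE; have [f [F [_ _ hF ->]]] := countable_bigcup_seq E cK.
apply: negligible_bigcup => n; case: (hF n) => [->|[x Kx [_ ->]]]; last exact: mE.
exact: negligible_set0.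
Qed.

Lemma measure_countable_bigcup (K : set T) (E : T -> set Omega) : countable K ->
  (forall x, K x -> measurable (E x)) -> trivIset K E ->
  mu (\bigcup_(x in K) E x) = \esum_(x in K) mu (E x).
Proof.
move=> cK mE tE; have [f [F [f_inj Ff hF ->]]] := countable_bigcup_seq E cK.
have mF n : measurable (F n) by case: (hF n) => [->//|[x Kx [_ ->]]]; exact: mE.
rewrite measure_bigcup //; last first.
  move=> n m _ _; case: (hF n) => [->|[x Kx [<- ->]]]; first by rewrite set0I => /set0P/eqP.
  case: (hF m) => [->|[y Ky [<- ->]]]; first by rewrite setI0 => /set0P/eqP.
  by move=> /(tE x y Kx Ky) ->.
rewrite nneseries_esum; last by move=> n _; exact: measure_ge0.
have -> : [set n | n \in [set: nat]] = [set: nat] by apply/seteqP; split=> n //= _; rewrite in_setT.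
rewrite -[RHS](eq_esum (fun x Kx => congr1 mu (Ff x Kx))) -(esum_image K f (mu \o F)) //.
rewrite [RHS]esum_mkcond; apply: eq_esum => n _.
case: ifPn => // /negP nK; case: (hF n) => [->|[x Kx [fx _]]]; first by rewrite measure0.
by case: nK; apply/mem_set; exists x.
Qed.

End CountableMeasure.

Local Open Scope classical_set_scope.
Local Open Scope ring_scope.

(** The product of the factorials of the multiplicities: the successive copies of [t] contribute all
    the integers from its multiplicity down to 1. *)
Fixpoint multiplicity_factorial (T : eqType) (ls : seq T) : nat :=
  if ls is t :: ls' then (count_mem t ls * multiplicity_factorial ls')%N else 1%N.

Lemma prod_multiplicities (R : realType) (T : eqType) (r : T -> R) (s ls : seq T) :
  uniq s -> {subset ls <= s} ->
  \prod_(t <- s) (r t ^+ count_mem t ls / (count_mem t ls)`!%:R) =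
  (\prod_(t <- ls) r t) / (multiplicity_factorial ls)%:R.
Proof.
move=> us; elim: ls => [_|t ls IH sub].
  by rewrite big_nil big1 ?divr1 // => t _; rewrite /= expr0 fact0 divr1.
have ts : t \in s by rewrite sub // mem_head.
have {}IH := IH (fun u uls => sub u (mem_behead (s := t :: ls) uls)).
rewrite (bigD1_seq t) //= eqxx /= add1n factS exprS.
rewrite (eq_bigr (fun u => r u ^+ count_mem u ls / (count_mem u ls)`!%:R)); last first.
  by move=> u ut; rewrite eq_sym (negPf ut).
move: IH; rewrite (bigD1_seq t) //= big_cons.
set B := \big[_/_]_(_ <- _ | _) _; set c := count_mem t ls; set Q := \prod_(_ <- _) _ => IH.
rewrite !natrM !invfM.
transitivity (r t * c.+1%:R^-1 * (r t ^+ c / c`!%:R * B)); first by ring.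
by rewrite IH; ring.
Qed.

Lemma poisson_prob_set1 (R : realType) (r : R) (k j : nat) : 0 <= r ->
  poisson_prob r j [set k] = (r ^+ k / k`!%:R * expR (- r))%:E.
Proof.
rewrite /poisson_prob le_eqVlt => /predU1P[<-|r0].
  rewrite ltxx oppr0 expR0 mulr1 diracE; case: k => [|k].
    by rewrite mem_set // expr0 fact0 divr1.
  by rewrite memNset ?expr0n ?mul0r.
rewrite r0 esum_set1; first by rewrite /poisson_pmf r0.
by rewrite lee_fin poisson_pmf_ge0.
Qed.

(** * The law of the whole configuration on a set of finite mass *)

Section PoissonConfiguration.
Context (R : realType) (d : measure_display) (Omega : measurableType d).
Context (P : probability Omega R) (T : choiceType).
Context (N : Omega -> T -> nat) (mu : set T -> \bar R).
Hypothesis ppp : poisson_point_process P N mu.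
Hypothesis mu_ge0 : forall A, (0 <= mu A)%E.
Hypothesis muID : forall A B, mu A = (mu (A `&` B) + mu (A `\` B))%E.

Lemma npoints_set1 (n : T -> nat) t : npoints R n [set t] = (n t)%:R%:E.
Proof. by rewrite /npoints esum_set1 // lee_fin. Qed.

Lemma npoints_eq0 (n : T -> nat) A : npoints R n A = 0%E <-> forall t, A t -> n t = 0%N.
Proof.
split=> [n0 t At|n0].
  have : ((n t)%:R%:E <= npoints R n A)%E.
    by rewrite -npoints_set1; apply: esum_subset => _ ->.
  by rewrite n0 lee_fin lern0 => /eqP.
by rewrite /npoints esum1 // => t /n0 ->.
Qed.

Lemma mu_monotone A B : A `<=` B -> (mu A <= mu B)%E.
Proof. by move=> AB; rewrite (muID B A) setIC (setIidl AB) leeDl. Qed.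

Lemma mu_set_seq (s : seq T) A : uniq s -> {subset s <= A} ->
  mu A = (mu (A `\` [set` s]) + \sum_(t <- s) mu [set t])%E.
Proof.
elim: s A => [|t s IH] A us sA.
  by rewrite big_nil adde0; congr mu; apply/seteqP; split=> x //= [].
case/andP: us => ts us; rewrite (IH A us) => [|u us']; last by rewrite sA // mem_behead.
rewrite (muID (A `\` [set` s]) [set t]) big_cons -addeA [RHS]addeCA; congr (_ + _)%E.
  congr mu; apply/seteqP; split=> x /=; last first.
    by move=> ->; split=> //; split; [apply/set_mem; rewrite sA // mem_head | apply/negP].
  by case.
congr (mu _ + _)%E; apply/seteqP; split=> x /=.
  by case=> -[Ax xs] xt; split=> //; rewrite inE => /predU1P[].
case=> Ax xts; split; [split=> // xs|move=> xt]; apply: xts; rewrite inE ?xs ?orbT //.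
by rewrite xt eqxx.
Qed.

(** [A] is split into the singletons of the points that occur and the remainder, which must contain
    no point. The Poisson laws of these disjoint sets multiply, and their exponents add up to the
    mass of [A]. *)
Lemma poisson_config (A : set T) (ls : seq T) : (mu A < +oo)%E -> {subset ls <= A} ->
  P [set w | forall t, A t -> N w t = count_mem t ls] =
  (expR (- fine (mu A)) * \prod_(t <- ls) fine (mu [set t]) /
   (multiplicity_factorial ls)%:R)%:E.
Proof.
move=> Afin lsA; set s := undup ls.
have us : uniq s by exact: undup_uniq.
have sA : {subset s <= A} by move=> t; rewrite mem_undup; exact: lsA.
(* Index 0 is the remainder; the other indices are the distinct points of [ls]. *)
pose B (i : 'I_(size s).+1) := if unlift ord0 i is Some j then [set tnth (in_tuple s) j]
  else A `\` [set` s].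
pose k (i : 'I_(size s).+1) := if unlift ord0 i is Some j
  then count_mem (tnth (in_tuple s) j) ls else 0%N.
have B0 : B ord0 = A `\` [set` s] by rewrite /B unlift_none.
have BS j : B (lift ord0 j) = [set tnth (in_tuple s) j] by rewrite /B liftK.
have k0 : k ord0 = 0%N by rewrite /k unlift_none.
have kS j : k (lift ord0 j) = count_mem (tnth (in_tuple s) j) ls by rewrite /k liftK.
have BA i : B i `<=` A.
  case: (unliftP ord0 i) => [j|] ->; rewrite ?B0 ?BS; last by move=> x [].
  by move=> _ ->; apply/set_mem/sA; exact: mem_tnth.
have Bfin i : (mu (B i) < +oo)%E by apply: le_lt_trans Afin; exact: mu_monotone.
have tB : trivIset setT B.
  move=> i j _ _; case: (unliftP ord0 i) => [i'|] ->;
    case: (unliftP ord0 j) => [j'|] ->; rewrite ?B0 ?BS //.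
  - case=> x [/= -> /eqP]; rewrite (tnth_nth x) [in X in _ == X](tnth_nth x) nth_uniq //.
    by move=> /eqP/val_inj ->.
  - by case=> x [/= -> [_ []]]; exact: mem_tnth.
  - by case=> x [[_ xs] /= e]; case: xs; rewrite /= e; exact: mem_tnth.
have [_ PB] := ppp.2 _ B k Bfin tB.
have -> : [set w | forall t, A t -> N w t = count_mem t ls] =
    \bigcap_(i in setT) [set w | npoints R (N w) (B i) = (k i)%:R%:E].
  apply/seteqP; split=> w /= h.
    move=> i _; case: (unliftP ord0 i) => [j|] ->; rewrite /= ?BS ?B0 ?kS ?k0.
      by rewrite npoints_set1 h //; apply/set_mem/sA; exact: mem_tnth.
    apply/npoints_eq0 => t [At ts]; rewrite h //; apply/count_memPn/negP => tls.
    by apply: ts; rewrite /= mem_undup.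
  move=> t At; case: (boolP (t \in s)) => ts; last first.
    have := h ord0 I; rewrite /= B0 k0 => /npoints_eq0 ->; last by split=> //; exact/negP.
    by apply/esym/count_memPn; rewrite -mem_undup.
  have [j ej] : exists j, t = tnth (in_tuple s) j by exact/tnthP.
  have := h (lift ord0 j) I; rewrite /= BS kS npoints_set1 -ej => -[] /eqP.
  by rewrite eqr_nat => /eqP.
rewrite PB big_ord_recl B0 k0.
have fin_set1 t : t \in s -> mu [set t] \is a fin_num.
  move=> ts; rewrite ge0_fin_numE //; apply: le_lt_trans Afin; apply: mu_monotone => _ ->.
  exact/set_mem/sA.
have finD : mu (A `\` [set` s]) \is a fin_num.
  by rewrite ge0_fin_numE //; rewrite -B0.
rewrite poisson_prob_set1 ?fine_ge0 //.
pose q t : R := fine (mu [set t]) ^+ count_mem t ls / (count_mem t ls)`!%:R *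
  expR (- fine (mu [set t])).
have -> : (\prod_(i < size s) poisson_prob (fine (mu (B (lift ord0 i)))) 0 [set k (lift ord0 i)])%E =
    (\prod_(t <- s) (q t)%:E)%E.
  rewrite [RHS]big_tnth; apply: eq_bigr => i _.
  by rewrite BS kS poisson_prob_set1 ?fine_ge0.
rewrite prodEFin -EFinM; congr _%:E; rewrite big_split /=.
rewrite (prod_multiplicities (fun t => fine (mu [set t])) us); last first.
  by move=> t; rewrite mem_undup.
rewrite expr0 fact0 divr1 mul1r.
have -> : \prod_(t <- s) expR (- fine (mu [set t])) = expR (- \sum_(t <- s) fine (mu [set t])) :> R.
  elim: (s) => [|t s' IH]; first by rewrite !big_nil oppr0 expR0.
  by rewrite !big_cons IH opprD expRD.
have -> : fine (mu A) = fine (mu (A `\` [set` s])) + \sum_(t <- s) fine (mu [set t]).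
  have -> : mu A = (mu (A `\` [set` s]) + (\sum_(t <- s) fine (mu [set t]))%:E)%E.
    rewrite (mu_set_seq us sA) -sumEFin; congr (_ + _)%E.
    by apply: eq_big_seq => t ts; rewrite fineK // fin_set1.
  by rewrite fineD.
by rewrite opprD expRD; ring.
Qed.

End PoissonConfiguration.

(** * Loop and bridge measures *)

Section LoopMeasure.
Context (R : realType) (Gam : graph) (g : nat) (D : subgraph Gam).
Local Notation weight := (@weight R Gam g).
Local Notation nu := (nu R g D).

Lemma weight_ge0 b : 0 <= weight b.
Proof. by rewrite invr_ge0 exprn_ge0. Qed.

Lemma rho_ge0 (l : rloop Gam) : 0 <= rho R g l.
Proof. by rewrite divr_ge0 ?weight_ge0. Qed.

Lemma rho2_ge0 (l : rloop Gam) : (0 <= (rho R g l / 2)%:E)%E.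
Proof. by rewrite lee_fin divr_ge0 ?rho_ge0. Qed.

Lemma nu_ge0 A : (0 <= nu A)%E.
Proof. by apply: esum_ge0 => l _; exact: rho2_ge0. Qed.

Lemma nuID A B : nu A = (nu (A `&` B) + nu (A `\` B))%E.
Proof.
rewrite /Defs.nu (esumID [set l | B (unroot l)]); last by move=> l _; exact: rho2_ge0.
congr (_ + _)%E; congr esum; apply/seteqP; split => l /=.
- by case=> -[].
- by case=> ? [].
- by case=> -[].
- by case=> ? [].
Qed.

Lemma in_subgraph_repr (l : rloop Gam) :
  in_subgraph D l <-> in_subgraph D (repr (unroot l)).
Proof.
have h : same_loop l (repr (unroot l)) by rewrite -unroot_eq unroot_repr eqxx.
split; apply: same_loop_darts => //.
by rewrite same_loop_sym.
Qed.

Lemma nu_outside A : (forall L, A L -> ~ in_subgraph D (repr L)) -> nu A = 0%E.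
Proof.
move=> AD; rewrite /Defs.nu (_ : [set l | _] = set0) ?esum_set0 //.
by apply/seteqP; split=> // l [/in_subgraph_repr lD /AD].
Qed.

Lemma symmetries_gt0 (L : uloop Gam) : (0 < symmetries (repr L))%N.
Proof. by rewrite -has_count has_pred1 mem_dih ?repr_neq0 // same_loop_refl. Qed.

(* Among the [2 n] ways of rooting and orienting a loop of length [n], each of
   the rooted oriented loops obtained occurs [symmetries] times. *)
Lemma nu_set1 L : in_subgraph D (repr L) ->
  nu [set L] = (weight (repr L) / (symmetries (repr L))%:R)%:E.
Proof.
move=> LD; set l : seq _ := repr L; have l0 : l != [::] := repr_neq0 L.
pose rs : seq (rloop Gam) := pmap insub (undup (dih l)).
have lP y : y \in undup (dih l) -> is_loop y.
  by rewrite mem_undup mem_dih // => /(same_loop_is_loop LD (repr_is_loop L)).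
have mem_rs (m : rloop Gam) : (m \in rs) = same_loop l m.
  by rewrite mem_pmap_sub mem_undup mem_dih.
have urs : uniq rs by rewrite pmap_sub_uniq ?undup_uniq.
have szrs : size rs = size (undup (dih l)).
  by rewrite size_pmap_sub; apply/eqP; rewrite -all_count; apply/allP.
rewrite /Defs.nu (_ : [set m | _] = [set` rs]); last first.
  apply/seteqP; split=> m /=; rewrite mem_rs.
    by case=> _ mL; rewrite /l -unroot_eq unroot_repr mL.
  rewrite /l -unroot_eq unroot_repr => /eqP e; split=> //.
  by apply/in_subgraph_repr; rewrite -e.
rewrite esum_seq //; last exact: rho2_ge0.
rewrite (eq_big_seq (fun=> (weight l / (size l)%:R / 2)%:E)); last first.
  by move=> m; rewrite mem_rs => /same_loop_size sz; rewrite /rho /Defs.weight sz.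
rewrite sumEFin big_const_seq count_predT iter_addr_0 szrs.
rewrite -[_ *+ size (undup _)]mulr_natr; congr _%:E.
have := congr1 (fun k : nat => k%:R : R) (size_undup_dih l0).
rewrite -muln2 !natrM => e.
have s0 : (symmetries l)%:R != 0 :> R by rewrite pnatr_eq0 -lt0n symmetries_gt0.
have n0 : (size l)%:R != 0 :> R by rewrite pnatr_eq0 size_eq0.
set k := (size (undup _))%:R in e *.
have -> : weight l / (size l)%:R / 2 * k = weight l / (size l)%:R / 2 * (k * (symmetries l)%:R) /
    (symmetries l)%:R by field; rewrite s0 n0.
by rewrite e; field; rewrite s0 n0.
Qed.

Hypothesis reg : regular Gam g.

(** No subgraph is imposed: countability only needs that finitely many darts leave each vertex. *)
Fixpoint walk (x : vertex Gam) (b : seq (dart Gam)) : bool :=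
  if b is a :: b' then (src a == x) && walk (tgt a) b' else true.

Lemma countable_walks x : countable [set b | walk x b].
Proof.
have cn n : forall x, countable [set b | walk x b /\ size b = n].
  elim: n => [|n IH] y.
    apply: (@sub_countable _ _ _ [set [::]]); last exact: countable1.
    by apply: subset_card_le => b /= [_ /size0nil].
  apply: (@sub_countable _ _ _
      (\bigcup_(a in [set a | src a = y]) (cons a @` [set b | walk (tgt a) b /\ size b = n]))).
    apply: subset_card_le => -[|a b] /= [//= /andP[/eqP ay wb] [sb]].
    by exists a => //; exists b.
  apply: bigcup_countable => [|a _].
    by rewrite (eq_countable (reg y)).
  by apply: sub_countable (card_image_le _ _) _; exact: IH.
apply: (@sub_countable _ _ _ (\bigcup_n [set b | walk x b /\ size b = n])).
  by apply: subset_card_le => b /= wb; exists (size b).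
by apply: bigcup_countable.
Qed.

Lemma bridge_walk (D' : subgraph Gam) x b y : bridge D' x b y -> walk x b.
Proof. by elim: b x => //= a b IH x /and3P[-> _ /IH]. Qed.

Lemma is_loop_walk a l : is_loop (a :: l) -> walk (src a) (a :: l).
Proof.
rewrite /is_loop /= rcons_path eqxx => /andP[al _].
by elim: l a al => //= b l IH a /andP[/eqP -> /IH ->]; rewrite eqxx.
Qed.

(** Vertices need not be countable, but a loop that meets the finite set [F] has a representative
    among the walks issued from [F]. *)
Lemma countable_visits (F : {fset vertex Gam}) : countable [set L | visits F L].
Proof.
pose S := \bigcup_(x in [set` F]) [set b | walk x b].
have cS : countable S.
  by apply: bigcup_countable => [|x _]; [exact: countable_fset | exact: countable_walks].
have [f f_inj] := countable_injP _ cS.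
have rep (L : uloop Gam) : exists b, visits F L -> S b /\ represents b L.
  case: (boolP (visits F L)) => [/hasP[a aL aF]|_]; last by exists [::].
  have [i l e] := rot_to aL; exists (a :: l) => _.
  have al : is_loop (a :: l).
    by have := repr_is_loop L; rewrite /is_loop -e rot_cycle -!size_eq0 size_rot.
  split; first by exists (src a) => //; exact: is_loop_walk.
  by apply/same_loopP; exists i; left.
have [b hb] := choice rep.
apply/countable_injP; exists (f \o b) => L L'; rewrite !inE /= => vL vL' e.
have [SL rL] := hb L vL; have [SL' rL'] := hb L' vL'.
apply: represents_inj rL _; rewrite (f_inj (b L) (b L')) //; exact/mem_set.
Qed.

Hypothesis fin_green : finite_green R g D.

(** The factor [1 / n] in [rho] is compensated by the [n] shifts: a rooted loop is coded by a point
    [x] of [F] on it, the bridge from [x] to [x] obtained by rerooting there, and the shift. The sum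
    is then bounded by that of the [G(x, x)] over [F]. *)
Lemma nu_visits_finite (F : {fset vertex Gam}) : [set` F] `<=` sverts D ->
  (nu [set L | visits F L] < +oo)%E.
Proof.
move=> FD.
pose B x := [set b : seq (dart Gam) | bridge D x b x].
pose K := [set` F] `*`` (fun x => B x `*`` (fun b => [set k : nat | (k < size b)%N])).
pose w (z : vertex Gam * (seq (dart Gam) * nat)) := (weight z.2.1 / (size z.2.1)%:R)%:E : \bar R.
have w0 z : (0 <= w z)%E by rewrite lee_fin divr_ge0 ?weight_ge0.
have Kfin : (\esum_(z in K) w z < +oo)%E.
  rewrite -(@esum_esum R _ _ [set` F]
    (fun x => B x `*`` (fun b => [set k : nat | (k < size b)%N])) (fun x z => w (x, z))); last first.
    by move=> x z _ _.
  apply: (@le_lt_trans _ _ (\esum_(x in [set` F]) green R g D x x)%E); last first.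
    rewrite esum_fset //; last by move=> x _; apply: esum_ge0 => b _; rewrite lee_fin weight_ge0.
    rewrite fsbig_finite //= set_fsetK big_seq_cond.
    apply: lte_sum_pinfty => x; rewrite andbT => xF; apply: fin_green; exact: FD.
  apply: le_esum => x xF.
  rewrite -(@esum_esum R _ _ (B x) (fun b => [set k : nat | (k < size b)%N])
     (fun b k => w (x, (b, k)))); last by move=> b k _ _.
  apply: le_esum => b bB.
  rewrite (_ : [set k | _] = [set` iota 0 (size b)]); last first.
    by apply/seteqP; split => k /=; rewrite mem_iota.
  rewrite esum_seq ?iota_uniq // /w /= sumEFin lee_fin big_const_seq count_predT size_iota.
  rewrite iter_addr_0; case: b {bB} => [|a b]; first by rewrite mulr0n weight_ge0.
  by rewrite -[_ *+ size (a :: b)]mulr_natr divfK // pnatr_eq0.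
apply: le_lt_trans Kfin.
(* Rotating back by the recorded shift recovers the loop, which makes the coding injective. *)
have rep (l : rloop Gam) : exists z, in_subgraph D l /\ has (fun a => src a \in F) l ->
    [/\ K z, rotr z.2.2 z.2.1 = l & size z.2.1 = size l].
  case: (pselect (in_subgraph D l /\ has (fun a => src a \in F) l)) => [[lD]|no]; last first.
    case: l no => -[|a l] p no; first by have /andP[] := p; rewrite eqxx.
    by exists (src a, ([::], 0%N)).
  case/hasP => a al aF; have [i s e] := rot_to al.
  have il : (minn i (size l) < size l)%N \/ rot 0 l = a :: s.
    case: (ltnP i (size l)) => il; first by left; lia.
    by right; rewrite rot0 -e rot_oversize.
  have [k kl ek] : exists2 k, (k < size l)%N & rot k l = a :: s.
    case: il => [il|e0]; first by exists (minn i (size l)); rewrite // -rot_minn.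
    by exists 0%N => //; have := rloop_is_loop l; rewrite /is_loop -size_eq0 lt0n => /andP[].
  exists (src a, (rot k l, k)) => _; split; rewrite /= ?size_rot ?rotK //.
  split=> //; split; last by rewrite /= size_rot.
  rewrite /B /= ek; apply: is_loop_bridge.
    by have := rloop_is_loop l; rewrite /is_loop -ek rot_cycle -!size_eq0 size_rot.
  by move=> c; rewrite -ek mem_rot; exact: lD.
have [phi hphi] := choice rep.
pose S := [set l : rloop Gam | in_subgraph D l /\ [set L | visits F L] (unroot l)].
have Shas l : S l -> in_subgraph D l /\ has (fun a => src a \in F) l.
  case=> lD /= v; split=> //; rewrite -(represents_visits F (L := unroot l)) //.
  by rewrite represents_unroot eqxx.
rewrite /Defs.nu -/S; apply: (@le_trans _ _ (\esum_(l in S) w (phi l))%E).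
  apply: le_esum => l /Shas /hphi[_ _ sz]; rewrite lee_fin /rho /Defs.weight sz.
  by rewrite ler_pdivrMr // ler_peMr ?ler1n // divr_ge0 ?invr_ge0 ?exprn_ge0.
rewrite -(esum_image S phi w); last first.
  move=> l l'; rewrite !inE => /Shas/hphi[_ e _] /Shas/hphi[_ e' _] ep.
  by apply: val_inj; rewrite /= -e -e' ep.
by apply: esum_subset => _ [l /Shas/hphi[Kl _ _] <-].
Qed.

End LoopMeasure.

Section EsumProduct.
Context (R : realType) (I : finType) (T : choiceType) (t0 : T).
Context (B : I -> set T) (a : T -> R).
Hypothesis a_ge0 : forall t, 0 <= a t.
Hypothesis Bfin : forall i, (\esum_(t in B i) (a t)%:E < +oo)%E.

(** The coordinates outside [rs] are frozen at [t0], so that the product can be built one coordinate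
    at a time within a single type of functions. *)
Definition supported_family (rs : seq I) : set {ffun I -> T} :=
  [set e | forall i, if i \in rs then B i (e i) else e i = t0].

Lemma esum_prod (rs : seq I) : uniq rs ->
  (\esum_(e in supported_family rs) (\prod_(i <- rs) a (e i))%:E)%E =
  (\prod_(i <- rs) fine (\esum_(t in B i) (a t)%:E)%E)%:E.
Proof.
have prod_ge0 rs' (e : {ffun I -> T}) : 0 <= \prod_(i <- rs') a (e i) by apply: prodr_ge0.
elim: rs => [_|i0 rs IH].
  rewrite big_nil (_ : supported_family [::] = [set [ffun=> t0]]); last first.
    apply/seteqP; split=> e /= h; first by apply/ffunP => i; rewrite ffunE; exact: h.
    by move=> i; rewrite h ffunE.
  by rewrite esum_set1 big_nil // lee_fin.
case/andP => i0rs urs; have {}IH := IH urs.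
pose upd (z : T * {ffun I -> T}) : {ffun I -> T} := [ffun i => if i == i0 then z.1 else z.2 i].
have upd0 z : upd z i0 = z.1 by rewrite ffunE eqxx.
have upd_rs z i : i \in rs -> upd z i = z.2 i.
  by move=> irs; rewrite ffunE; case: eqP => // e; rewrite e (negPf i0rs) in irs.
rewrite (reindex_esum (B i0 `*` supported_family rs) _ upd); last first.
  split=> [[x e] /= [Bx he] i|[x e] [x' e']|e he].
  - rewrite ffunE /= inE; case: eqP => [->//|_]; exact: he.
  - rewrite !inE /= => -[_ he] [_ he'] /ffunP u; have := u i0; rewrite !ffunE eqxx /= => ->.
    congr (_, _); apply/ffunP => i; case: (eqVneq i i0) => [->|ne]; last first.
      by have := u i; rewrite !ffunE (negPf ne).
    by have := he i0; have := he' i0; rewrite (negPf i0rs) => -> ->.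
  - exists (e i0, [ffun i => if i == i0 then t0 else e i]).
      split=> /=; first by have := he i0; rewrite mem_head.
      move=> i; have := he i; rewrite inE ffunE; case: (eqVneq i i0) => [->|_] //=.
      by rewrite (negPf i0rs).
    by apply/ffunP => i; rewrite !ffunE /=; case: (eqVneq i i0) => [->|].
rewrite (eq_esum (b := fun z : T * {ffun I -> T} =>
  (a z.1 * \prod_(i <- rs) a (z.2 i))%:E)); last first.
  move=> z _; rewrite big_cons upd0; congr (_ * _)%:E.
  by apply: eq_big_seq => i irs; rewrite upd_rs.
rewrite (@esum_setX _ _ _ (B i0) (supported_family rs) a
  (fun e : {ffun I -> T} => \prod_(i <- rs) a (e i))) //; last first.
  by rewrite IH ltry.
rewrite IH big_cons EFinM fineK // ge0_fin_numE //.
by apply: esum_ge0 => t _; rewrite lee_fin.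
Qed.

End EsumProduct.

(** * Weights and normalisation of unordered bridges *)

Section BridgeMeasure.
Context (R : realType) (Gam : graph) (g : nat) (D : subgraph Gam) (n : nat).
Context (z : 'I_n -> vertex Gam).
Hypothesis fin_green : forall x y, (green R g D x y < +oo)%E.
Local Notation weight := (@weight R Gam g).
Local Notation green := (green R g D).
Local Notation zbridge := (zbridge Gam n).

Definition zbridge_weight (beta : zbridge) : R :=
  \prod_(i : 'I_n | (i < beta.1 i)%N) weight (beta.2 i).

Lemma zbridge_weight_ge0 beta : 0 <= zbridge_weight beta.
Proof. by apply: prodr_ge0 => i _; exact: weight_ge0. Qed.

Definition zbridge_weights (S : set zbridge) : \bar R :=
  (\esum_(beta in [set beta | is_zbridge D z beta /\ S beta]) (zbridge_weight beta)%:E)%E.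

Definition pairing_total : R :=
  \sum_(t : {ffun 'I_n -> 'I_n} | is_pairing t) pairing_weight R g D z t.

Lemma green_fin_num x y : green x y \is a fin_num.
Proof. by rewrite ge0_fin_numE // esum_ge0 // => b _; rewrite lee_fin weight_ge0. Qed.

Lemma weight_le_green x y b : bridge D x b y -> weight b <= fine (green x y).
Proof.
move=> xy; rewrite -lee_fin fineK ?green_fin_num //.
rewrite -[leLHS](@esum_set1 R _ b (fun b => (weight b)%:E)) ?lee_fin ?weight_ge0 //.
by apply: esum_subset => _ ->.
Qed.

Lemma fine_green_ge0 x y : 0 <= fine (green x y).
Proof. by rewrite fine_ge0 // esum_ge0 // => b _; rewrite lee_fin weight_ge0. Qed.

Lemma zbridge_massE beta : is_zbridge D z beta ->
  zbridge_mass R g D z beta = zbridge_weight beta / pairing_total.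
Proof.
case/andP=> _ /forallP hb; rewrite /zbridge_mass /pairing_prob /pairing_weight mulrAC.
rewrite -big_split /=; congr (_ / _); apply: eq_bigr => i _.
have /andP[bi _] := hb i; have wG := weight_le_green bi.
(* The weight of a bridge is at most the Green's function, so it vanishes with it and the division
   by zero is harmless. *)
rewrite /bridge_prob; case: (eqVneq (fine (green (z i) (z (beta.1 i)))) 0) => [G0|G0].
  by rewrite G0 mul0r; apply/esym/le_anti; rewrite weight_ge0 andbT -G0.
by rewrite mulrCA mulfV // mulr1.
Qed.

Lemma zbridge_measureE S :
  zbridge_measure R g D z S = (zbridge_weights S * (pairing_total^-1)%:E)%E.
Proof.
rewrite /zbridge_measure /zbridge_weights -esumZr; last 2 first.
- rewrite invr_ge0; apply: sumr_ge0 => t _; apply: prodr_ge0 => i _; exact: fine_green_ge0.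
- by move=> beta; rewrite lee_fin zbridge_weight_ge0.
by apply: eq_esum => beta [hb _]; rewrite zbridge_massE.
Qed.

(** Over a fixed pairing, the bridges seen from the smaller labels are free and determine the others
    by reversal ([ext]), so the sum is a product of Green's functions. *)
Lemma pairing_bridges (t : {ffun 'I_n -> 'I_n}) : is_pairing t ->
  (\esum_(e in [set e | is_zbridge D z (t, e)]) (zbridge_weight (t, e))%:E)%E =
  (pairing_weight R g D z t)%:E.
Proof.
move=> pt; have /forallP tP := pt.
have tK i : t (t i) = i by case/andP: (tP i) => _ /eqP.
have tn i : t i != i by case/andP: (tP i).
pose rs := [seq i : 'I_n <- enum 'I_n | (i < t i)%N].
have urs : uniq rs by rewrite filter_uniq // enum_uniq.
have rsE (i : 'I_n) : (i \in rs) = (i < t i)%N by rewrite mem_filter mem_enum andbT.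
have rst (i : 'I_n) : (t i \in rs) = (i \notin rs).
  rewrite !rsE tK -leqNgt [RHS]leq_eqVlt (inj_eq val_inj).
  by rewrite (negPf (tn i)).
have prs (F : 'I_n -> R) : \prod_(i : 'I_n | (i < t i)%N) F i = \prod_(i <- rs) F i.
  by rewrite big_filter big_enum_cond.
pose B i := [set b : seq (dart Gam) | bridge D (z i) b (z (t i))].
pose ext (e : {ffun 'I_n -> seq (dart Gam)}) : {ffun 'I_n -> seq (dart Gam)} :=
  [ffun i => if i \in rs then e i else bflip (e (t i))].
rewrite (reindex_esum (supported_family [::] B rs) _ ext); last first.
  split=> [e he /=|e e'|e /= /andP[_ /forallP he]].
  - apply/andP; split=> //=; apply/forallP => i; rewrite !ffunE rst tK.
    have := he i; have := he (t i); rewrite rst /B tK /=; case: (i \in rs) => /=.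
      by move=> _ ->; rewrite eqxx.
    by move=> /bridge_bflip -> _; rewrite bflipK eqxx.
  - rewrite !inE => he he' /ffunP h; apply/ffunP => i.
    case: (boolP (i \in rs)) => irs; first by have := h i; rewrite !ffunE irs.
    by have := he i; have := he' i; rewrite (negPf irs) => -> ->.
  - exists [ffun i => if i \in rs then e i else [::]].
      move=> i; rewrite ffunE; case: (i \in rs) => //.
      by have /andP[] := he i.
    apply/ffunP => i; rewrite !ffunE rst; case: (i \in rs) => //=.
    have /andP[_ /eqP /= ->] := he i; exact: bflipK.
rewrite (eq_esum (b := fun e : {ffun 'I_n -> seq (dart Gam)} =>
  (\prod_(i <- rs) weight (e i))%:E)); last first.
  move=> e he; rewrite /zbridge_weight /= prs; congr _%:E.
  by apply: eq_big_seq => i irs; rewrite ffunE irs.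
rewrite esum_prod /pairing_weight ?prs //.
  by move=> b; exact: weight_ge0.
by move=> i; exact: fin_green.
Qed.

(** The normalising constant of the law of the pairing is the total weight of all unordered
    bridges. *)
Lemma zbridge_weightsT : zbridge_weights setT = pairing_total%:E.
Proof.
rewrite /zbridge_weights (_ : [set beta | _] =
    [set` [seq t <- enum {ffun 'I_n -> 'I_n} | is_pairing t]] `*``
    (fun t => [set e | is_zbridge D z (t, e)])); last first.
  apply/seteqP; split=> [[t e]|[t e]] /=.
    by move=> [h _]; split=> //; rewrite mem_filter mem_enum andbT; case/andP: h.
  by case.
rewrite (eq_esum (b := fun k => (zbridge_weight (k.1, k.2))%:E)); last by case.
rewrite -(@esum_esum _ _ _ _ (fun t => [set e | is_zbridge D z (t, e)])
  (fun t e => (zbridge_weight (t, e))%:E)); last first.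
  by move=> t e _ _; rewrite lee_fin zbridge_weight_ge0.
rewrite esum_seq; last 2 first.
- by rewrite filter_uniq // enum_uniq.
- by move=> t; apply: esum_ge0 => e _; rewrite lee_fin zbridge_weight_ge0.
rewrite big_filter big_enum_cond /pairing_total -sumEFin.
by apply: eq_bigr => t pt; rewrite pairing_bridges.
Qed.

Lemma zbridge_weights_le S : (zbridge_weights S <= pairing_total%:E)%E.
Proof. by rewrite -zbridge_weightsT; apply: esum_subset => beta []. Qed.

Lemma zbridge_weights_ge0 S : (0 <= zbridge_weights S)%E.
Proof. by apply: esum_ge0 => beta _; rewrite lee_fin zbridge_weight_ge0. Qed.

Lemma zbridge_weights_total S :
  zbridge_weights S = (pairing_total%:E * zbridge_measure R g D z S)%E.
Proof.
(* When the total weight is zero all weights vanish, so both sides are zero. *)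
rewrite zbridge_measureE; case: (eqVneq pairing_total 0) => [Z0|Z0].
  have := zbridge_weights_le S; rewrite Z0 mul0e => W0.
  by apply/eqP; rewrite eq_le W0 zbridge_weights_ge0.
by rewrite muleCA -EFinM mulfV // mule1.
Qed.

End BridgeMeasure.

Section FiniteConfigurations.
Context (R : realType) (T : choiceType).
Implicit Types (n : T -> nat) (A : set T).

Lemma npoints_finite n A : (npoints R n A < +oo)%E ->
  exists2 ls : seq T, {subset ls <= A} & forall t, A t -> n t = count_mem t ls.
Proof.
move=> fin; pose S := [set t | A t /\ n t != 0%N].
(* Each point of the support counts for at least 1, so an infinite support would exceed every
   integer bound on the number of points. *)
have finS : finite_set S.
  apply: contrapT => infS.
  have n0 t : (0 <= (n t)%:R%:E :> \bar R)%E by rewrite lee_fin.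
  have nfin : npoints R n A \is a fin_num by rewrite ge0_fin_numE // esum_ge0.
  have [k hk] : exists k : nat, (npoints R n A < k%:R%:E)%E.
    exists (Num.bound (fine (npoints R n A))).
    by rewrite -(fineK nfin) lte_fin archi_boundP // fine_ge0 // esum_ge0.
  have [X XS kX] := infinite_set_fset k infS.
  move: hk; apply/negP; rewrite -leNgt.
  apply: (@le_trans _ _ (\sum_(t <- X) (n t)%:R%:E)%E); last first.
    rewrite -esum_seq ?fset_uniq //; apply: esum_subset => t /XS[] //.
  rewrite sumEFin lee_fin -natr_sum ler_nat (leq_trans kX) // -sum1_size.
  rewrite big_seq [leqRHS]big_seq; apply: leq_sum => t /XS[_].
  by rewrite lt0n.
exists (flatten [seq nseq (n t) t | t <- fset_set S]).
  move=> t /flattenP[_ /mapP[u uS ->]]; rewrite mem_nseq => /andP[_ /eqP ->].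
  by rewrite in_fset_set // inE in uS; apply/mem_set; case: uS.
move=> t At; rewrite count_flatten -map_comp sumnE big_map.
rewrite (eq_bigr (fun u => if u == t then n u else 0%N)); last first.
  by move=> u _ /=; rewrite count_nseq /= eq_sym; case: eqP => _; rewrite ?mul1n ?mul0n.
rewrite -big_mkcond /=; case: (eqVneq (n t) 0%N) => [n0|nN0].
  by rewrite n0 big1 // => u /eqP ->.
have tS : t \in fset_set S by rewrite in_fset_set // inE.
by rewrite -big_filter (filter_pred1_uniq (fset_uniq _) tS) big_seq1.
Qed.

Lemma sum_count_mem (F : T -> nat) (ls : seq T) :
  (\sum_(t <- undup ls) count_mem t ls * F t = \sum_(t <- ls) F t)%N.
Proof.
rewrite -[RHS](big_undup_iterop_count _ ls predT F); apply: eq_bigr => t _.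
by rewrite Monoid.iteropE iter_addn_0 mulnC.
Qed.

Lemma esum_count_mem n A (ls : seq T) (F : T -> nat) : {subset ls <= A} ->
  (forall t, A t -> n t = count_mem t ls) -> (forall t, F t != 0%N -> A t) ->
  (\esum_(t in setT) (n t * F t)%N%:R%:E = (\sum_(t <- ls) F t)%N%:R%:E :> \bar R)%E.
Proof.
move=> lsA nE FA; have ge0 t : (0 <= (n t * F t)%N%:R%:E :> \bar R)%E by rewrite lee_fin.
rewrite (esumID [set` undup ls]) // setTI [X in (_ + X)%E]esum1 ?adde0; last first.
  move=> t [_ /= tls]; case: (eqVneq (F t) 0%N) => [->|/FA At]; first by rewrite muln0.
  by rewrite nE // (count_memPn _) // -mem_undup; exact/negP.
rewrite esum_seq ?undup_uniq // sumEFin -natr_sum -[in RHS]sum_count_mem; congr (_%:R%:E).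
by apply: eq_big_seq => t; rewrite mem_undup => /lsA/set_mem/nE ->.
Qed.

End FiniteConfigurations.

Lemma symmetry_weightE (R : realType) (Gam : graph) (ls : seq (uloop Gam)) :
  (symmetry_weight ls)%:R = (\prod_(L <- ls) (symmetries (repr L))%:R) *
    (multiplicity_factorial ls)%:R :> R.
Proof.
elim: ls => [|L ls IH]; first by rewrite big_nil mulr1.
by rewrite big_cons /= !natrM IH; ring.
Qed.

Lemma prod_weight (R : realType) (Gam : graph) (g : nat) (I : Type) (r : seq I) (p : pred I)
    (F : I -> seq (dart Gam)) :
  \prod_(i <- r | p i) weight R g (F i) = (g%:R ^+ (\sum_(i <- r | p i) size (F i))%N)^-1.
Proof. by rewrite /weight prodfV; congr _^-1; rewrite expr_sum. Qed.

(** * The conditional law *)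

Section Soup.
Context (R : realType) (Gam : graph) (g : nat) (D : subgraph Gam) (F1 F2 : {fset vertex Gam}).
Context (rule : seq (nepath Gam) -> seq (nepath Gam)).
Context (d : measure_display) (Omega : measurableType d) (P : probability Omega R).
Context (soup : Omega -> uloop Gam -> nat) (missing : Omega -> {m : nat & zbridge_pair Gam m}).
Hypotheses (reg : regular Gam g) (fin_green : finite_green R g D).
Hypothesis F1D : [set` F1] `<=` sverts D.
Hypotheses (F12 : [disjoint F1 & F2]%fset) (hrule : ordering_rule rule).
Hypothesis ppp : poisson_point_process P soup (nu R g D).
Hypothesis unif : uniform_given P soup missing (admissible R D F1 F2 rule).
Local Notation crossing_loop := (crossing_loop D F1 F2).
Local Notation nu := (nu R g D).

Definition hits : set (uloop Gam) := [set L | visits F1 L && visits F2 L].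

Lemma countable_hits : countable hits.
Proof.
apply: sub_countable (countable_visits reg F1).
by apply: subset_card_le => L /andP[].
Qed.

Lemma nu_hits_fin : (nu hits < +oo)%E.
Proof.
apply: le_lt_trans (nu_visits_finite fin_green F1D).
by apply: (mu_monotone (@nu_ge0 R Gam g D) (@nuID R Gam g D)) => L /andP[].
Qed.

Lemma occ_hits c L : is_crossing D F1 F2 c -> occ L (darts_of c) != 0%N -> hits L.
Proof.
move=> cc; rewrite occE -lt0n -has_count => /hasP[y yL /prefixP[z ey]].
rewrite mem_dih ?repr_neq0 // in yL.
rewrite /hits /= !(represents_visits _ (yL : represents y L)).
have -> /= : has (fun a => src a \in F1) y by rewrite ey /= [_ \in F1](crossing_start cc).
(* [L] may leave [D], so the closedness of its rerootings is obtained in the whole graph. *)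
pose D' := @Subgraph Gam setT setT (fun _ _ => I) (fun _ _ => I).
have := same_loop_is_loop (D := D') (fun _ _ => I) (repr_is_loop L) yL.
have c2 := crossing_finish cc; rewrite ey; case: z {ey} => [|b z].
  rewrite /is_loop /= cats0 rcons_path => /andP[_ /eqP e].
  have := in1N2 F12 (crossing_start cc : in1 F1 c.1).
  by rewrite /in2 -e [tgt _ \in F2]c2.
rewrite /is_loop /= rcons_path cat_path /= => /andP[/andP[_ /andP[/eqP e _]] _].
by rewrite has_cat /= -e [tgt _ \in F2]c2 !orbT.
Qed.

Definition config (K : set (uloop Gam)) (m : uloop Gam -> nat) : set Omega :=
  [set w | forall L, K L -> soup w L = m L].

Lemma configE K m : config K m = \bigcap_(L in K) [set w | soup w L = m L].
Proof. by []. Qed.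

Lemma config_measurable K m : countable K -> measurable (config K m).
Proof.
move=> cK; rewrite configE; apply: countable_bigcap_measurable => // L _.
exact: ppp.1.
Qed.

Lemma config_events K m : countable K -> events_of soup (config K m).
Proof.
move=> cK; rewrite configE; apply: sigma_countable_bigcap => // L _.
by apply: sub_sigma_algebra; exists L, (m L).
Qed.

Lemma config_prob ls : (forall L, L \in ls -> crossing_loop L) ->
  P (config hits (fun L => count_mem L ls)) =
  (expR (- fine (nu hits)) * (\prod_(L <- ls) weight R g (repr L)) /
    (symmetry_weight ls)%:R)%:E.
Proof.
move=> lsP; rewrite (poisson_config ppp (@nu_ge0 R Gam g D) (@nuID R Gam g D) nu_hits_fin); last first.
  by move=> L /lsP[_ h1 h2]; apply/mem_set; rewrite /hits /= h1 h2.
congr _%:E; rewrite symmetry_weightE -!mulrA; congr (_ * _); rewrite invfM mulrA; congr (_ * _).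
rewrite -prodfV -big_split /=; apply: eq_big_seq => L /lsP[LD _ _].
by rewrite nu_set1.
Qed.

Lemma crossing_mult_config w ls c :
  (forall L, L \in ls -> crossing_loop L) -> config hits (fun L => count_mem L ls) w ->
  is_crossing D F1 F2 c ->
  crossing_mult D F1 F2 R (soup w) c = (\sum_(L <- ls) occ L (darts_of c))%N%:R%:E.
Proof.
move=> lsP cw cc; rewrite /crossing_mult cc.
apply: (@esum_count_mem R _ (soup w) hits ls (fun L => occ L (darts_of c))) => //.
  by move=> L /lsP[_ h1 h2]; apply/mem_set; rewrite /hits /= h1 h2.
by move=> L; exact: occ_hits.
Qed.

Lemma eta_rule n s : eta_is D F1 F2 R rule n s -> rule s = s.
Proof. by case. Qed.

Lemma eta_crossing n s : eta_is D F1 F2 R rule n s -> forall c, c \in s -> is_crossing D F1 F2 c.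
Proof.
case=> _ h c cs; have := h c; rewrite /crossing_mult; case: ifP => // _ [] /eqP.
by rewrite eq_sym pnatr_eq0 => /eqP/count_memPn; rewrite cs.
Qed.

Lemma eta_unique n s s' : eta_is D F1 F2 R rule n s -> eta_is D F1 F2 R rule n s' -> s = s'.
Proof.
case=> rs hs [rs' hs']; rewrite -rs -rs'; apply: hrule.2; apply/allP => c _ /=.
by have := hs c; rewrite hs' => -[] /eqP; rewrite eqr_nat eq_sym.
Qed.

Lemma eta_config w ls s : (forall L, L \in ls -> crossing_loop L) ->
  config hits (fun L => count_mem L ls) w -> rule s = s ->
  (forall c, c \in s -> is_crossing D F1 F2 c) ->
  eta_is D F1 F2 R rule (soup w) s <->
  forall c, is_crossing D F1 F2 c -> count_mem c s = (\sum_(L <- ls) occ L (darts_of c))%N.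
Proof.
move=> lsP cw rs sc; split=> [[_ h] c cc|h].
  have := h c; rewrite (crossing_mult_config lsP) // => -[] /eqP.
  by rewrite eqr_nat => /eqP.
split=> // c; case cc: (is_crossing D F1 F2 c).
  by rewrite (crossing_mult_config lsP) // h.
rewrite /crossing_mult cc (count_memPn _) //.
by apply/negP => /sc; rewrite cc.
Qed.

Lemma npoints_prob A k : (nu A < +oo)%E ->
  measurable [set w | npoints R (soup w) A = k%:R%:E] /\
  P [set w | npoints R (soup w) A = k%:R%:E] = poisson_prob (fine (nu A)) 0 [set k].
Proof.
move=> Afin; have [h1 h2] := ppp.2 1%N (fun=> A) (fun=> k) (fun=> Afin)
  (fun i j _ _ _ => etrans (ord1 i) (esym (ord1 j))).
split; first exact: (h1 ord0).
rewrite (_ : [set w | _] = \bigcap_(i in [set: 'I_1]) [set w | npoints R (soup w) A = k%:R%:E]).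
  by rewrite h2 big_ord1.
by apply/seteqP; split=> w h //; exact: (h ord0 I).
Qed.

(** The number of points in [hits] is almost surely finite because Poisson probabilities sum to one.
    As [soup] is indexed by all the loops of the graph, those leaving [D] are ruled out separately:
    [nu] gives them no mass. *)
Lemma ae_finite_crossings :
  P.-negligible (~` [set w | exists2 ls, (forall L, L \in ls -> crossing_loop L) &
    config hits (fun L => count_mem L ls) w]).
Proof.
pose outside := hits `&` [set L | ~ in_subgraph D (repr L)].
have cN : countable [set: nat] by exact: countableP.
have out0 : nu outside = 0%E by apply: nu_outside => L [].
pose X1 := \bigcup_(k in [set: nat]) [set w | npoints R (soup w) hits = k%:R%:E].
pose X2 := [set w | npoints R (soup w) outside = 0%:R%:E].
have m1 : measurable X1.
  apply: countable_bigcup_measurable => // k _.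
  exact: (npoints_prob k nu_hits_fin).1.
have m2 : measurable X2 by apply: (npoints_prob 0 _).1; rewrite out0.
have P1 : P X1 = 1%E.
  rewrite measure_countable_bigcup //; last 2 first.
  - by move=> k _; exact: (npoints_prob k nu_hits_fin).1.
  - move=> i j _ _ [w [/= -> []]] /eqP; rewrite eqr_nat => /eqP //.
  rewrite (eq_esum (b := fun k => poisson_prob (fine (nu hits)) 0 [set k])); last first.
    by move=> k _; exact: (npoints_prob k nu_hits_fin).2.
  rewrite -(@measure_countable_bigcup _ _ _ (poisson_prob (fine (nu hits)) 0) _ [set: nat]
    (fun k => [set k])) //.
    rewrite (_ : \bigcup_(k in [set: nat]) [set k] = [set: nat]).
      exact: (@probability_setT _ _ _ (poisson_prob (fine (nu hits)) 0)).
    by apply/seteqP; split=> // k _; exists k.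
  by move=> i j _ _ [k [/= -> ->]].
have P2 : P X2 = 1%E.
  rewrite (npoints_prob 0 _).2 out0 //= poisson_prob_set1 //.
  by rewrite expr0 fact0 divr1 mul1r oppr0 expR0.
have null X : measurable X -> P X = 1%E -> P.-negligible (~` X).
  move=> mX PX; apply/negligibleP; first exact: measurableC.
  by have := probability_setC P mX; rewrite PX subee.
apply: negligibleS (negligibleU (null _ m1 P1) (null _ m2 P2)).
rewrite -setCI; apply: subsetC => w [[k _ /= hk] h2].
have [|ls lsh lsE] := @npoints_finite R _ (soup w) hits; first by rewrite hk ltry.
exists ls => // L Lls; have /set_mem Lh := lsh L Lls.
have /andP[v1 v2] := Lh; split=> //.
apply: contrapT => LD; move: Lls; apply/negP/count_memPn; rewrite -lsE //.
by move: h2 => /npoints_eq0; apply.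
Qed.

Lemma eta_ae : {ae P, forall w, exists s, eta_is D F1 F2 R rule (soup w) s}.
Proof.
apply: negligibleS ae_finite_crossings; apply: subsetC => w /= [ls lsP cw].
have [J [x mx]] := model_exists F12 lsP.
pose s := rule [seq lab x j | j <- enum J].
have sp : perm_eq s [seq lab x j | j <- enum J] by exact: hrule.1.
exists s; apply/(eta_config lsP cw) => [|c|c cc].
- exact: hrule.2.
- rewrite (perm_mem sp) => /mapP[j _ ->]; exact: lab_crossing (model_wf mx) j.
- rewrite (seq.permP sp) count_map -(model_lab mx cc) -sum1_count big_enum_cond /= sum1dep_card.
  by [].
Qed.

(** * The law of the missing parts on the event of a given list of crossings *)

Section FixedCrossings.
Context (s : seq (nepath Gam)).
Hypothesis s_rule : rule s = s.
Hypothesis s_cross : forall c, c \in s -> is_crossing D F1 F2 c.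
Local Notation n := (size s).
Local Notation zpair := (zbridge_pair Gam n).
Local Notation valid := (@valid Gam D F1 F2 s).
Local Notation tagged_pair := (@Tagged nat n (zbridge_pair Gam)).

(** A valid pair is coded by its pairings and finitely many walks issued from [F1] or [F2]. *)
Lemma countable_valid : countable [set b : zpair | valid b].
Proof.
pose S := \bigcup_(x in [set` F1] `|` [set` F2]) [set b | walk x b].
have cS : countable S.
  apply: bigcup_countable => [|x _]; last exact: countable_walks.
  have -> : [set` F1] `|` [set` F2] = [set` (F1 `|` F2)%fset] by rewrite set_fsetU.
  exact: countable_fset.
have [f f_inj] := countable_injP _ cS.
pose code (b : zpair) : ({ffun 'I_n -> 'I_n} * {ffun 'I_n -> nat}) *
  ({ffun 'I_n -> 'I_n} * {ffun 'I_n -> nat}) :=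
  ((b.1.1, [ffun i => f (b.1.2 i)]), (b.2.1, [ffun i => f (b.2.2 i)])).
have validS b : valid b -> forall i, S (b.1.2 i) /\ S (b.2.2 i).
  case/andP=> /andP[_ /forallP h1] /andP[_ /forallP h2] i.
  have /andP[b1 _] := h1 i; have /andP[b2 _] := h2 i.
  have ic : is_crossing D F1 F2 (tnth (in_tuple s) i) by apply: s_cross; exact: mem_tnth.
  split.
    exists (endpoints2 i); last exact: bridge_walk b1.
    by right; exact: crossing_finish ic.
  exists (endpoints1 i); last exact: bridge_walk b2.
  by left; exact: crossing_start ic.
apply/countable_injP; exists (fun b => choice.pickle (code b)) => b b'; rewrite !inE /= => vb vb'.
move/(pcan_inj choice.pickleK); case: b b' vb vb' => [[t1 e1] [t2 e2]] [[t1' e1'] [t2' e2']].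
move=> /validS vb /validS vb' [<- /ffunP h1 <- /ffunP h2].
congr ((_, _), (_, _)); apply/ffunP => i.
  have := h1 i; rewrite !ffunE; apply: f_inj; rewrite inE; [exact: (vb i).1 | exact: (vb' i).1].
have := h2 i; rewrite !ffunE; apply: f_inj; rewrite inE; [exact: (vb i).2 | exact: (vb' i).2].
Qed.

Lemma concatenation_config b : valid b -> exists ls,
  [/\ forall L, L \in ls -> crossing_loop L, forall L, concatenation b L = count_mem L ls &
      config hits (concatenation b) = config hits (fun L => count_mem L ls)].
Proof.
move=> /(valid_wf s_cross) w; have [ls lsP bls] := concatenation_list w.
by exists ls; split=> //; congr config; apply/funext.
Qed.

Lemma eta_concatenation b w : valid b -> config hits (concatenation b) w ->
  eta_is D F1 F2 R rule (soup w) s.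
Proof.
move=> vb; have [ls [lsP bls ->]] := concatenation_config vb => cw.
apply/(eta_config lsP cw s_rule s_cross) => c cc.
exact: (valid_count_mem F12 s_cross vb bls lsP cc).
Qed.

Lemma admissible_config b w (A : seq zpair) : valid b -> config hits (concatenation b) w ->
  (forall b', (b' \in A) = valid b' && `[< concatenation b' = concatenation b >]) ->
  admissible R D F1 F2 rule (soup w) = tagged_pair @` [set` A].
Proof.
move=> vb cw hA; have eta_s := eta_concatenation vb cw.
have cr : crossing_loops F1 F2 (soup w) = concatenation b.
  apply/funext => L; rewrite /crossing_loops; case: ifP => hL; first exact: cw.
  have [ls [lsP bls _]] := concatenation_config vb; rewrite bls; apply/esym/count_memPn/negP.
  by move=> /lsP[_ v1 v2]; rewrite v1 v2 in hL.
apply/seteqP; split=> x /=.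
  case=> s' [b' [eta_s' -> z1 z2 e]]; have es := eta_unique eta_s' eta_s.
  move: b' z1 z2 e; rewrite es => b' z1 z2 e; exists b' => //.
  by rewrite /= hA /valid z1 z2; apply/asboolP; rewrite e cr.
case=> b' /=; rewrite hA => /andP[/andP[z1 z2] /asboolP e] <-.
exists s, b'; split; [exact: eta_s | by [] | exact: z1 | exact: z2 | exact: etrans e (esym cr)].
Qed.

Lemma uniform_mass_tagged (A : seq zpair) b : uniq A -> b \in A ->
  uniform_mass R (tagged_pair @` [set` A]) (tagged_pair b) = (size A)%:R^-1.
Proof.
move=> uA bA; rewrite /uniform_mass mem_set; last by exists b.
have -> : tagged_pair @` [set` A] = [set` [fset x in map tagged_pair A]%fset].
  apply/seteqP; split=> x /=.
    by case=> b' b'A <-; rewrite inE; apply/mapP; exists b'.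
  by rewrite inE => /mapP[b' b'A ->]; exists b'.
rewrite set_fsetK card_fseq undup_id ?size_map // map_inj_uniq // => b1 b2.
exact: eq_from_Tagged.
Qed.

Lemma measurable_missing x : measurable [set w | missing w = x].
Proof. exact: (unif.1 [set x]). Qed.

(** The event on the loops belongs to the sigma-algebra of the soup, and the conditional uniform
    mass is constant on it. *)
Lemma prob_missing b (A : seq zpair) b' : valid b -> uniq A ->
  (forall b', (b' \in A) = valid b' && `[< concatenation b' = concatenation b >]) ->
  b' \in A ->
  P (config hits (concatenation b) `&` [set w | missing w = tagged_pair b']) =
  ((size A)%:R^-1%:E * P (config hits (concatenation b)))%E.
Proof.
move=> vb uA hA b'A; rewrite unif.2; last exact: config_events countable_hits.
rewrite (eq_integral (cst (size A)%:R^-1%:E)) ?integral_cst //.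
  exact: config_measurable countable_hits.
by move=> w /set_mem cw; rewrite (admissible_config vb cw hA) uniform_mass_tagged.
Qed.

(** The constant [C(s)]. By [valid_count], dividing by [size A] and by [symmetry_weight] amounts to
    dividing by the number of relabellings, which depends on [s] alone. *)
Definition crossings_factor : R := expR (- fine (nu hits)) *
  (\prod_(c <- s) weight R g (darts_of c)) / #|label_perms s|%:R.

Definition bridge_event (b : zpair) : set Omega :=
  config hits (concatenation b) `&` [set w | missing w = tagged_pair b].

Lemma bridge_event_measurable b : measurable (bridge_event b).
Proof.
by apply: measurableI; [exact: config_measurable countable_hits | exact: measurable_missing].
Qed.

Lemma bridge_event_prob b : valid b -> P (bridge_event b) =
  (crossings_factor * (zbridge_weight R g b.1 * zbridge_weight R g b.2))%:E.
Proof.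
move=> vb; have [ls [lsP bls ec]] := concatenation_config vb.
have [A [uA hA szA]] := valid_count F12 s_cross vb bls lsP.
have bA : b \in A by rewrite hA vb; apply/asboolP.
rewrite /bridge_event (prob_missing vb uA hA bA) ec config_prob // -EFinM; congr _%:E.
rewrite (@prod_weight R Gam g _ ls predT (fun L => rloop_darts (repr L))).
rewrite (valid_size F12 s_cross vb bls lsP).
rewrite /crossings_factor /zbridge_weight !prod_weight -szA natrM !exprD !invfM.
by ring.
Qed.

(** The elements of [A] give disjoint events, each of probability [P E / size A], which therefore
    exhaust [E] up to a null set. *)
Lemma missing_admissible b : valid b -> P.-negligible (config hits (concatenation b) `\`
  \bigcup_(b' in [set b' | valid b']) bridge_event b').
Proof.
move=> vb; have [ls [lsP bls ec]] := concatenation_config vb.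
have [A [uA hA szA]] := valid_count F12 s_cross vb bls lsP.
set E := config hits (concatenation b).
have mE : measurable E by exact: config_measurable countable_hits.
pose U := \bigcup_(b' in [set` A]) (E `&` [set w | missing w = tagged_pair b']).
have cA : countable [set` A] by apply: finite_set_countable.
have mI b' : measurable (E `&` [set w | missing w = tagged_pair b']).
  by apply: measurableI => //; exact: measurable_missing.
have mU : measurable U by apply: countable_bigcup_measurable.
have A0 : (size A)%:R != 0 :> R.
  rewrite pnatr_eq0; have : b \in A by rewrite hA vb; apply/asboolP.
  by case: (A).
have PU : P U = P E.
  rewrite measure_countable_bigcup //; last first.
    by move=> b1 b2 _ _ [w [[_ /= m1] [_ /= m2]]]; apply: (@eq_from_Tagged nat); rewrite -m1 m2.
  rewrite (eq_esum (b := fun=> ((size A)%:R^-1%:E * P E)%E)); last first.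
    by move=> b' b'A; exact: prob_missing.
  rewrite esum_seq //; last by move=> _; rewrite mule_ge0 // lee_fin invr_ge0.
  rewrite big_const_seq count_predT.
  have fE : P E \is a fin_num by exact: fin_num_measure.
  rewrite -(fineK fE) -EFinM; set r := (_^-1 * _).
  have -> : iter (size A) (+%E r%:E) 0%E = (r *+ size A)%:E.
    by elim: (size A) => // k /= ->; rewrite -EFinD mulrS.
  by rewrite -mulr_natr /r mulrC mulrA mulfV // mul1r.
have UE : U `<=` E by move=> w [b' _ []].
have sub : E `\` \bigcup_(b' in [set b' | valid b']) bridge_event b' `<=` E `\` U.
  move=> w [Ew h]; split; first exact: Ew.
  case=> b' b'A [_ mb']; apply: h.
  have /andP[vb' /asboolP eb'] : valid b' && `[< concatenation b' = concatenation b >].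
    by rewrite -hA.
  exists b'; first exact: vb'.
  by split; [rewrite eb'; exact: Ew | exact: mb'].
apply: negligibleS sub _; apply/negligibleP; first exact: measurableD.
have Efin : (P E < +oo)%E by rewrite ltey_eq fin_num_measure.
have e : P (E `\` U) = (P E - P (E `&` U))%E by exact: measureD.
by rewrite (setIidr UE) PU subee ?fin_num_measure in e.
Qed.

(** Almost surely the crossing loops are listed by some [ls]; having the crossings [s], they are the
    concatenation of some valid pair, and [missing] is then a valid pair with this concatenation. *)
Lemma eta_bridge_events : P.-negligible ([set w | eta_is D F1 F2 R rule (soup w) s] `\`
  \bigcup_(b in [set b | valid b]) bridge_event b).
Proof.
apply: negligibleS (negligibleU ae_finite_crossings
  (negligible_countable_bigcup countable_valid (fun b vb => missing_admissible vb))).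
move=> w [/= eta_s nb].
case: (pselect (exists2 ls, (forall L, L \in ls -> crossing_loop L) &
    config hits (fun L => count_mem L ls) w)) => [[ls lsP cw]|]; last by left.
right; have h := (eta_config lsP cw s_rule s_cross).1 eta_s.
have [b vb bls] := valid_exists F12 s_cross lsP h.
exists b => //; split=> // L hL; rewrite bls; exact: cw.
Qed.

(* The crossings between [F1] and [F2] determine the configuration of the
   loops in [hit]: it has to be finite, hence is listed by some [ls]. *)
Lemma eta_measurable : measurable [set w | eta_is D F1 F2 R rule (soup w) s].
Proof.
pose hit := [set L | exists2 c, is_crossing D F1 F2 c & occ L (darts_of c) != 0%N].
have ch : countable hit.
  by apply: sub_countable countable_hits; apply: subset_card_le => L [c cc /(occ_hits cc)].
pose LS := [set ls : seq (uloop Gam) | {subset ls <= hit} /\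
  forall c, is_crossing D F1 F2 c -> count_mem c s = (\sum_(L <- ls) occ L (darts_of c))%N].
have cLS : countable LS.
  have [f f_inj] := countable_injP _ ch.
  apply/countable_injP; exists (fun ls => choice.pickle (map f ls)) => ls ls'.
  rewrite !inE => -[sub _] [sub' _] /(pcan_inj choice.pickleK).
  elim: ls ls' sub sub' => [|L ls IH] [|L' ls'] //= sub sub' [e1 e2].
  rewrite (f_inj L L' (sub _ (mem_head _ _)) (sub' _ (mem_head _ _)) e1).
  by rewrite (IH ls') // => L0 h; [apply: sub | apply: sub']; rewrite inE h orbT.
have mult_config w ls c : {subset ls <= hit} -> config hit (fun L => count_mem L ls) w ->
    is_crossing D F1 F2 c ->
    crossing_mult D F1 F2 R (soup w) c = (\sum_(L <- ls) occ L (darts_of c))%N%:R%:E.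
  move=> sub cw cc; rewrite /crossing_mult cc.
  apply: (@esum_count_mem R _ (soup w) hit ls (fun L => occ L (darts_of c))) => //.
  by move=> L; exists c.
suff -> : [set w | eta_is D F1 F2 R rule (soup w) s] =
    \bigcup_(ls in LS) config hit (fun L => count_mem L ls).
  by apply: countable_bigcup_measurable => // ls _; exact: config_measurable.
apply/seteqP; split=> w /=; last first.
  case=> ls [sub h] cw; split=> // c; case cc: (is_crossing D F1 F2 c).
    by rewrite (mult_config w ls) // h.
  rewrite /crossing_mult cc (count_memPn _) //.
  by apply/negP => /s_cross; rewrite cc.
move=> eta_s; have [_ hs] := eta_s.
(* Every loop of the soup in [hit] contributes a crossing, which must occur in [s]; the number of
   such loops is thus bounded by the multiplicities of the crossings of [s]. *)
have fin : (npoints R (soup w) hit < +oo)%E.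
  apply: (@le_lt_trans _ _ (\esum_(L in setT) \sum_(c <- undup s)
     (soup w L * occ L (darts_of c))%N%:R%:E)%E).
    apply: (@le_trans _ _ (\esum_(L in hit) \sum_(c <- undup s)
     (soup w L * occ L (darts_of c))%N%:R%:E)%E); last by apply: esum_subset.
    apply: le_esum => L [c cc oc]; case: (posnP (soup w L)) => [->|n0].
      by apply: sume_ge0 => c' _; rewrite lee_fin.
    have cs : c \in undup s.
      rewrite mem_undup -[c \in s]negbK; apply/negP => /count_memPn c0.
      have := hs c; rewrite c0 /crossing_mult cc => /eqP; rewrite eq_le => /andP[h _].
      have : ((soup w L * occ L (darts_of c))%N%:R%:E <= (0%:R%:E : \bar R))%E.
        apply: le_trans h; rewrite -[leLHS](@esum_set1 R _ L (fun L =>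
          (soup w L * occ L (darts_of c))%N%:R%:E)) ?lee_fin //.
        exact: esum_subset.
      by rewrite lee_fin ler_nat leqn0 muln_eq0 (negPf oc) orbF; case: (soup w L) n0.
    rewrite (bigD1_seq c) ?undup_uniq //=; apply: le_trans (leeDl _ _).
      by rewrite lee_fin ler_nat leq_pmulr // lt0n.
    by apply: sume_ge0 => c' _; rewrite lee_fin.
  rewrite esum_sum; last by move=> L c _ _; rewrite lee_fin.
  rewrite big_seq_cond; apply: lte_sum_pinfty => c; rewrite andbT mem_undup => cs.
  by have := hs c; rewrite /crossing_mult s_cross // => ->; rewrite ltry.
have [ls sub lsE] := npoints_finite fin; exists ls => //; split=> // c cc.
by have := hs c; rewrite (mult_config w ls) // => -[] /eqP; rewrite eqr_nat => /eqP.
Qed.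

(** Up to a null set, the event is the disjoint union of the [bridge_event b] over the valid [b] in
    [B]. *)
Lemma eta_missing_prob (B : set zpair) :
  P ([set w | eta_is D F1 F2 R rule (soup w) s] `&`
     [set w | exists2 b, missing w = tagged_pair b & B b]) =
  (\esum_(b in [set b | valid b /\ B b])
    (crossings_factor * (zbridge_weight R g b.1 * zbridge_weight R g b.2))%:E)%E.
Proof.
set H := [set w | eta_is D F1 F2 R rule (soup w) s].
set X := H `&` _; pose V := [set b : zpair | valid b /\ B b].
have cV : countable V.
  by apply: sub_countable countable_valid; apply: subset_card_le => b [].
pose Y := \bigcup_(b in V) bridge_event b.
have mY : measurable Y.
  by apply: countable_bigcup_measurable => // b _; exact: bridge_event_measurable.
have mX : measurable X.
  apply: measurableI; first exact: eta_measurable.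
  exact: (unif.1 [set x | exists2 b, x = tagged_pair b & B b]).
have YX : Y `<=` X.
  move=> w [b [vb Bb] [cw mw]]; split; first exact: (eta_concatenation vb).
  by exists b.
have XY0 : P (X `\` Y) = 0%E.
  apply/negligibleP; first exact: measurableD.
  apply: negligibleS eta_bridge_events => w [[Hw [b0 mb0 Bb0]] nY]; split=> //.
  case=> b /= vb hb; apply: nY; exists b => //; split=> //.
  by have [_ /= mb] := hb; rewrite mb0 in mb; rewrite -(eq_from_Tagged mb).
have -> : P X = P Y.
  have e : P (Y `|` (X `\` Y)) = (P Y + P (X `\` Y))%E.
    by apply: measureU => //; [exact: measurableD | rewrite setDIK].
  by rewrite -[in LHS](setDUK YX) e XY0 adde0.
rewrite measure_countable_bigcup //; last 2 first.
- by move=> b _; exact: bridge_event_measurable.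
- by move=> b1 b2 _ _ [w [[_ /= m1] [_ /= m2]]]; apply: (@eq_from_Tagged nat); rewrite -m1 m2.
by apply: eq_esum => b [vb _]; exact: bridge_event_prob.
Qed.

Local Notation D1 := (remove_vertices D F1).
Local Notation D2 := (remove_vertices D F2).

Lemma green_remove_fin (F : {fset vertex Gam}) x y :
  (green R g (remove_vertices D F) x y < +oo)%E.
Proof.
case: (pselect (sverts D x /\ sverts D y)) => [[xD yD]|no].
  apply: le_lt_trans (fin_green xD yD); apply: esum_subset => b.
  exact: bridge_remove.
rewrite /green (_ : [set b | _] = set0) ?esum_set0 //; apply/seteqP; split=> // b /=.
move/bridge_remove/bridge_verts/andP => [/set_mem xD /set_mem yD].
by case: no.
Qed.

Lemma crossings_factor_ge0 : 0 <= crossings_factor.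
Proof.
rewrite divr_ge0 // mulr_ge0 ?expR_ge0 //; apply: prodr_ge0 => c _.
exact: weight_ge0.
Qed.

(** The source of independence: validity of a pair is a condition on each bridge separately and its
    weight is a product, so the sum over pairs factorises. *)
Lemma eta_missing_product (S S' : set (zbridge Gam n)) :
  P ([set w | eta_is D F1 F2 R rule (soup w) s] `&`
     [set w | exists beta beta' : zbridge Gam n,
        [/\ missing w = tagged_pair (beta, beta'), S beta & S' beta']]) =
  (crossings_factor%:E * (zbridge_weights R g D1 (@endpoints2 _ s) S *
    zbridge_weights R g D2 (@endpoints1 _ s) S'))%E.
Proof.
rewrite (_ : [set w | exists beta, _] =
    [set w | exists2 b : zpair, missing w = tagged_pair b & S b.1 /\ S' b.2]); last first.
  apply/seteqP; split=> w /=.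
    by case=> beta [beta' [h1 h2 h3]]; exists (beta, beta').
  by case=> -[beta beta'] h1 [h2 h3]; exists beta, beta'.
rewrite (eta_missing_prob [set b | S b.1 /\ S' b.2]).
have wge0 (b : zbridge Gam n) : 0 <= zbridge_weight R g b by exact: zbridge_weight_ge0.
rewrite (eq_esum (b := fun b : zpair => (crossings_factor%:E *
  (zbridge_weight R g b.1 * zbridge_weight R g b.2)%:E)%E)) //.
rewrite esumZl ?crossings_factor_ge0 //; last by move=> b; rewrite lee_fin mulr_ge0.
congr (_ * _)%E; rewrite /zbridge_weights -esum_setX //; last first.
  exact: (le_lt_trans (@zbridge_weights_le R Gam g D2 n (@endpoints1 _ s)
    (green_remove_fin F2) S') (ltry _)).
congr esum; apply/seteqP; split=> -[beta beta'] /=.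
  by case=> /andP[h1 h2] [h3 h4].
by case=> -[h1 h2] [h3 h4]; split=> //; rewrite /valid h1 h3.
Qed.

(** The product identity with both sets of bridges full: given the crossings [s], the missing parts
    are almost surely a pair of bridges with [size s] labels. *)
Lemma eta_prob : P [set w | eta_is D F1 F2 R rule (soup w) s] =
  (crossings_factor%:E * ((pairing_total R g D1 (@endpoints2 _ s))%:E *
    (pairing_total R g D2 (@endpoints1 _ s))%:E))%E.
Proof.
rewrite -!zbridge_weightsT; try exact: green_remove_fin.
rewrite -eta_missing_product.
set H := [set w | eta_is D F1 F2 R rule (soup w) s]; set M := [set w | _].
have mM : measurable M.
  exact: (unif.1 [set x | exists beta beta' : zbridge Gam n,
    [/\ x = tagged_pair (beta, beta'), setT beta & setT beta']]).
have mH : measurable H by exact: eta_measurable.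
have mHM : measurable (H `&` M) by exact: measurableI.
have e : P ((H `&` M) `|` (H `\` (H `&` M))) = (P (H `&` M) + P (H `\` (H `&` M)))%E.
  by apply: measureU => //; [exact: measurableD | rewrite setDIK].
rewrite -[in LHS](setDUK (@subIsetl _ H M)) e.
suff -> : P (H `\` (H `&` M)) = 0%E by rewrite adde0.
apply/negligibleP; first exact: measurableD.
apply: negligibleS eta_bridge_events => w [Hw nM]; split=> // -[[beta beta'] /= _ [_ mw]].
by apply: nM; split=> //; exists beta, beta'.
Qed.

End FixedCrossings.

End Soup.

Theorem proposition4 (R : realType) (Gam : graph) (g : nat)
    (D : subgraph Gam) (F1 F2 : {fset vertex Gam})
    (rule : seq (nepath Gam) -> seq (nepath Gam))
    (d : measure_display) (Omega : measurableType d) (P : probability Omega R)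
    (soup : Omega -> uloop Gam -> nat)
    (missing : Omega -> {m : nat & zbridge_pair Gam m}) :
  regular Gam g ->
  finite_green R g D ->
  [set` F1] `<=` sverts D -> [set` F2] `<=` sverts D ->
  [disjoint F1 & F2]%fset ->
  ordering_rule rule ->
  poisson_point_process P soup (nu R g D) ->
  uniform_given P soup missing (admissible R D F1 F2 rule) ->
  {ae P, forall w, exists s, eta_is D F1 F2 R rule (soup w) s} /\
  forall (s : seq (nepath Gam)) (S S' : set (zbridge Gam (size s))),
    P ([set w | eta_is D F1 F2 R rule (soup w) s] `&`
       [set w | exists beta beta' : zbridge Gam (size s),
          [/\ missing w = Tagged (zbridge_pair Gam) (beta, beta'),
              S beta & S' beta']]) =
    (P [set w | eta_is D F1 F2 R rule (soup w) s] *
     (zbridge_measure R g (remove_vertices D F1) (@endpoints2 Gam s) S *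
      zbridge_measure R g (remove_vertices D F2) (@endpoints1 Gam s) S'))%E.
Proof.
move=> reg fin_green F1D _ F12 hrule ppp unif.
split; first exact: (eta_ae fin_green F1D F12 hrule ppp).
move=> s S S'.
(* A single outcome with crossings [s] shows that [s] is ordered by [rule] and made of crossings; if
   there is none, both sides vanish. *)
have [[w eta_s]|no] := pselect (exists w, eta_is D F1 F2 R rule (soup w) s); last first.
  have -> : [set w | eta_is D F1 F2 R rule (soup w) s] = set0.
    by apply/seteqP; split=> // w eta_s; apply: no; exists w.
  by rewrite set0I measure0 mul0e.
have s_rule := eta_rule eta_s; have s_cross := eta_crossing eta_s.
rewrite (eta_missing_product reg fin_green F1D F12 hrule ppp unif s_rule s_cross).
rewrite (eta_prob reg fin_green F1D F12 hrule ppp unif s_rule s_cross).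
(* Each weight becomes a total times a probability, and the totals regroup with [C(s)] into the
   probability of the list of crossings. *)
rewrite !zbridge_weights_total; try exact: green_remove_fin.
by rewrite [X in (_ * X)%E = _]muleACA [LHS]muleA.
Qed.
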